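(* Notation: for real-valued smooth functions $W_\pm,X_\pm,Y_\pm,Z_\pm$ of $(u,v)$ put $\Delta_{\pm}=W_{\mp}X_{\pm}+Y_{\pm}Z_{\mp}$ and, where $\Delta_\pm\neq0$ (upper signs throughout or lower signs throughout), $$A_{\pm}=\mp\frac{1}{\Delta_{\pm}}\Big[-X_{\pm}\big((Y_{\pm})_v\mp(X_{\pm})_u\big)+Z_{\mp}\big((W_{\mp})_v\pm(Z_{\mp})_u\big)\Big],$$ $$B_{\mp}=-\frac{1}{\Delta_{\pm}}\Big[Y_{\pm}\big((Y_{\pm})_v\mp(X_{\pm})_u\big)+W_{\mp}\big((W_{\mp})_v\pm(Z_{\mp})_u\big)\Big].$$ (1) Let $N$ be an oriented $4$-dimensional Riemannian space form of constant sectional curvature $L_0\neq0$, $M$ a Riemann surface, and $F:M\to N$ a conformal immersion whose twistor lifts $\Theta_{\pm,1}$ are nondegenerate. Then for any local data $(u,v),\lambda,N_1,N_2$ as in the context (with $(T_1,T_2,N_1,N_2)$ positively oriented), the associated functions satisfy $\Delta_\pm\neq0$, $(A_{\pm},B_{\mp})=(\phi_{\pm},\psi_{\mp})$, and, with $f=L_0e^{2\lambda}$, $f_u=f(A_++A_-)$, $f_v=f(B_++B_-)$. (2) Conversely, let $L_0\neq0$ be a real number, $D\subset\mathbb{R}^2$ a simply connected domain with coordinates $(u,v)$, and $W_\pm,X_\pm,Y_\pm,Z_\pm$ real-valued smooth functions on $D$ with $W_++W_-=X_++X_-$, $Y_++Y_-=Z_++Z_-$, $\Delta_\pm\neq0$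 everywhere, and $\Delta_+-\Delta_-=(A_+-A_-)_u-(B_+-B_-)_v$. Suppose that $f:=\Delta_+-(A_+)_u-(B_-)_v$ $(=\Delta_--(A_-)_u-(B_+)_v)$ is nowhere zero, $f/L_0>0$, and $f_u=f(A_++A_-)$, $f_v=f(B_++B_-)$. Then these give a conformal immersion $F$ of $D$ into the $4$-dimensional Riemannian space form $N$ of constant sectional curvature $L_0$: namely $F$ has induced metric $e^{2\lambda}(du^2+dv^2)$ with $\lambda=\frac12\log(f/L_0)$, and for suitable normal fields $N_1,N_2$ as in the context and an orientation of $N$ making $(T_1,T_2,N_1,N_2)$ positively oriented, its associated functions $W_\pm,X_\pm,Y_\pm,Z_\pm$ are the given ones. The twistor lifts of $F$ are nondegenerate, and $F$ is unique up to an isometry of $N$.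
   Context: $N$ is realized as $\{x\in E^5:\langle x,x\rangle=1/L_0\}$ if $L_0>0$ and as $\{x\in E^5_1:\langle x,x\rangle=1/L_0\}$ if $L_0<0$; $h$ its metric, $\nabla$ its Levi-Civita connection. For a conformal immersion $F$ of a Riemann surface into $N$: take local isothermal coordinates $(u,v)$, induced metric $e^{2\lambda}(du^2+dv^2)$, $T_1=dF(\partial_u)$, $T_2=dF(\partial_v)$, and normal fields $N_1,N_2$ with $h(N_1,N_1)=h(N_2,N_2)=e^{2\lambda}$, $h(N_1,N_2)=0$. Define $\alpha_k,\beta_k,\mu_l$ by $\sigma(T_1,T_1)=\alpha_1N_1+\beta_1N_2$, $\sigma(T_1,T_2)=\alpha_2N_1+\beta_2N_2$, $\sigma(T_2,T_2)=\alpha_3N_1+\beta_3N_2$ ($\sigma$ the second fundamental form), $\nabla^\perp_{\partial_u}N_1=\lambda_uN_1+\mu_1N_2$, $\nabla^\perp_{\partial_v}N_1=\lambda_vN_1+\mu_2N_2$. Associated functions: $W_\pm=\alpha_2\pm\beta_1$, $X_\pm=\alpha_2\pm\beta_3$, $Y_\pm=\beta_2\pm\alpha_1$, $Z_\pm=\beta_2\pm\alpha_3$, $\phi_\pm=\lambda_u\mp\mu_2$, $\psi_\pm=\lambda_v\mp\mu_1$. With $e_1,\dots,e_4=e^{-\lambda}(T_1,T_2,N_1,N_2)$ and $(T_1,T_2,N_1,N_2)$ positively oriented, the twistor lifts are $\Theta_{\pm,1}=\frac1{\sqrt2}(e_1\wedge e_2\pm e_3\wedge e_4)$; they are nondegenerate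 if for each $\varepsilon\in\{+,-\}$, $\hat\nabla_{T_1}\Theta_{\varepsilon,1}$ and $\hat\nabla_{T_2}\Theta_{\varepsilon,1}$ are linearly independent at each point, $\hat\nabla$ being the connection on $\bigwedge^2F^*TN$ induced by $\nabla$. *)

(* Defs.v *)
From Stdlib Require Import Reals Lra.
From Coquelicot Require Import Coquelicot.
Open Scope R_scope.

(* Vectors of R^5 as functions nat -> R; only indices 0..4 are meaningful. *)
Definition Vec := nat -> R.

(* signature: E^5 if L0 > 0, E^5_1 (index 4 timelike) if L0 < 0 *)
Definition sgnL (L0 : R) : R := if Rlt_dec 0 L0 then 1 else -1.

Definition ip (L0 : R) (x y : Vec) : R :=
  x 0%nat * y 0%nat + x 1%nat * y 1%nat + x 2%nat * y 2%nat + x 3%nat * y 3%nat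
  + sgnL L0 * (x 4%nat * y 4%nat).

Definition vscal (a : R) (x : Vec) : Vec := fun i => a * x i.
Definition vadd (x y : Vec) : Vec := fun i => x i + y i.

(* tangential projection onto T_x N, N = {<x,x> = 1/L0} *)
Definition tanproj (L0 : R) (x w : Vec) : Vec :=
  fun i => w i - L0 * ip L0 w x * x i.

Fixpoint detn (n : nat) (M : nat -> nat -> R) : R :=
  match n with
  | O => 1
  | S m => sum_f_R0 (fun j => (-1) ^ j * M 0%nat j *
             detn m (fun i k => M (S i) (if Nat.ltb k j then k else S k))) m
  end.

Definition rows5 (a b c d e : Vec) : nat -> nat -> R :=
  fun i j => match i with
             | 0%nat => a j | 1%nat => b j | 2%nat => c j | 3%nat => d j
             | _ => e j end.

(* bivectors in /\^2 R^5 as antisymmetric arrays *)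
Definition Biv := nat -> nat -> R.
Definition wedge (a b : Vec) : Biv := fun i j => a i * b j - a j * b i.
Definition badd (P Q : Biv) : Biv := fun i j => P i j + Q i j.
Definition bscal (c : R) (P : Biv) : Biv := fun i j => c * P i j.

Definition lin_indep2 (P Q : Biv) : Prop :=
  forall a b : R,
    (forall i j, (i < 5)%nat -> (j < 5)%nat -> a * P i j + b * Q i j = 0) ->
    a = 0 /\ b = 0.

Definition du (g : R -> R -> R) : R -> R -> R :=
  fun u v => Derive (fun t => g t v) u.
Definition dv (g : R -> R -> R) : R -> R -> R :=
  fun u v => Derive (fun t => g u t) v.

Definition dU (F : R -> R -> Vec) : R -> R -> Vec :=
  fun u v i => Derive (fun t => F t v i) u.
Definition dV (F : R -> R -> Vec) : R -> R -> Vec :=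
  fun u v i => Derive (fun t => F u t i) v.

Definition pdir (b : bool) (g : R -> R -> R) : R -> R -> R :=
  if b then du g else dv g.
Definition iterpd (l : list bool) (g : R -> R -> R) : R -> R -> R :=
  List.fold_right pdir g l.

Definition smooth_on (D : R * R -> Prop) (g : R -> R -> R) : Prop :=
  forall (l : list bool) (u v : R), D (u, v) ->
    ex_derive (fun t => iterpd l g t v) u /\
    ex_derive (fun t => iterpd l g u t) v /\
    continuous (fun p : R * R => iterpd l g (fst p) (snd p)) (u, v).

Definition vsmooth_on (D : R * R -> Prop) (F : R -> R -> Vec) : Prop :=
  forall i, (i < 5)%nat -> smooth_on D (fun u v => F u v i).

(* Levi-Civita connection of N along F: nabla_{d_u} V, nabla_{d_v} V *)
Definition nab_u (L0 : R) (F V : R -> R -> Vec) : R -> R -> Vec :=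
  fun u v => tanproj L0 (F u v) (dU V u v).
Definition nab_v (L0 : R) (F V : R -> R -> Vec) : R -> R -> Vec :=
  fun u v => tanproj L0 (F u v) (dV V u v).

Definition sg (s : bool) : R := if s then 1 else -1.

Section Frame.
Variables (L0 : R) (F : R -> R -> Vec) (lam : R -> R -> R) (N1 N2 : R -> R -> Vec).

Definition e2l (u v : R) : R := exp (2 * lam u v).
Definition T1 := dU F.
Definition T2 := dV F.

(* sigma(T1,T1) = a1 N1 + b1 N2 etc.; since N1, N2 are orthogonal with
   h(Ni,Ni) = e^{2 lam} and orthogonal to T1,T2, the coefficient of N1 in the
   normal part of w is h(w,N1)/e^{2 lam}. *)
Definition al1 u v := ip L0 (nab_u L0 F T1 u v) (N1 u v) / e2l u v.
Definition be1 u v := ip L0 (nab_u L0 F T1 u v) (N2 u v) / e2l u v.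
Definition al2 u v := ip L0 (nab_u L0 F T2 u v) (N1 u v) / e2l u v.
Definition be2 u v := ip L0 (nab_u L0 F T2 u v) (N2 u v) / e2l u v.
Definition al3 u v := ip L0 (nab_v L0 F T2 u v) (N1 u v) / e2l u v.
Definition be3 u v := ip L0 (nab_v L0 F T2 u v) (N2 u v) / e2l u v.
(* nabla^perp_{d_u} N1 = lam_u N1 + mu1 N2, nabla^perp_{d_v} N1 = lam_v N1 + mu2 N2 *)
Definition mu1 u v := ip L0 (nab_u L0 F N1 u v) (N2 u v) / e2l u v.
Definition mu2 u v := ip L0 (nab_v L0 F N1 u v) (N2 u v) / e2l u v.

Definition Wf (s : bool) u v := al2 u v + sg s * be1 u v.
Definition Xf (s : bool) u v := al2 u v + sg s * be3 u v.
Definition Yf (s : bool) u v := be2 u v + sg s * al1 u v.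
Definition Zf (s : bool) u v := be2 u v + sg s * al3 u v.
Definition phif (s : bool) u v := du lam u v - sg s * mu2 u v.
Definition psif (s : bool) u v := dv lam u v - sg s * mu1 u v.

Definition ef1 : R -> R -> Vec := fun u v => vscal (exp (- lam u v)) (T1 u v).
Definition ef2 : R -> R -> Vec := fun u v => vscal (exp (- lam u v)) (T2 u v).
Definition ef3 : R -> R -> Vec := fun u v => vscal (exp (- lam u v)) (N1 u v).
Definition ef4 : R -> R -> Vec := fun u v => vscal (exp (- lam u v)) (N2 u v).

Definition Theta (s : bool) u v : Biv :=
  bscal (/ sqrt 2) (badd (wedge (ef1 u v) (ef2 u v))
                         (bscal (sg s) (wedge (ef3 u v) (ef4 u v)))).

(* induced connection on /\^2 F^*TN (Leibniz rule) applied to Theta *)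
Definition nabhat_Theta (nab : (R -> R -> Vec) -> R -> R -> Vec) (s : bool) u v : Biv :=
  bscal (/ sqrt 2)
    (badd (badd (wedge (nab ef1 u v) (ef2 u v)) (wedge (ef1 u v) (nab ef2 u v)))
          (bscal (sg s) (badd (wedge (nab ef3 u v) (ef4 u v))
                              (wedge (ef3 u v) (nab ef4 u v))))).

Definition twistor_nondeg (D : R * R -> Prop) : Prop :=
  forall s u v, D (u, v) ->
    lin_indep2 (nabhat_Theta (nab_u L0 F) s u v) (nabhat_Theta (nab_v L0 F) s u v).

(* local data: F is a smooth conformal immersion of D into N (isothermal
   coordinates (u,v), metric e^{2 lam}(du^2+dv^2)), N1,N2 smooth normal fields
   with h(Ni,Ni) = e^{2 lam}, h(N1,N2) = 0, and (T1,T2,N1,N2) positively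
   oriented for the orientation o of N (o = 1 or -1; a basis (a,b,c,d) of
   T_x N is positive iff o * det(x,a,b,c,d) > 0). *)
Definition local_data (D : R * R -> Prop) (o : R) : Prop :=
  vsmooth_on D F /\ smooth_on D lam /\ vsmooth_on D N1 /\ vsmooth_on D N2 /\
  (o = 1 \/ o = -1) /\
  forall u v, D (u, v) ->
    ip L0 (F u v) (F u v) = / L0 /\
    ip L0 (T1 u v) (T1 u v) = e2l u v /\
    ip L0 (T2 u v) (T2 u v) = e2l u v /\
    ip L0 (T1 u v) (T2 u v) = 0 /\
    ip L0 (N1 u v) (F u v) = 0 /\ ip L0 (N2 u v) (F u v) = 0 /\
    ip L0 (N1 u v) (T1 u v) = 0 /\ ip L0 (N1 u v) (T2 u v) = 0 /\
    ip L0 (N2 u v) (T1 u v) = 0 /\ ip L0 (N2 u v) (T2 u v) = 0 /\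
    ip L0 (N1 u v) (N1 u v) = e2l u v /\
    ip L0 (N2 u v) (N2 u v) = e2l u v /\
    ip L0 (N1 u v) (N2 u v) = 0 /\
    0 < o * detn 5 (rows5 (F u v) (T1 u v) (T2 u v) (N1 u v) (N2 u v)).

End Frame.

Section Coefs.
Variables (W X Y Z : bool -> R -> R -> R).

Definition Dlt (s : bool) u v := W (negb s) u v * X s u v + Y s u v * Z (negb s) u v.

Definition brk1 (s : bool) u v := dv (Y s) u v - sg s * du (X s) u v.
Definition brk2 (s : bool) u v := dv (W (negb s)) u v + sg s * du (Z (negb s)) u v.

Definition Acoef (s : bool) u v :=
  - sg s / Dlt s u v *
  (- X s u v * brk1 s u v + Z (negb s) u v * brk2 s u v).

(* B_{-s} (computed with Delta_s) *)
Definition Bneg (s : bool) u v :=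
  - / Dlt s u v *
  (Y s u v * brk1 s u v + W (negb s) u v * brk2 s u v).

Definition Bcoef (t : bool) u v := Bneg (negb t) u v.

End Coefs.

Definition unit_I (t : R) : Prop := 0 <= t <= 1.

Definition path_in (D : R * R -> Prop) (g : R -> R * R) : Prop :=
  (forall t, continuous g t) /\ (forall t, unit_I t -> D (g t)).

Definition simply_connected_domain (D : R * R -> Prop) : Prop :=
  open D /\ (exists p, D p) /\
  (forall p q, D p -> D q -> exists g, path_in D g /\ g 0 = p /\ g 1 = q) /\
  (forall g, path_in D g -> g 0 = g 1 ->
     exists H : R * R -> R * R,
       (forall z, continuous H z) /\
       (forall s t, unit_I s -> unit_I t -> D (H (s, t))) /\
       (forall t, H (0, t) = g t) /\
       (forall t, H (1, t) = g 0) /\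
       (forall s, H (s, 0) = g 0 /\ H (s, 1) = g 0)).

(* linear isometries of the ambient E^5 / E^5_1 (these restrict to N and give
   all isometries of N) *)
Definition mapply (P : nat -> nat -> R) (x : Vec) : Vec :=
  fun i => sum_f_R0 (fun j => P i j * x j) 4.

Definition lin_isometry (L0 : R) (P : nat -> nat -> R) : Prop :=
  forall x y : Vec, ip L0 (mapply P x) (mapply P y) = ip L0 x y.

(* Main.v *)
(** The frame E = (F, T_1, T_2, N_1, N_2) along F is orthogonal in E^5 or E^5_1 and satisfies a
    linear system E_u = P E, E_v = Q E whose coefficients are f = L_0 e^(2 lambda), the first
    derivatives of lambda and the functions alpha_k, beta_k, mu_l.  In terms of W, X, Y, Z the
    Codazzi part of P_v + P Q = Q_u + Q P is, for each sign, a linear 2 x 2 system for (phi, psi)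
    with determinant Delta, so Cramer's rule gives phi = A and psi = B; and
    nabla-hat Theta_u, nabla-hat Theta_v are linearly independent exactly when Delta does not
    vanish.  Conversely, the hypotheses of (2) are the Codazzi, Ricci and Gauss equations, that
    is, the integrability of the system, so it has global solutions on a simply connected domain:
    they exist locally by integrating along u and then along v, and are continued along homotopies.
    For two matrix solutions E, E' the matrix E^T g^-1 E' (g the diagonal matrix of the squared
    lengths) is constant: for E = E' this propagates orthogonality from one point to the whole
    domain, and for two immersions with the same data it yields the ambient isometry. *)

Require Import Defs.
From Stdlib Require Import Reals Lra Lia ClassicalEpsilon.
From Coquelicot Require Import Coquelicot.
From mathcomp Require all_boot all_algebra Rstruct.
Open Scope R_scope.

(** * Inverses of real square matrices *)

(** Differentiability is slice-wise throughout: a smooth function has continuous iterated partials,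
    and a flat section has two partial derivatives at each point. Integrating along [u] and then
    along [v] yields the [v]-equation everywhere but the [u]-equation only on the starting line, and
    transporting the latter is the main analytic obstacle. Instead of differentiating solutions with
    respect to a parameter, the proof estimates the first order defect of the candidate, on squares
    so small that the equation is a contraction. The same smallness gives uniqueness from any point
    of such a square, which is what lifting over subdivided squares rests on. The systems are solved
    for one column of the matrix [E] at a time (its rows are the frame vectors, its columns their
    ambient coordinates), whereas [E J E^T = g], with [J] the ambient metric, relates rows. From
    [P g + g P^T = g_u], and likewise for [Q], the entries of [E^T g^-1 E] are constant; and
    [E^T g^-1 E = J] is equivalent to [E J E^T = g], because a one-sided inverse of a square matrix
    is two-sided. *)

Definition kron (i j : nat) : R := if Nat.eqb i j then 1 else 0.

Module SquareMatrices.
Import all_boot all_algebra Rstruct.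
Import GRing.Theory.
Local Open Scope ring_scope.

Lemma sum_f_R0_big (f : nat -> R) (n : nat) :
  sum_f_R0 f n = \sum_(i < n.+1) f i.
Proof.
elim: n => [|n IHn]; first by rewrite big_ord_recr big_ord0 /= add0r.
by rewrite big_ord_recr /= -IHn.
Qed.

Definition to_mx (n : nat) (A : nat -> nat -> R) : 'M[R]_n := \matrix_(i, j) A i j.

Lemma kronE n (i j : 'I_n) : kron i j = (i == j)%:R.
Proof.
rewrite /kron -val_eqE /=.
by case: eqP => [->|/Nat.eqb_neq ->]; rewrite ?Nat.eqb_refl.
Qed.

Lemma mx_mul_eq1 (n : nat) (A B : nat -> nat -> R) :
  (forall i j, (i <= n)%coq_nat -> (j <= n)%coq_nat ->
     sum_f_R0 (fun k => Rmult (A i k) (B k j)) n = kron i j) ->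
  to_mx n.+1 A *m to_mx n.+1 B = 1%:M.
Proof.
move=> AB1; apply/matrixP=> i j; rewrite !mxE -kronE -AB1.
- by rewrite sum_f_R0_big; apply: eq_bigr => k _; rewrite !mxE.
- by apply/leP; rewrite -ltnS.
- by apply/leP; rewrite -ltnS.
Qed.

(** This exchanges orthogonality relations between the rows of a frame matrix with relations between
    its columns. *)
Lemma right_inverse_left_inverse (n : nat) (A B : nat -> nat -> R) :
  (forall i j, (i <= n)%coq_nat -> (j <= n)%coq_nat ->
     sum_f_R0 (fun k => Rmult (A i k) (B k j)) n = kron i j) ->
  forall i j, (i <= n)%coq_nat -> (j <= n)%coq_nat ->
     sum_f_R0 (fun k => Rmult (B i k) (A k j)) n = kron i j.
Proof.
move=> /mx_mul_eq1 /mulmx1C /matrixP BA1 i j /leP ilen /leP jlen.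
have := BA1 (Ordinal (ilen : (i < n.+1)%N)) (Ordinal (jlen : (j < n.+1)%N)).
rewrite !mxE -kronE /= => <-; rewrite sum_f_R0_big.
by apply: eq_bigr => k _; rewrite !mxE.
Qed.

Lemma detnE (n : nat) (A : nat -> nat -> R) : detn n A = \det (to_mx n A).
Proof.
elim: n A => [|n IHn] A; first by rewrite det_mx00.
rewrite (expand_det_row _ ord0) /= sum_f_R0_big; apply: eq_bigr => j _.
rewrite mxE /cofactor /= add0n IHn.
(* The re-indexing [if k < j then k else S k] is [bump j], so the recursive minor is the matrix with
   row 0 and column [j] deleted. *)
have -> : to_mx n (fun i k => A (S i) (if Nat.ltb k j then k else S k))
          = row' ord0 (col' j (to_mx n.+1 A)).
  apply/matrixP=> i k; rewrite !mxE /= /bump /=.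
  congr (A _ _); rewrite leqNgt.
  by case: ltnP => /= [/ltP/Nat.ltb_lt -> | /leP/Nat.ltb_ge ->].
rewrite -RpowE mulrA; congr (_ * _).
by rewrite mulrC.
Qed.

Lemma detn_neq0 (n : nat) (A B : nat -> nat -> R) :
  (forall i j, (i <= n)%coq_nat -> (j <= n)%coq_nat ->
     sum_f_R0 (fun k => Rmult (A i k) (B k j)) n = kron i j) ->
  detn n.+1 A <> 0.
Proof.
move=> /mx_mul_eq1 AB1; rewrite detnE => detA0.
by move/(congr1 determinant)/eqP: AB1; rewrite det_mulmx detA0 mul0r det1 eq_sym oner_eq0.
Qed.

End SquareMatrices.

(** * Smooth functions on plane domains *)

Definition cont_on (D : R * R -> Prop) (g : R -> R -> R) : Prop :=
  forall u v, D (u, v) -> continuous (fun p : R * R => g (fst p) (snd p)) (u, v).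

Definition has_partials (D : R * R -> Prop) (g gu gv : R -> R -> R) : Prop :=
  forall u v, D (u, v) ->
    is_derive (fun t => g t v) u (gu u v) /\ is_derive (fun t => g u t) v (gv u v).

(** Regularity of finite order, on which closure under products and composition goes by induction;
    [smooth_on] quantifies over words of derivatives instead, where a product does not stay a
    product. The partials are any functions with the right values on [D]. *)
Fixpoint Ck (k : nat) (D : R * R -> Prop) (g : R -> R -> R) : Prop :=
  cont_on D g /\
  match k with
  | O => True
  | S k => exists gu gv, has_partials D g gu gv /\ Ck k D gu /\ Ck k D gv
  end.

Lemma Ck_cont k D g : Ck k D g -> cont_on D g.
Proof. destruct k; simpl; tauto. Qed.

Lemma Ck_pred k D g : Ck (S k) D g -> Ck k D g.
Proof.
  revert g; induction k as [|k IH]; intros g [Hc [gu [gv [Hp [Hu Hv]]]]].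
  - split; trivial.
  - split; [exact Hc|]. exists gu, gv. split; [exact Hp | split; apply IH; assumption].
Qed.

Lemma open_slice_u D (u v : R) : open D -> D (u, v) -> locally u (fun t => D (t, v)).
Proof.
  intros HD Huv. destruct (HD (u, v) Huv) as [e He].
  exists e; intros t Ht. apply He. split; [exact Ht | apply ball_center].
Qed.

Lemma open_slice_v D (u v : R) : open D -> D (u, v) -> locally v (fun t => D (u, t)).
Proof.
  intros HD Huv. destruct (HD (u, v) Huv) as [e He].
  exists e; intros t Ht. apply He. split; [apply ball_center | exact Ht].
Qed.

Lemma open_slice_2d D (u v : R) : open D -> D (u, v) -> locally_2d (fun a b => D (a, b)) u v.
Proof.
  intros HD Huv. destruct (HD (u, v) Huv) as [e He].
  exists e; intros a b Ha Hb. apply He. split; assumption.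
Qed.

Lemma is_derive_Rmult (g h : R -> R) (x dg dh : R) :
  is_derive g x dg -> is_derive h x dh ->
  is_derive (fun t => g t * h t) x (dg * h x + g x * dh).
Proof.
  intros Hg Hh. apply (is_derive_mult (K := R_AbsRing)); trivial.
  intros; apply Rmult_comm.
Qed.

Lemma is_derive_Rcomp (phi g : R -> R) (x dphi dg : R) :
  is_derive phi (g x) dphi -> is_derive g x dg -> is_derive (fun t => phi (g t)) x (dg * dphi).
Proof. apply (is_derive_comp (K := R_AbsRing) (V := R_NormedModule)). Qed.

Lemma is_derive_Rplus (g h : R -> R) (x dg dh : R) :
  is_derive g x dg -> is_derive h x dh -> is_derive (fun t => g t + h t) x (dg + dh).
Proof. apply (is_derive_plus (V := R_NormedModule)). Qed.

Lemma is_derive_Rminus (g h : R -> R) (x dg dh : R) :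
  is_derive g x dg -> is_derive h x dh -> is_derive (fun t => g t - h t) x (dg - dh).
Proof. apply (is_derive_minus (V := R_NormedModule)). Qed.

Lemma is_derive_Rconst (c x : R) : is_derive (fun _ : R => c) x 0.
Proof. apply (is_derive_const (V := R_NormedModule)). Qed.

Section Calculus.
Variable D : R * R -> Prop.
Hypothesis openD : open D.

Lemma cont_on_ext g h :
  (forall u v, D (u, v) -> g u v = h u v) -> cont_on D g -> cont_on D h.
Proof.
  intros E Hg u v Huv.
  apply (continuous_ext_loc _ (fun p : R * R => g (fst p) (snd p))).
  - generalize (openD (u, v) Huv). apply filter_imp. intros [a b] Hab. now apply E.
  - now apply Hg.
Qed.

Lemma has_partials_ext g h gu gv :
  (forall u v, D (u, v) -> g u v = h u v) ->
  has_partials D g gu gv -> has_partials D h gu gv.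
Proof.
  intros E Hg u v Huv. destruct (Hg u v Huv) as [H1 H2]. split.
  - apply (is_derive_ext_loc (fun t => g t v)); [|exact H1].
    generalize (open_slice_u D u v openD Huv). apply filter_imp. intros t Ht. now apply E.
  - apply (is_derive_ext_loc (fun t => g u t)); [|exact H2].
    generalize (open_slice_v D u v openD Huv). apply filter_imp. intros t Ht. now apply E.
Qed.

Lemma Ck_ext k g h : (forall u v, D (u, v) -> g u v = h u v) -> Ck k D g -> Ck k D h.
Proof.
  intros E. destruct k as [|k].
  - intros [Hc _]; split; trivial. now apply (cont_on_ext g).
  - intros [Hc [gu [gv [Hp H]]]]. split; [now apply (cont_on_ext g)|].
    exists gu, gv; split; [now apply (has_partials_ext g) | exact H].
Qed.

Lemma has_partials_dudv g gu gv u v :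
  has_partials D g gu gv -> D (u, v) -> du g u v = gu u v /\ dv g u v = gv u v.
Proof.
  intros Hp Huv. destruct (Hp u v Huv). split; now apply is_derive_unique.
Qed.

Lemma Ck_const k c : Ck k D (fun _ _ => c).
Proof.
  revert c; induction k as [|k IH]; intros c; (split; [intros u v _; apply continuous_const|]);
    trivial.
  exists (fun _ _ => 0), (fun _ _ => 0). split; [|split; apply IH].
  intros u v _; split; apply (is_derive_const (K := R_AbsRing) (V := R_NormedModule)).
Qed.

Lemma Ck_plus k g h : Ck k D g -> Ck k D h -> Ck k D (fun u v => g u v + h u v).
Proof.
  revert g h; induction k as [|k IH]; intros g h [Hg Hg'] [Hh Hh'];
    (split; [intros u v Huv; apply (continuous_plus (V := R_NormedModule));
             [now apply Hg | now apply Hh]|]); trivial.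
  destruct Hg' as [gu [gv [Pg [Cgu Cgv]]]]. destruct Hh' as [hu [hv [Ph [Chu Chv]]]].
  exists (fun u v => gu u v + hu u v), (fun u v => gv u v + hv u v).
  split; [|split; apply IH; assumption].
  intros u v Huv. destruct (Pg u v Huv), (Ph u v Huv).
  split; apply @is_derive_plus; assumption.
Qed.

Lemma Ck_mult k g h : Ck k D g -> Ck k D h -> Ck k D (fun u v => g u v * h u v).
Proof.
  revert g h; induction k as [|k IH]; intros g h Gg Gh;
    generalize Gg Gh; intros [Hg Hg'] [Hh Hh'];
    (split; [intros u v Huv; apply (continuous_mult (K := R_AbsRing));
             [now apply Hg | now apply Hh]|]); trivial.
  apply Ck_pred in Gg; apply Ck_pred in Gh.
  destruct Hg' as [gu [gv [Pg [Cgu Cgv]]]]. destruct Hh' as [hu [hv [Ph [Chu Chv]]]].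
  exists (fun u v => gu u v * h u v + g u v * hu u v),
         (fun u v => gv u v * h u v + g u v * hv u v).
  split; [|split; apply Ck_plus; apply IH; assumption].
  intros u v Huv. destruct (Pg u v Huv), (Ph u v Huv).
  split; [apply (is_derive_Rmult (fun t => g t v) (fun t => h t v))
         | apply (is_derive_Rmult (fun t => g u t) (fun t => h u t))]; assumption.
Qed.

(* Meant for [exp], [ln] and [Rinv], whose derivatives are expressed by the function itself. *)
Lemma Ck_comp k (phi dphi : R -> R) g :
  (forall u v, D (u, v) -> is_derive phi (g u v) (dphi (g u v))) ->
  (forall j, (j < k)%nat -> Ck j D (fun u v => phi (g u v)) ->
             Ck j D (fun u v => dphi (g u v))) ->
  Ck k D g -> Ck k D (fun u v => phi (g u v)).
Proof.
  intros Hphi; induction k as [|k IH]; intros Hd Gg.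
  - split; trivial. intros u v Huv.
    apply (continuous_comp (fun p : R * R => g (fst p) (snd p)) phi).
    + now apply Gg.
    + apply (ex_derive_continuous (K := R_AbsRing) (V := R_NormedModule)).
      eexists; now apply Hphi.
  - assert (Hk : Ck k D (fun u v => phi (g u v))).
    { apply IH; [intros j Hj; apply Hd; lia | now apply Ck_pred]. }
    split; [now apply (Ck_cont k)|].
    destruct Gg as [_ [gu [gv [Pg [Cgu Cgv]]]]].
    exists (fun u v => gu u v * dphi (g u v)), (fun u v => gv u v * dphi (g u v)).
    assert (Hk' : Ck k D (fun u v => dphi (g u v))) by (apply Hd; [lia | exact Hk]).
    split; [|split; apply Ck_mult; assumption].
    intros u v Huv. destruct (Pg u v Huv).
    split; apply (is_derive_Rcomp phi); auto.
Qed.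

Lemma Ck_exp k g : Ck k D g -> Ck k D (fun u v => exp (g u v)).
Proof.
  apply (Ck_comp k exp exp); auto. intros u v _. apply is_derive_exp.
Qed.

Lemma Ck_inv k g :
  (forall u v, D (u, v) -> g u v <> 0) -> Ck k D g -> Ck k D (fun u v => / g u v).
Proof.
  intros Hg. apply (Ck_comp k Rinv (fun x => (-1) * (/ x * / x))).
  - intros u v Huv. generalize (Hg u v Huv); intros Hn. auto_derive; [exact Hn|].
    now field.
  - intros j _ Hj. apply Ck_mult; [apply Ck_const | now apply Ck_mult].
Qed.

Lemma Ck_ln k g :
  (forall u v, D (u, v) -> 0 < g u v) -> Ck k D g -> Ck k D (fun u v => ln (g u v)).
Proof.
  intros Hg Gg. apply (Ck_comp k ln Rinv); auto.
  - intros u v Huv. apply is_derive_ln. now apply Hg.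
  - intros j Hj _. apply Ck_inv.
    + intros u v Huv. apply Rgt_not_eq. now apply Hg.
    + clear -Gg Hj. revert Gg. induction Hj; intros Gg; [now apply Ck_pred|].
      apply IHHj. now apply Ck_pred.
Qed.

Lemma smooth_on_pdir b g : smooth_on D g -> smooth_on D (pdir b g).
Proof.
  intros Hg l. replace (iterpd l (pdir b g)) with (iterpd (l ++ (b :: nil))%list g).
  - apply Hg.
  - unfold iterpd. now rewrite List.fold_right_app.
Qed.

Lemma smooth_on_partials g : smooth_on D g -> has_partials D g (du g) (dv g).
Proof.
  intros Hg u v Huv. destruct (Hg nil u v Huv) as [H1 [H2 _]].
  split; now apply Derive_correct.
Qed.

Lemma smooth_on_Ck g : smooth_on D g <-> (forall k, Ck k D g).
Proof.
  split.
  - intros Hg k; revert g Hg; induction k as [|k IH]; intros g Hg;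
      (split; [intros u v Huv; apply (Hg nil u v Huv)|]); trivial.
    exists (du g), (dv g). split; [now apply smooth_on_partials|].
    split; apply IH; [now apply (smooth_on_pdir true) | now apply (smooth_on_pdir false)].
  - intros Hg l.
    (* Stated for all orders at once, since each letter of the word uses up one order of
       regularity. *)
    assert (Hl : forall k, Ck k D (iterpd l g)).
    { induction l as [|b l IH]; [exact Hg|]. intros k.
      destruct (IH (S k)) as [_ [gu [gv [Hp [Cu Cv]]]]].
      simpl. destruct b; simpl; [apply (Ck_ext k gu) | apply (Ck_ext k gv)]; trivial;
        intros u v Huv; destruct (has_partials_dudv _ _ _ u v Hp Huv); auto. }
    intros u v Huv. destruct (Hl 1%nat) as [Hc [gu [gv [Hp _]]]].
    destruct (Hp u v Huv).
    split; [eexists; eassumption | split; [eexists; eassumption | now apply Hc]].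
Qed.

Lemma smooth_on_ext g h :
  (forall u v, D (u, v) -> g u v = h u v) -> smooth_on D g -> smooth_on D h.
Proof.
  rewrite !smooth_on_Ck. intros E Hg k. now apply (Ck_ext k g).
Qed.

Lemma smooth_on_const c : smooth_on D (fun _ _ => c).
Proof. apply smooth_on_Ck. intros k; apply Ck_const. Qed.

Lemma smooth_on_plus g h :
  smooth_on D g -> smooth_on D h -> smooth_on D (fun u v => g u v + h u v).
Proof. rewrite !smooth_on_Ck. intros; now apply Ck_plus. Qed.

Lemma smooth_on_mult g h :
  smooth_on D g -> smooth_on D h -> smooth_on D (fun u v => g u v * h u v).
Proof. rewrite !smooth_on_Ck. intros; now apply Ck_mult. Qed.

Lemma smooth_on_opp g : smooth_on D g -> smooth_on D (fun u v => - g u v).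
Proof.
  intros Hg. apply (smooth_on_ext (fun u v => (-1) * g u v)); [intros; ring|].
  apply smooth_on_mult; [apply smooth_on_const | exact Hg].
Qed.

Lemma smooth_on_minus g h :
  smooth_on D g -> smooth_on D h -> smooth_on D (fun u v => g u v - h u v).
Proof. intros; apply smooth_on_plus; [|apply smooth_on_opp]; assumption. Qed.

Lemma smooth_on_exp g : smooth_on D g -> smooth_on D (fun u v => exp (g u v)).
Proof. rewrite !smooth_on_Ck. intros; now apply Ck_exp. Qed.

Lemma smooth_on_inv g :
  (forall u v, D (u, v) -> g u v <> 0) -> smooth_on D g -> smooth_on D (fun u v => / g u v).
Proof. rewrite !smooth_on_Ck. intros; now apply Ck_inv. Qed.

Lemma smooth_on_div g h :
  (forall u v, D (u, v) -> h u v <> 0) ->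
  smooth_on D g -> smooth_on D h -> smooth_on D (fun u v => g u v / h u v).
Proof. intros; apply smooth_on_mult; [|apply smooth_on_inv]; assumption. Qed.

Lemma smooth_on_ln g :
  (forall u v, D (u, v) -> 0 < g u v) -> smooth_on D g -> smooth_on D (fun u v => ln (g u v)).
Proof. rewrite !smooth_on_Ck. intros; now apply Ck_ln. Qed.

Lemma smooth_on_du g : smooth_on D g -> smooth_on D (du g).
Proof. apply (smooth_on_pdir true). Qed.

Lemma smooth_on_dv g : smooth_on D g -> smooth_on D (dv g).
Proof. apply (smooth_on_pdir false). Qed.

Lemma smooth_on_du_dv_comm g u v :
  smooth_on D g -> D (u, v) -> dv (du g) u v = du (dv g) u v.
Proof.
  intros Hg Huv. unfold du, dv. symmetry. apply Schwarz.
  - apply locally_2d_impl with (2 := open_slice_2d D u v openD Huv).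
    apply locally_2d_forall. intros a b Hab. repeat split.
    + eexists. apply (smooth_on_partials g Hg a b Hab).
    + eexists. apply (smooth_on_partials g Hg a b Hab).
    + eexists. apply (smooth_on_partials _ (smooth_on_dv g Hg) a b Hab).
    + eexists. apply (smooth_on_partials _ (smooth_on_du g Hg) a b Hab).
  - apply continuity_2d_pt_filterlim.
    apply (proj2 (proj2 (smooth_on_du _ (smooth_on_dv g Hg) nil u v Huv))).
  - apply continuity_2d_pt_filterlim.
    apply (proj2 (proj2 (smooth_on_dv _ (smooth_on_du g Hg) nil u v Huv))).
Qed.

End Calculus.

(** * Linear differential equations *)

(* As with [sum_f_R0], the bound [n] is the last index: vectors have [S n] entries. *)
Definition nrm (n : nat) (w : Vec) : R := sum_f_R0 (fun i => Rabs (w i)) n.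
Definition mvmul (n : nat) (A : nat -> nat -> R) (w : Vec) : Vec :=
  fun i => sum_f_R0 (fun j => A i j * w j) n.

Lemma nrm_ge0 n w : 0 <= nrm n w.
Proof. apply cond_pos_sum. intros; apply Rabs_pos. Qed.

Lemma Rabs_le_nrm n w i : (i <= n)%nat -> Rabs (w i) <= nrm n w.
Proof.
  unfold nrm; induction n as [|n IH]; intros Hi; simpl.
  - replace i with 0%nat by lia. apply Rle_refl.
  - destruct (Nat.eq_dec i (S n)) as [->|Hn].
    + generalize (nrm_ge0 n w); unfold nrm; lra.
    + generalize (Rabs_pos (w (S n))) (IH ltac:(lia)); lra.
Qed.

Lemma nrm_bound n w M :
  (forall i, (i <= n)%nat -> Rabs (w i) <= M) -> nrm n w <= INR (S n) * M.
Proof.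
  intros H. rewrite Rmult_comm, <- sum_cte. now apply sum_Rle.
Qed.

Lemma nrm_triang n w z : nrm n (fun i => w i + z i) <= nrm n w + nrm n z.
Proof.
  unfold nrm; rewrite <- plus_sum. apply sum_Rle; intros; apply Rabs_triang.
Qed.

Lemma nrm_ext n w z : (forall i, (i <= n)%nat -> w i = z i) -> nrm n w = nrm n z.
Proof. intros H. apply sum_eq; intros i Hi; now rewrite H. Qed.

Lemma nrm_eq0 n w i : nrm n w <= 0 -> (i <= n)%nat -> w i = 0.
Proof.
  intros H Hi. generalize (Rabs_le_nrm n w i Hi) (Rabs_pos (w i)); intros.
  apply Rabs_eq_0; lra.
Qed.

Lemma mvmul_bound n A w K i :
  (i <= n)%nat -> (forall i j, (i <= n)%nat -> (j <= n)%nat -> Rabs (A i j) <= K) ->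
  Rabs (mvmul n A w i) <= K * nrm n w.
Proof.
  intros Hi HA. eapply Rle_trans; [apply Rsum_abs|].
  unfold nrm; rewrite scal_sum. apply sum_Rle; intros j Hj.
  rewrite Rabs_mult, Rmult_comm. apply Rmult_le_compat_l; [apply Rabs_pos | now apply HA].
Qed.

Lemma mvmul_minus n A w z i :
  mvmul n A (fun j => w j - z j) i = mvmul n A w i - mvmul n A z i.
Proof.
  unfold mvmul. rewrite <- minus_sum. apply sum_eq; intros; ring.
Qed.

Lemma sum_f_R0_swap (a : nat -> nat -> R) n m :
  sum_f_R0 (fun i => sum_f_R0 (a i) m) n = sum_f_R0 (fun j => sum_f_R0 (fun i => a i j) n) m.
Proof.
  induction n as [|n IH]; simpl; [reflexivity|].
  now rewrite IH, <- plus_sum.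
Qed.

Lemma is_derive_sum_f_R0 n (f : nat -> R -> R) (df : nat -> R) x :
  (forall i, (i <= n)%nat -> is_derive (f i) x (df i)) ->
  is_derive (fun t => sum_f_R0 (fun i => f i t) n) x (sum_f_R0 df n).
Proof.
  induction n as [|n IH]; intros H; simpl; [now apply H|].
  apply (is_derive_plus (V := R_NormedModule)); [apply IH; intros; apply H; lia | now apply H].
Qed.

Lemma continuous_sum_f_R0 {T : UniformSpace} n (f : nat -> T -> R) x :
  (forall i, (i <= n)%nat -> continuous (f i) x) ->
  continuous (fun t => sum_f_R0 (fun i => f i t) n) x.
Proof.
  induction n as [|n IH]; intros H; simpl; [now apply H|].
  apply (continuous_plus (V := R_NormedModule)); [apply IH; intros; apply H; lia | now apply H].
Qed.

Lemma is_lim_seq_sum_f_R0 n (f : nat -> nat -> R) (l : nat -> R) :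
  (forall i, (i <= n)%nat -> is_lim_seq (f i) (l i)) ->
  is_lim_seq (fun k => sum_f_R0 (fun i => f i k) n) (sum_f_R0 l n).
Proof.
  induction n as [|n IH]; intros H; simpl; [now apply H|].
  apply is_lim_seq_plus'; [apply IH; intros; apply H; lia | now apply H].
Qed.

Lemma is_derive_continuity_pt (f : R -> R) x l : is_derive f x l -> continuity_pt f x.
Proof.
  intros H. apply continuity_pt_filterlim.
  apply (ex_derive_continuous (K := R_AbsRing) (V := R_NormedModule)). now exists l.
Qed.

Lemma MVT_Rabs (f df : R -> R) (a b M : R) :
  (forall x, Rmin a b <= x <= Rmax a b -> is_derive f x (df x) /\ Rabs (df x) <= M) ->
  Rabs (f b - f a) <= M * Rabs (b - a).
Proof.
  intros H. destruct (MVT_gen f a b df) as [c [Hc E]].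
  - intros x Hx. apply H; lra.
  - intros x Hx. apply (is_derive_continuity_pt f x (df x)). now apply H.
  - rewrite E, Rabs_mult. apply Rmult_le_compat_r; [apply Rabs_pos | now apply H].
Qed.

Lemma between_dist (t0 t x rho : R) :
  Rabs (t - t0) <= rho -> Rmin t0 t <= x <= Rmax t0 t -> Rabs (x - t0) <= rho.
Proof.
  unfold Rmin, Rmax; destruct (Rle_dec t0 t); intros H Hx;
    revert H; unfold Rabs; repeat destruct Rcase_abs; lra.
Qed.

(* At a maximum point of the norm on the segment the mean value inequality reads
   [M <= |w t0| + M/2 + (n+1) |t1 - t0| eta]. *)
Lemma contraction_estimate n (w dw : R -> Vec) (t0 t1 K eta : R) :
  0 <= K -> INR (S n) * K * Rabs (t1 - t0) <= / 2 ->
  (forall t i, Rmin t0 t1 <= t <= Rmax t0 t1 -> (i <= n)%nat ->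
     is_derive (fun s => w s i) t (dw t i) /\ Rabs (dw t i) <= K * nrm n (w t) + eta) ->
  nrm n (w t1) <= 2 * (nrm n (w t0) + INR (S n) * (Rabs (t1 - t0) * eta)).
Proof.
  intros HK0 HK Hw. set (rho := Rabs (t1 - t0)) in *.
  destruct (continuity_ab_maj (fun s => nrm n (w s)) (Rmin t0 t1) (Rmax t0 t1)) as [m [Hm Im]].
  { apply Rminmax. }
  { intros c Hc. apply continuity_pt_filterlim. unfold nrm.
    apply (continuous_sum_f_R0 n (fun i s => Rabs (w s i))).
    intros i Hi. apply (continuous_comp (fun s => w s i) Rabs).
    - apply (ex_derive_continuous (K := R_AbsRing) (V := R_NormedModule)).
      exists (dw c i). now apply Hw.
    - apply continuous_Rabs. }
  assert (Hmt : Rabs (m - t0) <= rho).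
  { apply (between_dist t0 t1); [apply Rle_refl | exact Im]. }
  assert (Hbet : forall x, Rmin t0 m <= x <= Rmax t0 m -> Rmin t0 t1 <= x <= Rmax t0 t1).
  { intros x. revert Im. unfold Rmin, Rmax. repeat destruct Rle_dec; lra. }
  assert (HM : nrm n (w m) <= nrm n (w t0) + INR (S n) * ((K * nrm n (w m) + eta) * rho)).
  { rewrite (nrm_ext n (w m) (fun i => w t0 i + (w m i - w t0 i))) at 1 by (intros; ring).
    eapply Rle_trans; [apply nrm_triang|]. apply Rplus_le_compat_l.
    apply nrm_bound. intros i Hi.
    eapply Rle_trans.
    - apply (MVT_Rabs (fun s => w s i) (fun s => dw s i) t0 m (K * nrm n (w m) + eta)).
      intros x Hx. apply Hbet in Hx.
      destruct (Hw x i Hx Hi) as [H1 H2]. split; [exact H1|].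
      eapply Rle_trans; [exact H2|]. apply Rplus_le_compat_r, Rmult_le_compat_l; [exact HK0|].
      now apply Hm.
    - apply Rmult_le_compat_l; [|exact Hmt].
      destruct (Hw m i Im Hi) as [_ H2].
      eapply Rle_trans; [apply Rabs_pos | exact H2]. }
  assert (Ht' : nrm n (w t1) <= nrm n (w m)).
  { apply Hm. split; [apply Rmin_r | apply Rmax_r]. }
  generalize (nrm_ge0 n (w m)); intros. nra.
Qed.

Lemma is_derive_RInt_continuous (f : R -> R) (t0 t : R) :
  (forall s, continuous f s) -> is_derive (fun s => RInt f t0 s) t (f t).
Proof.
  intros Hf. apply (is_derive_RInt (V := R_NormedModule) f _ t0); [|apply Hf].
  apply filter_forall. intros s. apply (RInt_correct (V := R_CompleteNormedModule)).
  apply (ex_RInt_continuous (V := R_CompleteNormedModule)). intros; apply Hf.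
Qed.

(** * Picard iteration for linear systems *)

Section Picard.
Variables (n : nat) (A : R -> nat -> nat -> R) (c : Vec) (t0 rho K : R).
Hypothesis contA : forall i j t, (i <= n)%nat -> (j <= n)%nat -> continuous (fun s => A s i j) t.
Hypothesis boundA : forall i j t, (i <= n)%nat -> (j <= n)%nat -> Rabs (A t i j) <= K.
Hypothesis rho_ge0 : 0 <= rho.
Hypothesis contraction : INR (S n) * K * rho <= / 2.

(** The coefficients are continuous and bounded on the whole line, so that every iterate is
    differentiable everywhere; only the estimates are confined to [|t - t0| <= rho]. *)
Fixpoint picard (k : nat) : R -> Vec :=
  match k with
  | O => fun _ => c
  | S k => fun t i => c i + RInt (fun s => mvmul n (A s) (picard k s) i) t0 t
  end.

Let Kge0 : 0 <= K.
Proof.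
  eapply Rle_trans; [apply Rabs_pos | apply (boundA 0 0 0); lia].
Qed.

Lemma continuous_mvmul (w : R -> Vec) i t :
  (i <= n)%nat -> (forall j, (j <= n)%nat -> continuous (fun s => w s j) t) ->
  continuous (fun s => mvmul n (A s) (w s) i) t.
Proof.
  intros Hi Hw. apply continuous_sum_f_R0. intros j Hj.
  apply (continuous_mult (K := R_AbsRing)); [now apply contA | now apply Hw].
Qed.

(** Continuity of the iterate under the integral is assumed here because it is itself deduced from
    this lemma, by induction on [k]. *)
Lemma picard_derive_aux k i t :
  (i <= n)%nat -> (forall j s, (j <= n)%nat -> continuous (fun s => picard k s j) s) ->
  is_derive (fun s => picard (S k) s i) t (mvmul n (A t) (picard k t) i).
Proof.
  intros Hi Hc. simpl.
  replace (mvmul n (A t) (picard k t) i) with (0 + mvmul n (A t) (picard k t) i) by ring.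
  apply (is_derive_Rplus (fun _ => c i)).
  - apply is_derive_Rconst.
  - apply (is_derive_RInt_continuous (fun s => mvmul n (A s) (picard k s) i)).
    intros s. apply continuous_mvmul; auto.
Qed.

Lemma picard_continuous k i t : (i <= n)%nat -> continuous (fun s => picard k s i) t.
Proof.
  revert i t; induction k as [|k IH]; intros i t Hi; [apply continuous_const|].
  apply (ex_derive_continuous (K := R_AbsRing) (V := R_NormedModule)).
  eexists. apply picard_derive_aux; auto.
Qed.

Lemma picard_derive k i t :
  (i <= n)%nat -> is_derive (fun s => picard (S k) s i) t (mvmul n (A t) (picard k t) i).
Proof. intros Hi. apply picard_derive_aux; trivial. intros; now apply picard_continuous. Qed.

Lemma picard_initial k i : picard k t0 i = c i.
Proof.
  destruct k; simpl; [reflexivity|]. rewrite RInt_point. apply Rplus_0_r.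
Qed.

Lemma picard_step k t :
  Rabs (t - t0) <= rho ->
  nrm n (fun i => picard (S k) t i - picard k t i) <= nrm n c * (/ 2) ^ k.
Proof.
  (* One integration halves the norm: the mean value bound of each component, summed over the [S n]
     components, gives the factor [INR (S n) * K * rho <= / 2]. *)
  assert (step : forall (w dw : R -> Vec) M t, 0 <= M -> Rabs (t - t0) <= rho ->
    (forall i, (i <= n)%nat -> w t0 i = 0) ->
    (forall s i, Rabs (s - t0) <= rho -> (i <= n)%nat ->
       is_derive (fun r => w r i) s (dw s i) /\ Rabs (dw s i) <= K * M) ->
    nrm n (w t) <= M * / 2).
  { clear t. intros w dw M t HM Ht H0 Hw.
    apply Rle_trans with (INR (S n) * (K * M * rho)).
    - apply nrm_bound. intros i Hi.
      replace (w t i) with (w t i - w t0 i) by (rewrite H0; [ring | exact Hi]).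
      apply Rle_trans with (K * M * Rabs (t - t0)).
      + apply (MVT_Rabs (fun s => w s i) (fun s => dw s i)).
        intros x Hx. apply Hw; [now apply (between_dist _ _ _ _ Ht) | exact Hi].
      + apply Rmult_le_compat_l; [now apply Rmult_le_pos | exact Ht].
    - replace (INR (S n) * (K * M * rho)) with (M * (INR (S n) * K * rho)) by ring.
      now apply Rmult_le_compat_l. }
  revert t. induction k as [|k IH]; intros t Ht.
  - replace (nrm n c * (/ 2) ^ 0) with (nrm n c * / 2 + nrm n c * / 2) by (simpl; lra).
    apply Rle_trans with (nrm n c * / 2); [|generalize (nrm_ge0 n c); lra].
    apply (step (fun t i => picard 1 t i - picard 0 t i)
                (fun t i => mvmul n (A t) c i - 0)); trivial.
    + apply nrm_ge0.
    + intros i Hi. rewrite !picard_initial. ring.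
    + intros s i Hs Hi. split.
      * apply (is_derive_Rminus (fun t => picard 1 t i) (fun _ => c i));
          [now apply (picard_derive 0) | apply is_derive_Rconst].
      * rewrite Rminus_0_r. apply mvmul_bound; auto.
  - rewrite <- tech_pow_Rmult.
    replace (nrm n c * (/ 2 * (/ 2) ^ k)) with (nrm n c * (/ 2) ^ k * / 2) by ring.
    apply (step (fun t i => picard (S (S k)) t i - picard (S k) t i)
                (fun t i => mvmul n (A t) (picard (S k) t) i - mvmul n (A t) (picard k t) i));
      trivial.
    + apply Rmult_le_pos; [apply nrm_ge0 | apply pow_le; lra].
    + intros i Hi. rewrite !picard_initial. ring.
    + intros s i Hs Hi. split.
      * apply (is_derive_Rminus (fun t => picard (S (S k)) t i) (fun t => picard (S k) t i));
          now apply picard_derive.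
      * rewrite <- mvmul_minus. eapply Rle_trans; [apply mvmul_bound; auto|].
        apply Rmult_le_compat_l; [exact Kge0 | now apply IH].
Qed.

(** The bound is the exact geometric sum of the steps from [k] to [k + m - 1], so that the induction
    on [m] closes with an equality. *)
Lemma picard_tail k m t :
  Rabs (t - t0) <= rho ->
  nrm n (fun i => picard (k + m) t i - picard k t i)
  <= 2 * nrm n c * ((/ 2) ^ k - (/ 2) ^ (k + m)).
Proof.
  intros Ht. induction m as [|m IH].
  - rewrite Nat.add_0_r, Rminus_diag, Rmult_0_r.
    replace 0 with (INR (S n) * 0) by ring.
    apply nrm_bound. intros i Hi. rewrite Rminus_diag, Rabs_R0. apply Rle_refl.
  - rewrite (nrm_ext n _ (fun i => (picard (k + m) t i - picard k t i)
              + (picard (S (k + m)) t i - picard (k + m) t i)))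
      by (intros; rewrite Nat.add_succ_r; ring).
    eapply Rle_trans; [apply nrm_triang|].
    eapply Rle_trans; [apply Rplus_le_compat; [exact IH | now apply picard_step]|].
    rewrite Nat.add_succ_r, <- tech_pow_Rmult. right. field.
Qed.

Lemma picard_uniform_cauchy (eps : R) :
  0 < eps -> exists N, forall k m t, (N <= k)%nat -> (N <= m)%nat -> Rabs (t - t0) <= rho ->
    nrm n (fun i => picard k t i - picard m t i) < eps.
Proof.
  intros Heps.
  destruct (pow_lt_1_zero (/ 2) ltac:(rewrite Rabs_pos_eq; lra)
              (eps / (2 * nrm n c + 1))) as [N HN].
  { apply Rdiv_lt_0_compat; [exact Heps | generalize (nrm_ge0 n c); lra]. }
  exists N.
  assert (H : forall k m t, (N <= k)%nat -> (k <= m)%nat -> Rabs (t - t0) <= rho ->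
    nrm n (fun i => picard m t i - picard k t i) < eps).
  { intros k m t Hk Hm Ht. replace m with (k + (m - k))%nat by lia.
    eapply Rle_lt_trans; [now apply picard_tail|].
    specialize (HN k Hk). rewrite Rabs_pos_eq in HN by (apply pow_le; lra).
    apply Rle_lt_trans with ((2 * nrm n c + 1) * (/ 2) ^ k).
    - generalize (nrm_ge0 n c) (pow_le (/ 2) k ltac:(lra))
        (pow_le (/ 2) (k + (m - k)) ltac:(lra)). intros; nra.
    - apply (Rmult_lt_compat_l (2 * nrm n c + 1)) in HN;
        [|generalize (nrm_ge0 n c); lra].
      replace ((2 * nrm n c + 1) * (eps / (2 * nrm n c + 1))) with eps in HN; [exact HN|].
      field. generalize (nrm_ge0 n c); lra. }
  intros k m t Hk Hm Ht. destruct (Nat.le_ge_cases k m) as [Hkm|Hkm].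
  - rewrite (nrm_ext n _ (fun i => - (picard m t i - picard k t i))) by (intros; ring).
    unfold nrm. rewrite (sum_eq _ (fun i => Rabs (picard m t i - picard k t i)))
      by (intros; apply Rabs_Ropp).
    now apply H.
  - now apply H.
Qed.

(** [Lim_seq] is total, so the definition precedes any proof of convergence. The shift to [S k]
    selects the iterates whose derivative is given by [picard_derive]. *)
Definition ode_solution : R -> Vec :=
  fun t i => real (Lim_seq (fun k => picard (S k) t i)).

Lemma ode_solution_initial i : ode_solution t0 i = c i.
Proof.
  unfold ode_solution. rewrite (Lim_seq_ext _ (fun _ => c i)).
  - now rewrite Lim_seq_const.
  - intros k. apply picard_initial.
Qed.

(** The derivative of an iterate is the coefficient matrix applied to the preceding iterate, so the
    derivatives inherit the uniform Cauchy estimate up to the factor [K], and the limit may be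
    differentiated term by term. *)
Lemma ode_solution_derive : forall t i,
  Rabs (t - t0) < rho -> (i <= n)%nat ->
  is_derive (fun s => ode_solution s i) t (mvmul n (A t) (ode_solution t) i).
Proof.
  set (D := fun t => Rabs (t - t0) < rho).
  assert (Hcau : forall i, (i <= n)%nat -> CVU_cauchy (fun k t => picard (S k) t i) D).
  { intros i Hi eps. destruct (picard_uniform_cauchy eps (cond_pos eps)) as [N HN].
    exists N. intros k m t Ht Hk Hm.
    eapply Rle_lt_trans; [|apply (HN (S k) (S m) t); [lia | lia | now apply Rlt_le]].
    apply (Rabs_le_nrm n (fun i => picard (S k) t i - picard (S m) t i)); exact Hi. }
  assert (Hlim : forall i t, (i <= n)%nat -> D t ->
            is_lim_seq (fun k => picard k t i) (ode_solution t i)).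
  { intros i t Hi Ht. apply is_lim_seq_incr_1. unfold ode_solution.
    apply is_lim_seq_spec. intros eps.
    destruct (proj2 (CVU_dom_cauchy _ _) (Hcau i Hi) eps) as [N HN].
    exists N. intros k Hk. now apply HN. }
  intros t i Ht Hi.
  assert (HD : forall k s, Derive (fun s => picard (S k) s i) s = mvmul n (A s) (picard k s) i).
  { intros k s. apply is_derive_unique. now apply picard_derive. }
  replace (mvmul n (A t) (ode_solution t) i)
    with (real (Lim_seq (fun k => Derive (fun s => picard (S k) s i) t))).
  - apply (CVU_Derive (fun k s => picard (S k) s i) D); trivial.
    + intros s Hs.
      assert (He : 0 < rho - Rabs (s - t0)) by (unfold D in Hs; lra).
      exists (mkposreal _ He). intros x Hx. unfold D.
      change (Rabs (x - s) < rho - Rabs (s - t0)) in Hx.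
      replace (x - t0) with ((x - s) + (s - t0)) by ring.
      eapply Rle_lt_trans; [apply Rabs_triang | lra].
    + intros a b x Ha Hb Hx. unfold D in *.
      apply Rabs_lt_between in Ha. apply Rabs_lt_between in Hb. apply Rabs_lt_between. lra.
    + apply CVU_dom_cauchy. now apply Hcau.
    + intros k s _. eexists. now apply picard_derive.
    + intros k s _. apply continuity_pt_filterlim.
      apply (continuous_ext (fun s => mvmul n (A s) (picard k s) i)); [now intros; rewrite HD|].
      apply continuous_mvmul; [exact Hi|]. intros; now apply picard_continuous.
    + apply CVU_dom_cauchy. intros eps.
      (* [K + 1] in place of [K] allows for [K = 0]. *)
      assert (He : 0 < eps / (K + 1)).
      { apply Rdiv_lt_0_compat; [apply cond_pos | lra]. }
      destruct (picard_uniform_cauchy _ He) as [N HN].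
      exists N. intros k m s Hs Hk Hm. rewrite !HD, <- mvmul_minus.
      eapply Rle_lt_trans; [apply mvmul_bound; auto|].
      specialize (HN k m s Hk Hm (Rlt_le _ _ Hs)).
      apply Rle_lt_trans with ((K + 1) * nrm n (fun j => picard k s j - picard m s j)).
      * generalize (nrm_ge0 n (fun j => picard k s j - picard m s j)). nra.
      * apply (Rmult_lt_compat_l (K + 1)) in HN; [|lra].
        replace (pos eps) with ((K + 1) * (eps / (K + 1))) by (field; lra). exact HN.
  - rewrite (Lim_seq_ext _ (fun k => mvmul n (A t) (picard k t) i)) by (intros; apply HD).
    rewrite (is_lim_seq_unique _ (Finite (mvmul n (A t) (ode_solution t) i))); [reflexivity|].
    apply is_lim_seq_sum_f_R0. intros j Hj.
    apply (is_lim_seq_scal_l _ (A t i j) (Finite (ode_solution t j))). now apply Hlim.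
Qed.

End Picard.

(** * Flat sections of integrable linear systems *)

Definition mfield := R -> R -> nat -> nat -> R.

Definition flat_section (n : nat) (P Q : mfield) (D : R * R -> Prop) (y : R -> R -> Vec) : Prop :=
  forall u v i, D (u, v) -> (i <= n)%nat ->
    is_derive (fun t => y t v i) u (mvmul n (P u v) (y u v) i) /\
    is_derive (fun t => y u t i) v (mvmul n (Q u v) (y u v) i).

Definition msmooth_on (n : nat) (D : R * R -> Prop) (P : mfield) : Prop :=
  forall i j, (i <= n)%nat -> (j <= n)%nat -> smooth_on D (fun u v => P u v i j).

Definition mmul (n : nat) (A B : nat -> nat -> R) (i j : nat) : R :=
  sum_f_R0 (fun k => A i k * B k j) n.

Definition integrable (n : nat) (D : R * R -> Prop) (P Q : mfield) : Prop :=
  forall u v i j, D (u, v) -> (i <= n)%nat -> (j <= n)%nat ->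
    dv (fun a b => P a b i j) u v + mmul n (P u v) (Q u v) i j =
    du (fun a b => Q a b i j) u v + mmul n (Q u v) (P u v) i j.

Definition square (p1 p2 r : R) (q : R * R) : Prop :=
  Rabs (fst q - p1) < r /\ Rabs (snd q - p2) < r.

(* A square around [p] on which the equation is a contraction on segments of length [2 r]. *)
Definition good_square (n : nat) (D : R * R -> Prop) (P Q : mfield) (p1 p2 r K : R) : Prop :=
  0 < r /\ 0 <= K /\ INR (S n) * K * (2 * r) <= / 2 /\
  (forall q, square p1 p2 (4 * r) q -> D q) /\
  (forall u v i j, square p1 p2 (4 * r) (u, v) -> (i <= n)%nat -> (j <= n)%nat ->
     Rabs (P u v i j) <= K /\ Rabs (Q u v i j) <= K).

Lemma filter_forall_le {T} {F : (T -> Prop) -> Prop} {FF : Filter F} n (P : nat -> T -> Prop) :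
  (forall i, (i <= n)%nat -> F (P i)) -> F (fun x => forall i, (i <= n)%nat -> P i x).
Proof.
  induction n as [|n IH]; intros H.
  - generalize (H 0%nat (Nat.le_refl _)). apply filter_imp. intros x Hx i Hi.
    now replace i with 0%nat by lia.
  - generalize (filter_and _ _ (IH (fun i Hi => H i (Nat.le_le_succ_r _ _ Hi))) (H (S n) (Nat.le_refl _))).
    apply filter_imp. intros x [H1 H2] i Hi.
    destruct (Nat.eq_dec i (S n)) as [->|]; [exact H2 | apply H1; lia].
Qed.

Lemma finite_bound n (f : nat -> nat -> R) :
  exists K, 0 <= K /\ forall i j, (i <= n)%nat -> (j <= n)%nat -> Rabs (f i j) <= K.
Proof.
  exists (sum_f_R0 (fun i => nrm n (f i)) n). split.
  - apply cond_pos_sum. intros; apply nrm_ge0.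
  - intros i j Hi Hj. apply Rle_trans with (nrm n (f i)); [now apply Rabs_le_nrm|].
    rewrite <- (Rabs_pos_eq (nrm n (f i))) by apply nrm_ge0.
    eapply Rle_trans; [apply (Rabs_le_nrm n (fun i => nrm n (f i)) i Hi)|].
    right. apply sum_eq. intros; apply Rabs_pos_eq, nrm_ge0.
Qed.

Lemma good_square_exists n (D : R * R -> Prop) P Q (p1 p2 : R) :
  open D -> D (p1, p2) -> msmooth_on n D P -> msmooth_on n D Q ->
  exists r K, good_square n D P Q p1 p2 r K.
Proof.
  intros HD Hp HP HQ.
  destruct (finite_bound n (P p1 p2)) as [K1 [HK1 B1]].
  destruct (finite_bound n (Q p1 p2)) as [K2 [HK2 B2]].
  (* [K1 + K2] bounds the entries at the point itself; the [1] is the variation that continuity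
     permits nearby. *)
  set (K := K1 + K2 + 1).
  assert (Hnear : forall M, msmooth_on n D M ->
    (forall i j, (i <= n)%nat -> (j <= n)%nat -> Rabs (M p1 p2 i j) <= K1 + K2) ->
    locally (p1, p2) (fun q : R * R => forall i, (i <= n)%nat -> forall j, (j <= n)%nat ->
       Rabs (M (fst q) (snd q) i j) <= K)).
  { intros M HM HB.
    apply (filter_forall_le n (fun i (q : R * R) => forall j, (j <= n)%nat ->
             Rabs (M (fst q) (snd q) i j) <= K)). intros i Hi.
    apply (filter_forall_le n (fun j (q : R * R) => Rabs (M (fst q) (snd q) i j) <= K)).
    intros j Hj.
    destruct (HM i j Hi Hj nil p1 p2 Hp) as [_ [_ Hc]]. simpl in Hc.
    apply (filterlim_locally (F := locally (p1, p2)) _ _) with (eps := mkposreal 1 Rlt_0_1) in Hc.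
    revert Hc. apply filter_imp. intros [a b] Hq. simpl.
    change (Rabs (M a b i j - M p1 p2 i j) < 1) in Hq.
    specialize (HB i j Hi Hj).
    apply Rabs_lt_between in Hq. apply Rabs_le_between in HB.
    apply Rabs_le_between. unfold K; lra. }
  assert (HPn := Hnear P HP ltac:(intros i j Hi Hj; specialize (B1 i j Hi Hj); lra)).
  assert (HQn := Hnear Q HQ ltac:(intros i j Hi Hj; specialize (B2 i j Hi Hj); lra)).
  destruct (filter_and _ _ (HD _ Hp) (filter_and _ _ HPn HQn)) as [e He].
  set (m := INR (S n) * K * 2).
  assert (Hm : 0 < m).
  { unfold m. apply Rmult_lt_0_compat; [|lra]. apply Rmult_lt_0_compat.
    - apply lt_0_INR; lia.
    - unfold K; lra. }
  (* The first term keeps the square of half side [4 * r] inside the ball of radius [e], the second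
     makes [m * r <= / 2]. *)
  set (r := Rmin (e / 4) (/ (2 * m))).
  assert (Hr : 0 < r).
  { apply Rmin_pos; [generalize (cond_pos e); lra | apply Rinv_0_lt_compat; lra]. }
  assert (Hsq : forall q, square p1 p2 (4 * r) q -> ball (p1, p2) e q).
  { intros [a b] [Ha Hb]. simpl in Ha, Hb.
    assert (4 * r <= e) by (generalize (Rmin_l (e / 4) (/ (2 * m))); unfold r; lra).
    split; [change (Rabs (a - p1) < e) | change (Rabs (b - p2) < e)]; lra. }
  exists r, K. split; [exact Hr|]. split; [unfold K; lra|]. split.
  { replace (INR (S n) * K * (2 * r)) with (m * r) by (unfold m; ring).
    replace (/ 2) with (m * / (2 * m)) by (field; lra).
    apply Rmult_le_compat_l; [lra | apply Rmin_r]. }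
  split.
  - intros q Hq. now apply He, Hsq.
  - intros u v i j Hq Hi Hj. apply Hsq in Hq. destruct (He _ Hq) as [_ [H1 H2]].
    split; [now apply H1 | now apply H2].
Qed.

Lemma flat_section_u_bound n D P Q p1 p2 r K y q1 u v (D' : R * R -> Prop) :
  good_square n D P Q p1 p2 r K -> flat_section n P Q D' y -> Rabs (u - q1) <= 2 * r ->
  (forall t, Rmin q1 u <= t <= Rmax q1 u -> square p1 p2 (4 * r) (t, v) /\ D' (t, v)) ->
  nrm n (y u v) <= 2 * nrm n (y q1 v).
Proof.
  intros [Hr [HK [HKr [_ HPQ]]]] Hy Hu Hin.
  replace (2 * nrm n (y q1 v)) with (2 * (nrm n (y q1 v) + INR (S n) * (Rabs (u - q1) * 0)))
    by ring.
  apply (contraction_estimate n (fun t => y t v) (fun t => mvmul n (P t v) (y t v)) q1 u K);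
    trivial.
  - eapply Rle_trans; [|exact HKr]. apply Rmult_le_compat_l; [|exact Hu].
    apply Rmult_le_pos; [apply pos_INR | exact HK].
  - intros t i Ht Hi. destruct (Hin t Ht) as [H1 H2]. split.
    + now apply Hy.
    + rewrite Rplus_0_r. apply mvmul_bound; [exact Hi|]. intros; now apply HPQ.
Qed.

Lemma flat_section_v_bound n D P Q p1 p2 r K y q2 u v (D' : R * R -> Prop) :
  good_square n D P Q p1 p2 r K -> flat_section n P Q D' y -> Rabs (v - q2) <= 2 * r ->
  (forall t, Rmin q2 v <= t <= Rmax q2 v -> square p1 p2 (4 * r) (u, t) /\ D' (u, t)) ->
  nrm n (y u v) <= 2 * nrm n (y u q2).
Proof.
  intros [Hr [HK [HKr [_ HPQ]]]] Hy Hu Hin.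
  replace (2 * nrm n (y u q2)) with (2 * (nrm n (y u q2) + INR (S n) * (Rabs (v - q2) * 0)))
    by ring.
  apply (contraction_estimate n (fun t => y u t) (fun t => mvmul n (Q u t) (y u t)) q2 v K);
    trivial.
  - eapply Rle_trans; [|exact HKr]. apply Rmult_le_compat_l; [|exact Hu].
    apply Rmult_le_pos; [apply pos_INR | exact HK].
  - intros t i Ht Hi. destruct (Hin t Ht) as [H1 H2]. split.
    + now apply Hy.
    + rewrite Rplus_0_r. apply mvmul_bound; [exact Hi|]. intros; now apply HPQ.
Qed.

Lemma Rabs_between_lt (a b t c r : R) :
  Rmin a b <= t <= Rmax a b -> Rabs (a - c) < r -> Rabs (b - c) < r -> Rabs (t - c) < r.
Proof.
  intros Ht Ha Hb. apply Rabs_lt_between in Ha; apply Rabs_lt_between in Hb.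
  apply Rabs_lt_between. revert Ht. unfold Rmin, Rmax. destruct Rle_dec; lra.
Qed.

(** Each leg of the path from [(q1, q2)] through [(u, q2)] to [(u, v)] costs a factor 2. *)
Lemma flat_section_bound n D P Q p1 p2 r K y q1 q2 u v (D' : R * R -> Prop) :
  good_square n D P Q p1 p2 r K -> flat_section n P Q D' y ->
  (forall q, square p1 p2 r q -> D' q) ->
  square p1 p2 r (q1, q2) -> square p1 p2 r (u, v) ->
  nrm n (y u v) <= 4 * nrm n (y q1 q2).
Proof.
  intros G Hy HD' [Hq1 Hq2] [Hu Hv]. simpl in *.
  assert (Hr : 0 < r) by apply G.
  assert (Hd : forall a b c, Rabs (a - c) < r -> Rabs (b - c) < r -> Rabs (a - b) <= 2 * r).
  { intros a b c Ha Hb. apply Rabs_lt_between in Ha; apply Rabs_lt_between in Hb.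
    apply Rabs_le_between. lra. }
  assert (H1 : nrm n (y u q2) <= 2 * nrm n (y q1 q2)).
  { apply (flat_section_u_bound n D P Q p1 p2 r K y q1 u q2 D'); trivial; [now apply (Hd _ _ p1)|].
    intros t Ht. assert (Rabs (t - p1) < r) by now apply (Rabs_between_lt q1 u).
    split; [split; simpl; lra | apply HD'; split; assumption]. }
  assert (H2 : nrm n (y u v) <= 2 * nrm n (y u q2)).
  { apply (flat_section_v_bound n D P Q p1 p2 r K y q2 u v D'); trivial; [now apply (Hd _ _ p2)|].
    intros t Ht. assert (Rabs (t - p2) < r) by now apply (Rabs_between_lt q2 v).
    split; [split; simpl; lra | apply HD'; split; assumption]. }
  lra.
Qed.

Lemma flat_section_zero n D P Q p1 p2 r K y q1 q2 :
  good_square n D P Q p1 p2 r K -> flat_section n P Q (square p1 p2 r) y ->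
  square p1 p2 r (q1, q2) -> (forall i, (i <= n)%nat -> y q1 q2 i = 0) ->
  forall u v i, square p1 p2 r (u, v) -> (i <= n)%nat -> y u v i = 0.
Proof.
  intros G Hy Hq H0 u v i Huv Hi. apply (nrm_eq0 n); [|exact Hi].
  eapply Rle_trans; [now apply (flat_section_bound n D P Q p1 p2 r K y q1 q2 u v (square p1 p2 r))|].
  assert (E : nrm n (y q1 q2) <= INR (S n) * 0).
  { apply nrm_bound. intros j Hj. rewrite H0, Rabs_R0 by exact Hj. apply Rle_refl. }
  lra.
Qed.

Lemma flat_section_minus n P Q D y z :
  flat_section n P Q D y -> flat_section n P Q D z ->
  flat_section n P Q D (fun u v i => y u v i - z u v i).
Proof.
  intros Hy Hz u v i Huv Hi. destruct (Hy u v i Huv Hi), (Hz u v i Huv Hi).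
  rewrite !mvmul_minus. split;
    [apply (is_derive_Rminus (fun t => y t v i) (fun t => z t v i))
    |apply (is_derive_Rminus (fun t => y u t i) (fun t => z u t i))]; assumption.
Qed.

(** Partial derivatives alone do not give joint continuity; here they are bounded by [K * M] near
    the point, because the norm of the section is, and so the section is Lipschitz there. *)
Lemma flat_section_cont n D P Q y :
  open D -> msmooth_on n D P -> msmooth_on n D Q -> flat_section n P Q D y ->
  forall i, (i <= n)%nat -> cont_on D (fun u v => y u v i).
Proof.
  intros HD HP HQ Hy i Hi p1 p2 Hp.
  destruct (good_square_exists n D P Q p1 p2 HD Hp HP HQ) as [r [K G]].
  pose proof G as [Hr [HK [HKr [HsD HPQ]]]].
  assert (HD' : forall q, square p1 p2 r q -> D q).
  { intros q [H1 H2]. apply HsD. split; lra. }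
  assert (Hpp : square p1 p2 r (p1, p2)).
  { split; simpl; rewrite Rminus_diag, Rabs_R0; exact Hr. }
  set (M := 4 * nrm n (y p1 p2)).
  assert (HM : 0 <= K * M).
  { apply Rmult_le_pos; [exact HK|]. unfold M. generalize (nrm_ge0 n (y p1 p2)); lra. }
  assert (HB : forall u v, square p1 p2 r (u, v) -> nrm n (y u v) <= M).
  { intros u v Huv. now apply (flat_section_bound n D P Q p1 p2 r K y p1 p2 u v D). }
  assert (HL : forall u v, square p1 p2 r (u, v) ->
     Rabs (y u v i - y p1 p2 i) <= K * M * (Rabs (u - p1) + Rabs (v - p2))).
  { intros u v [Hu Hv]; simpl in Hu, Hv.
    replace (y u v i - y p1 p2 i) with ((y u p2 i - y p1 p2 i) + (y u v i - y u p2 i)) by ring.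
    eapply Rle_trans; [apply Rabs_triang|]. rewrite Rmult_plus_distr_l.
    destruct Hpp as [Hp1 Hp2]; simpl in Hp1, Hp2.
    apply Rplus_le_compat.
    - apply (MVT_Rabs (fun t => y t p2 i) (fun t => mvmul n (P t p2) (y t p2) i)).
      intros t Ht.
      assert (Hs : square p1 p2 r (t, p2)) by (split; [now apply (Rabs_between_lt p1 u) | exact Hp2]).
      split; [apply Hy; auto|]. eapply Rle_trans; [apply mvmul_bound; [exact Hi|]|].
      + intros; apply HPQ; trivial. destruct Hs; split; simpl in *; lra.
      + apply Rmult_le_compat_l; [exact HK | now apply HB].
    - apply (MVT_Rabs (fun t => y u t i) (fun t => mvmul n (Q u t) (y u t) i)).
      intros t Ht.
      assert (Hs : square p1 p2 r (u, t)) by (split; [exact Hu | now apply (Rabs_between_lt p2 v)]).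
      split; [apply Hy; auto|]. eapply Rle_trans; [apply mvmul_bound; [exact Hi|]|].
      + intros; apply HPQ; trivial. destruct Hs; split; simpl in *; lra.
      + apply Rmult_le_compat_l; [exact HK | now apply HB]. }
  apply (filterlim_locally (F := locally (p1, p2)) _ _). intros eps.
  assert (He : 0 < Rmin r (eps / (2 * (K * M + 1)))).
  { apply Rmin_pos; [exact Hr|]. apply Rdiv_lt_0_compat; [apply cond_pos | lra]. }
  exists (mkposreal _ He). intros [u v] [Hu Hv].
  change (Rabs (u - p1) < Rmin r (eps / (2 * (K * M + 1)))) in Hu.
  change (Rabs (v - p2) < Rmin r (eps / (2 * (K * M + 1)))) in Hv.
  change (Rabs (y u v i - y p1 p2 i) < eps).
  pose proof (Rmin_l r (eps / (2 * (K * M + 1)))). pose proof (Rmin_r r (eps / (2 * (K * M + 1)))).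
  eapply Rle_lt_trans; [apply HL; split; simpl; lra|].
  apply Rle_lt_trans with ((K * M) * (2 * (eps / (2 * (K * M + 1))))).
  - apply Rmult_le_compat_l; [exact HM | lra].
  - replace ((K * M) * (2 * (eps / (2 * (K * M + 1))))) with (eps * (K * M / (K * M + 1)))
      by (field; lra).
    rewrite <- (Rmult_1_r eps) at 2. apply Rmult_lt_compat_l; [apply cond_pos|].
    apply (Rmult_lt_reg_r (K * M + 1)); [lra|]. field_simplify; lra.
Qed.

Lemma Ck_sum_f_R0 k D n (f : nat -> R -> R -> R) :
  (forall i, (i <= n)%nat -> Ck k D (f i)) ->
  Ck k D (fun u v => sum_f_R0 (fun i => f i u v) n).
Proof.
  induction n as [|n IH]; intros H; simpl; [now apply H|].
  apply Ck_plus; [apply IH; intros; apply H; lia | now apply H].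
Qed.

(** Bootstrap: the partials are [P y] and [Q y], so regularity of order [k] for [y] gives order
    [k + 1]. *)
Lemma flat_section_smooth n D P Q y :
  open D -> msmooth_on n D P -> msmooth_on n D Q -> flat_section n P Q D y ->
  forall i, (i <= n)%nat -> smooth_on D (fun u v => y u v i).
Proof.
  intros HD HP HQ Hy i Hi. apply smooth_on_Ck; [exact HD|]. intros k. revert i Hi.
  pose proof (flat_section_cont n D P Q y HD HP HQ Hy) as Hc.
  induction k as [|k IH]; intros i Hi; (split; [now apply Hc|]); trivial.
  exists (fun u v => mvmul n (P u v) (y u v) i), (fun u v => mvmul n (Q u v) (y u v) i).
  split; [intros u v Huv; now apply Hy|].
  split; apply (Ck_sum_f_R0 k D n (fun j u v => _ u v i j * y u v j));
    intros j Hj; apply Ck_mult; auto; now apply smooth_on_Ck; auto.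
Qed.

(** * Local existence of flat sections *)

Lemma is_derive_eps (f : R -> R) (x l : R) :
  is_derive f x l <->
  (forall eps, 0 < eps -> locally x (fun t => Rabs (f t - f x - (t - x) * l) <= eps * Rabs (t - x))).
Proof.
  rewrite is_derive_Reals. split.
  - intros H eps Heps. destruct (H eps Heps) as [d Hd]. exists d.
    change (forall t : R, Rabs (t - x) < d ->
      Rabs (f t - f x - (t - x) * l) <= eps * Rabs (t - x)). intros t Ht.
    destruct (Req_dec t x) as [->|Hn].
    { rewrite !Rminus_diag, Rmult_0_l, Rminus_diag, Rabs_R0. lra. }
    specialize (Hd (t - x) ltac:(lra) Ht).
    replace (x + (t - x)) with t in Hd by ring.
    replace (f t - f x - (t - x) * l) with (((f t - f x) / (t - x) - l) * (t - x)) by (field; lra).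
    rewrite Rabs_mult. apply Rmult_le_compat_r; [apply Rabs_pos | now apply Rlt_le].
  - intros H eps Heps. destruct (H (eps / 2) ltac:(lra)) as [d Hd]. exists d. intros h Hh Hhd.
    assert (Hb : ball x d (x + h)).
    { change (Rabs (x + h - x) < d). now replace (x + h - x) with h by ring. }
    specialize (Hd _ Hb). replace (x + h - x) with h in Hd by ring.
    replace ((f (x + h) - f x) / h - l) with ((f (x + h) - f x - h * l) / h) by (field; lra).
    unfold Rdiv. rewrite Rabs_mult, Rabs_inv by exact Hh.
    assert (0 < Rabs h) by now apply Rabs_pos_lt.
    apply (Rmult_lt_reg_r (Rabs h)); [assumption|].
    rewrite Rmult_assoc, Rinv_l, Rmult_1_r by lra. nra.
Qed.

Lemma continuity_uniform_on_segment (g : R -> R -> R) (u a b eps : R) :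
  0 < eps ->
  (forall t, Rmin a b <= t <= Rmax a b -> continuity_2d_pt g u t) ->
  locally u (fun x => forall t, Rmin a b <= t <= Rmax a b -> Rabs (g x t - g u t) < eps).
Proof.
  intros Heps Hg.
  destruct (uniform_continuity_2d_1d' g _ _ u Hg (mkposreal eps Heps)) as [d Hd].
  exists d. change (forall x : R, Rabs (x - u) < d -> forall t, Rmin a b <= t <= Rmax a b ->
    Rabs (g x t - g u t) < eps). intros x Hx t Ht.
  apply Rabs_lt_between in Hx.
  apply (Hd t u t x Ht); [generalize (cond_pos d); lra | exact Ht | lra|].
  rewrite Rminus_diag, Rabs_R0. apply cond_pos.
Qed.

Lemma smooth_on_continuity_2d D g u v : smooth_on D g -> D (u, v) -> continuity_2d_pt g u v.
Proof.
  intros Hg Huv. apply continuity_2d_pt_filterlim.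
  exact (proj2 (proj2 (Hg nil u v Huv))).
Qed.

(** First order expansion in the first variable, uniform along a compact segment of the second
    because [du g] is uniformly continuous there; the mean value inequality is applied to
    [g s t - s * du g u t]. *)
Lemma increment_uniform_on_segment D g (u a b d eps : R) :
  0 < d -> 0 < eps -> smooth_on D g ->
  (forall s t, Rabs (s - u) < d -> Rmin a b <= t <= Rmax a b -> D (s, t)) ->
  locally u (fun x => forall t, Rmin a b <= t <= Rmax a b ->
    Rabs (g x t - g u t - (x - u) * du g u t) <= eps * Rabs (x - u)).
Proof.
  intros Hd Heps Hg HD.
  assert (H0 : Rabs (u - u) < d) by (rewrite Rminus_diag, Rabs_R0; exact Hd).
  destruct (continuity_uniform_on_segment (du g) u a b eps Heps) as [e He].
  { intros t Ht. apply (smooth_on_continuity_2d D); [now apply smooth_on_du | now apply HD]. }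
  assert (Hm : 0 < Rmin d e) by (apply Rmin_pos; [exact Hd | apply cond_pos]).
  exists (mkposreal _ Hm). 
  change (forall x : R, Rabs (x - u) < Rmin d e -> forall t, Rmin a b <= t <= Rmax a b ->
    Rabs (g x t - g u t - (x - u) * du g u t) <= eps * Rabs (x - u)). intros x Hx t Ht.
  pose proof (Rmin_l d e). pose proof (Rmin_r d e).
  replace (g x t - g u t - (x - u) * du g u t)
    with ((g x t - x * du g u t) - (g u t - u * du g u t)) by ring.
  apply (MVT_Rabs (fun s => g s t - s * du g u t) (fun s => du g s t - du g u t)).
  intros s Hs.
  assert (Hsu : Rabs (s - u) <= Rabs (x - u)).
  { apply (between_dist u x); [apply Rle_refl | exact Hs]. }
  split.
  - apply (is_derive_Rminus (fun s => g s t) (fun s => s * du g u t)).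
    + destruct (smooth_on_partials D g Hg s t) as [E _]; [apply HD; [lra | exact Ht] | exact E].
    + auto_derive; [exact I | ring].
  - apply Rlt_le. apply He; [change (Rabs (s - u) < e); lra | exact Ht].
Qed.

Lemma mvmul_mmul n A B w i : mvmul n A (mvmul n B w) i = mvmul n (mmul n A B) w i.
Proof.
  unfold mvmul, mmul.
  rewrite (sum_eq _ (fun j => sum_f_R0 (fun k => A i j * B j k * w k) n)).
  - rewrite sum_f_R0_swap. apply sum_eq. intros k _.
    rewrite Rmult_comm, scal_sum. apply sum_eq; intros; ring.
  - intros j _. rewrite scal_sum. apply sum_eq; intros; ring.
Qed.

Lemma mvmul_lincomb n A a b c (h : R) i :
  mvmul n A (fun k => a k - b k - h * c k) i = mvmul n A a i - mvmul n A b i - h * mvmul n A c i.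
Proof.
  unfold mvmul. rewrite scal_sum, <- !minus_sum. apply sum_eq. intros; ring.
Qed.

Lemma mvmul_row_bound n A w e i :
  (forall j, (j <= n)%nat -> Rabs (A i j) <= e) -> Rabs (mvmul n A w i) <= e * nrm n w.
Proof.
  intros HA. eapply Rle_trans; [apply Rsum_abs|].
  unfold nrm; rewrite scal_sum. apply sum_Rle; intros j Hj.
  rewrite Rabs_mult, Rmult_comm. apply Rmult_le_compat_l; [apply Rabs_pos | now apply HA].
Qed.

(* With [h = x - u], the defect [y(x,t) - y(u,t) - h P y(u,t)] solves the [v]-equation
   up to a forcing term [o(h)]; integrability is what makes its order-[h] part cancel. *)
Lemma transport_partial_u n D P Q y (u q2 v d K M : R) :
  0 < d -> 0 <= K -> INR (S n) * K * Rabs (v - q2) <= / 2 ->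
  msmooth_on n D P -> msmooth_on n D Q -> integrable n D P Q ->
  let seg := fun t => Rmin q2 v <= t <= Rmax q2 v in
  (forall s t, Rabs (s - u) < d -> seg t -> D (s, t)) ->
  (forall s t i j, Rabs (s - u) < d -> seg t -> (i <= n)%nat -> (j <= n)%nat ->
     Rabs (P s t i j) <= K /\ Rabs (Q s t i j) <= K) ->
  (forall s t i, Rabs (s - u) < d -> seg t -> (i <= n)%nat ->
     is_derive (fun t => y s t i) t (mvmul n (Q s t) (y s t) i)) ->
  (forall t, seg t -> nrm n (y u t) <= M) ->
  (forall i, (i <= n)%nat -> is_derive (fun s => y s q2 i) u (mvmul n (P u q2) (y u q2) i)) ->
  forall i, (i <= n)%nat -> is_derive (fun s => y s v i) u (mvmul n (P u v) (y u v) i).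
Proof.
  intros Hd HK HKv HP HQ Hcc seg HD HPQ Hyv HM Hy0 i Hi.
  assert (Hv : seg v) by (split; [apply Rmin_r | apply Rmax_r]).
  assert (H0 : Rabs (u - u) < d) by (rewrite Rminus_diag, Rabs_R0; exact Hd).
  assert (HM0 : 0 <= M) by (eapply Rle_trans; [apply nrm_ge0 | exact (HM v Hv)]).
  assert (HN : 0 < INR (S n)) by (apply lt_0_INR, Nat.lt_0_succ).
  set (N := INR (S n)) in *.
  (* [C - 1] is the factor that the final estimate produces when all small quantities are taken
     relative to [e1 = eps / C]. *)
  set (C := 2 * (N + N * (Rabs (v - q2) * (M + N * (K * M)))) + 1).
  assert (HC : 0 < C).
  { assert (0 <= N * (Rabs (v - q2) * (M + N * (K * M)))); [|unfold C; lra].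
    apply Rmult_le_pos; [lra|]. apply Rmult_le_pos; [apply Rabs_pos|].
    apply Rplus_le_le_0_compat; [exact HM0|]. apply Rmult_le_pos; [lra|].
    now apply Rmult_le_pos. }
  apply is_derive_eps. intros eps Heps.
  set (e1 := eps / C). assert (He1 : 0 < e1) by now apply Rdiv_lt_0_compat.
  assert (L1 : locally u (fun x => Rabs (x - u) < d)) by now exists (mkposreal d Hd).
  assert (L2 : locally u (fun x => forall k, (k <= n)%nat -> forall j, (j <= n)%nat -> forall t, seg t ->
            Rabs (Q x t k j - Q u t k j) < e1)).
  { apply (filter_forall_le n (fun k x => forall j, (j <= n)%nat -> forall t, seg t ->
            Rabs (Q x t k j - Q u t k j) < e1)). intros k Hk.
    apply (filter_forall_le n (fun j x => forall t, seg t -> Rabs (Q x t k j - Q u t k j) < e1)).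
    intros j Hj. apply (continuity_uniform_on_segment (fun x t => Q x t k j)); [exact He1|].
    intros t Ht. apply (smooth_on_continuity_2d D (fun a b => Q a b k j)); [now apply HQ | now apply HD]. }
  assert (L3 : locally u (fun x => forall k, (k <= n)%nat -> forall j, (j <= n)%nat -> forall t, seg t ->
            Rabs (Q x t k j - Q u t k j - (x - u) * du (fun a b => Q a b k j) u t)
            <= e1 * Rabs (x - u))).
  { apply (filter_forall_le n (fun k x => forall j, (j <= n)%nat -> forall t, seg t ->
            Rabs (Q x t k j - Q u t k j - (x - u) * du (fun a b => Q a b k j) u t)
            <= e1 * Rabs (x - u))). intros k Hk.
    apply (filter_forall_le n (fun j x => forall t, seg t ->
            Rabs (Q x t k j - Q u t k j - (x - u) * du (fun a b => Q a b k j) u t)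
            <= e1 * Rabs (x - u))).
    intros j Hj.
    apply (increment_uniform_on_segment D (fun x t => Q x t k j) u q2 v d); auto. }
  assert (L4 : locally u (fun x => forall k, (k <= n)%nat ->
            Rabs (y x q2 k - y u q2 k - (x - u) * mvmul n (P u q2) (y u q2) k)
            <= e1 * Rabs (x - u))).
  { apply (filter_forall_le n (fun k x =>
            Rabs (y x q2 k - y u q2 k - (x - u) * mvmul n (P u q2) (y u q2) k)
            <= e1 * Rabs (x - u))).
    intros k Hk. apply (proj1 (is_derive_eps (fun s => y s q2 k) u _)); [now apply Hy0 | exact He1]. }
  generalize (filter_and _ _ L1 (filter_and _ _ L2 (filter_and _ _ L3 L4))).
  clear L1 L2 L3 L4. apply filter_imp. intros x.
  change R in x. intros [Hx [L2 [L3 L4]]].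
  set (h := x - u) in *.
  set (w := fun t k => y x t k - y u t k - h * mvmul n (P u t) (y u t) k).
  set (Pv := fun t k j => dv (fun a b => P a b k j) u t).
  set (Qu := fun t k j => du (fun a b => Q a b k j) u t).
  set (dw := fun t k => mvmul n (Q x t) (y x t) k - mvmul n (Q u t) (y u t) k
       - h * (mvmul n (Pv t) (y u t) k + mvmul n (P u t) (mvmul n (Q u t) (y u t)) k)).
  set (eta := Rabs h * e1 * (M + N * (K * M))).
  assert (Hw : nrm n (w v) <= 2 * (nrm n (w q2) + N * (Rabs (v - q2) * eta))).
  { apply (contraction_estimate n w dw q2 v K eta); trivial.
    intros t k Ht Hk. split.
    - unfold w, dw. apply (is_derive_Rminus (fun t => y x t k - y u t k)
                             (fun t => h * mvmul n (P u t) (y u t) k)).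
      + apply (is_derive_Rminus (fun t => y x t k) (fun t => y u t k)); now apply Hyv.
      + assert (E : is_derive (fun t => mvmul n (P u t) (y u t) k) t
          (mvmul n (Pv t) (y u t) k + mvmul n (P u t) (mvmul n (Q u t) (y u t)) k)).
        { unfold mvmul at 1 2 3. rewrite <- plus_sum.
          apply (is_derive_sum_f_R0 n (fun j t => P u t k j * y u t j)).
          intros j Hj. apply (is_derive_Rmult (fun t => P u t k j) (fun t => y u t j)).
          - apply (smooth_on_partials D _ (HP k j Hk Hj)). now apply HD.
          - now apply Hyv. }
        apply (is_derive_scal _ _ h) in E. exact E.
    (* The derivative of the defect is [Q(x,t) w] plus a forcing term: the first order remainder
       [E1] of [Q], of size [o(h)], and [h] times the variation [E2] of [Q], of size [o(1)]. *)
    - set (E1 := fun k j => Q x t k j - Q u t k j - h * Qu t k j).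
      set (E2 := fun k j => Q x t k j - Q u t k j).
      replace (dw t k) with (mvmul n (Q x t) (w t) k
         + (mvmul n E1 (y u t) k + h * mvmul n E2 (mvmul n (P u t) (y u t)) k)).
      + eapply Rle_trans; [apply Rabs_triang|]. apply Rplus_le_compat.
        * apply mvmul_bound; [exact Hk|]. intros a b Ha Hb. now apply HPQ.
        * assert (B1 : Rabs (mvmul n E1 (y u t) k) <= e1 * Rabs h * M).
          { eapply Rle_trans; [apply (mvmul_row_bound n E1 _ (e1 * Rabs h))|].
            - intros j Hj. now apply L3.
            - apply Rmult_le_compat_l; [|now apply HM].
              apply Rmult_le_pos; [lra | apply Rabs_pos]. }
          assert (B2 : Rabs (mvmul n E2 (mvmul n (P u t) (y u t)) k) <= e1 * (N * (K * M))).
          { eapply Rle_trans; [apply (mvmul_row_bound n E2 _ e1)|].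
            - intros j Hj. apply Rlt_le. now apply L2.
            - apply Rmult_le_compat_l; [lra|]. apply nrm_bound. intros j Hj.
              eapply Rle_trans; [apply mvmul_bound; [exact Hj|]|].
              + intros a b Ha Hb. now apply HPQ.
              + apply Rmult_le_compat_l; [exact HK | now apply HM]. }
          eapply Rle_trans; [apply Rabs_triang|]. rewrite Rabs_mult.
          apply (Rmult_le_compat_l (Rabs h)) in B2; [|apply Rabs_pos].
          unfold eta. lra.
      + assert (I1 : mvmul n (Pv t) (y u t) k + mvmul n (P u t) (mvmul n (Q u t) (y u t)) k
                   = mvmul n (Qu t) (y u t) k + mvmul n (Q u t) (mvmul n (P u t) (y u t)) k).
        { rewrite !mvmul_mmul. unfold mvmul. rewrite <- !plus_sum.
          apply sum_eq. intros j Hj. rewrite <- !Rmult_plus_distr_r. f_equal.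
          apply (Hcc u t k j); auto. }
        unfold dw. rewrite I1.
        assert (I2 : mvmul n (Q x t) (w t) k = mvmul n (Q x t) (y x t) k
            - mvmul n (Q x t) (y u t) k - h * mvmul n (Q x t) (mvmul n (P u t) (y u t)) k).
        { apply (mvmul_lincomb n (Q x t) (y x t) (y u t) (mvmul n (P u t) (y u t)) h k). }
        assert (I3 : mvmul n E1 (y u t) k = mvmul n (Q x t) (y u t) k - mvmul n (Q u t) (y u t) k
            - h * mvmul n (Qu t) (y u t) k).
        { unfold mvmul. rewrite scal_sum, <- !minus_sum. apply sum_eq. intros; unfold E1; ring. }
        assert (I4 : forall z, mvmul n E2 z k = mvmul n (Q x t) z k - mvmul n (Q u t) z k).
        { intros z. unfold mvmul. rewrite <- minus_sum. apply sum_eq. intros; unfold E2; ring. }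
        rewrite I2, I3, I4. ring. }
  assert (Hw0 : nrm n (w q2) <= N * (e1 * Rabs h)).
  { apply nrm_bound. intros k Hk. now apply L4. }
  eapply Rle_trans; [apply (Rabs_le_nrm n (w v) i Hi)|].
  eapply Rle_trans; [exact Hw|].
  replace eps with (e1 * C) by (unfold e1; field; lra).
  apply Rle_trans with (e1 * Rabs h * (C - 1)).
  - unfold C, eta. lra.
  - assert (0 <= e1 * Rabs h) by (apply Rmult_le_pos; [lra | apply Rabs_pos]). lra.
Qed.

(** Retraction of the line onto a closed interval. Composed with it, coefficients known on a segment
    become continuous and bounded on the whole line, as the Picard iteration requires. *)
Definition clamp (a rho t : R) : R := Rmax (a - rho) (Rmin (a + rho) t).

Lemma clamp_id a rho t : Rabs (t - a) <= rho -> clamp a rho t = t.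
Proof.
  intros H. apply Rabs_le_between in H. unfold clamp.
  rewrite Rmin_right, Rmax_right; lra.
Qed.

Lemma clamp_dist a rho t : 0 <= rho -> Rabs (clamp a rho t - a) <= rho.
Proof.
  intros H. apply Rabs_le. unfold clamp, Rmax, Rmin. repeat destruct Rle_dec; lra.
Qed.

Lemma continuous_clamp a rho t : continuous (clamp a rho) t.
Proof.
  unfold clamp.
  (* The maximum and minimum are rewritten with absolute values, which [reg] can handle. *)
  apply (continuous_ext (fun t => ((a - rho) + ((a + rho + t - Rabs (t - (a + rho))) / 2)
     + Rabs ((a + rho + t - Rabs (t - (a + rho))) / 2 - (a - rho))) / 2)).
  { intros x. unfold Rmax, Rmin, Rabs. repeat destruct Rle_dec; repeat destruct Rcase_abs; lra. }
  apply continuity_pt_filterlim. reg.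
Qed.

Lemma continuous_slice D g (alpha beta : R -> R) t :
  smooth_on D g -> D (alpha t, beta t) -> continuous alpha t -> continuous beta t ->
  continuous (fun s => g (alpha s) (beta s)) t.
Proof.
  intros Hg Ht Ha Hb. apply continuous_comp_2; trivial.
  exact (proj2 (proj2 (Hg nil _ _ Ht))).
Qed.

(** By construction [y] has the initial value, solves the [v]-equation, and solves the [u]-equation
    on the line [v = q2]; [transport_partial_u] carries the last property off that line. *)
Lemma flat_section_local n D P Q p1 p2 r K q1 q2 (c : Vec) :
  open D -> msmooth_on n D P -> msmooth_on n D Q -> integrable n D P Q ->
  good_square n D P Q p1 p2 r K -> square p1 p2 r (q1, q2) ->
  exists y, flat_section n P Q (square p1 p2 r) y /\ forall i, y q1 q2 i = c i.
Proof.
  intros openD HP HQ Hcc [Hr [HK [HKr [HsD HPQ]]]] [Hq1 Hq2]. simpl in Hq1, Hq2.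
  (* A point at distance at most [2 * r] from the base point stays within [3 * r] of the centre,
     hence inside the square of half side [4 * r] where the bounds hold. *)
  assert (Hsq : forall u v, Rabs (u - q1) <= 2 * r -> Rabs (v - q2) <= 2 * r ->
            square p1 p2 (4 * r) (u, v)).
  { intros u v Hu Hv. apply Rabs_le_between in Hu. apply Rabs_le_between in Hv.
    apply Rabs_lt_between in Hq1. apply Rabs_lt_between in Hq2.
    split; apply Rabs_lt_between; simpl; lra. }
  assert (H00 : forall a, Rabs (a - a) <= 2 * r) by (intros; rewrite Rminus_diag, Rabs_R0; lra).
  assert (H2r : 0 <= 2 * r) by lra.
  set (A := fun t => P (clamp q1 (2 * r) t) q2).
  set (B := fun u t => Q u (clamp q2 (2 * r) t)).
  set (a := ode_solution n A c q1).
  set (y := fun u v => ode_solution n (B u) (a u) q2 v).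
  assert (Ha : forall t i, Rabs (t - q1) < 2 * r -> (i <= n)%nat ->
            is_derive (fun s => a s i) t (mvmul n (P t q2) (a t) i)).
  { intros t i Ht Hi.
    replace (mvmul n (P t q2) (a t) i) with (mvmul n (A t) (a t) i)
      by (unfold A; rewrite clamp_id by lra; reflexivity).
    apply (ode_solution_derive n A c q1 (2 * r) K); trivial.
    - intros k j s Hk Hj. unfold A.
      apply (continuous_slice D (fun u v => P u v k j) (clamp q1 (2 * r)) (fun _ => q2)).
      + now apply HP.
      + apply HsD, Hsq; [now apply clamp_dist | apply H00].
      + apply continuous_clamp.
      + apply continuous_const.
    - intros k j s Hk Hj. apply HPQ; trivial.
      apply Hsq; [now apply clamp_dist | apply H00]. }
  assert (Hy : forall u v i, Rabs (u - q1) < 2 * r -> Rabs (v - q2) < 2 * r -> (i <= n)%nat ->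
            is_derive (fun s => y u s i) v (mvmul n (Q u v) (y u v) i)).
  { intros u v i Hu Hv Hi.
    replace (mvmul n (Q u v) (y u v) i) with (mvmul n (B u v) (y u v) i)
      by (unfold B; rewrite clamp_id by lra; reflexivity).
    apply (ode_solution_derive n (B u) (a u) q2 (2 * r) K); trivial.
    - intros k j s Hk Hj. unfold B.
      apply (continuous_slice D (fun u v => Q u v k j) (fun _ => u) (clamp q2 (2 * r))).
      + now apply HQ.
      + apply HsD, Hsq; [lra | now apply clamp_dist].
      + apply continuous_const.
      + apply continuous_clamp.
    - intros k j s Hk Hj. apply HPQ; trivial.
      apply Hsq; [lra | now apply clamp_dist]. }
  assert (Hyq : forall u i, y u q2 i = a u i) by (intros; apply ode_solution_initial).
  exists y. split.
  2: { intros i. rewrite Hyq. apply ode_solution_initial. }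
  intros u v i [Hu Hv] Hi. simpl in Hu, Hv.
  assert (Hu2 : Rabs (u - q1) < 2 * r).
  { apply Rabs_lt_between in Hu. apply Rabs_lt_between in Hq1. apply Rabs_lt_between. lra. }
  assert (Hv2 : Rabs (v - q2) < 2 * r).
  { apply Rabs_lt_between in Hv. apply Rabs_lt_between in Hq2. apply Rabs_lt_between. lra. }
  split; [|now apply Hy].
  assert (Hseg : forall t, Rmin q2 v <= t <= Rmax q2 v -> Rabs (t - q2) < 2 * r).
  { intros t Ht. eapply Rle_lt_trans; [|exact Hv2].
    apply (between_dist q2 v); [apply Rle_refl | exact Ht]. }
  assert (Hnear : forall s, Rabs (s - u) < 2 * r - Rabs (u - q1) -> Rabs (s - q1) < 2 * r).
  { intros s Hs. replace (s - q1) with ((s - u) + (u - q1)) by ring.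
    eapply Rle_lt_trans; [apply Rabs_triang | lra]. }
  assert (HKv : forall t, Rabs (t - q2) < 2 * r -> INR (S n) * K * Rabs (t - q2) <= / 2).
  { intros t Ht. eapply Rle_trans; [|exact HKr].
    apply Rmult_le_compat_l; [|lra]. apply Rmult_le_pos; [apply pos_INR | exact HK]. }
  (* The width [2 * r - Rabs (u - q1)] keeps [s] within [2 * r] of [q1]; the bound
     [2 * nrm n (y u q2)] is the contraction estimate without forcing term. *)
  apply (transport_partial_u n D P Q y u q2 v (2 * r - Rabs (u - q1)) K (2 * nrm n (y u q2)));
    trivial.
  - lra.
  - now apply HKv.
  - intros s t Hs Ht. apply HsD, Hsq; apply Rlt_le; [now apply Hnear | now apply Hseg].
  - intros s t k j Hs Ht Hk Hj.
    apply HPQ; trivial. apply Hsq; apply Rlt_le; [now apply Hnear | now apply Hseg].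
  - intros s t k Hs Ht Hk. apply Hy; auto.
  - intros t Ht. replace (2 * nrm n (y u q2))
      with (2 * (nrm n (y u q2) + INR (S n) * (Rabs (t - q2) * 0))) by ring.
    apply (contraction_estimate n (fun s => y u s) (fun s => mvmul n (Q u s) (y u s)) q2 t K);
      trivial.
    + apply HKv. now apply Hseg.
    + intros s k Hs Hk.
      assert (Hs2 : Rabs (s - q2) < 2 * r).
      { eapply Rle_lt_trans; [|apply (Hseg t Ht)].
        apply (between_dist q2 t); [apply Rle_refl | exact Hs]. }
      split; [now apply Hy|].
      rewrite Rplus_0_r. apply mvmul_bound; [exact Hk|].
      intros. apply HPQ; trivial. apply Hsq; lra.
  - intros k Hk.
    apply (is_derive_ext (fun s => a s k)); [intros; now rewrite Hyq|].
    replace (mvmul n (P u q2) (y u q2) k) with (mvmul n (P u q2) (a u) k).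
    + now apply Ha.
    + apply sum_eq. intros; now rewrite Hyq.
Qed.

(** * Monodromy *)

(** Connectedness of the unit interval by means of the mean value inequality: the indicator function
    of [phi], extended by clamping its argument, has derivative 0 everywhere. *)
Lemma locally_constant_segment (phi : R -> Prop) :
  (forall t, unit_I t -> exists d, 0 < d /\
     forall t', unit_I t' -> Rabs (t' - t) < d -> (phi t' <-> phi t)) ->
  forall a b, unit_I a -> unit_I b -> phi a -> phi b.
Proof.
  intros Hloc a b Ha Hb Hpa.
  set (c := fun t => Rmax 0 (Rmin 1 t)).
  assert (Hc : forall t, unit_I (c t)).
  { intros t. unfold unit_I, c, Rmax, Rmin. repeat destruct Rle_dec; lra. }
  assert (Hcl : forall t s, Rabs (c t - c s) <= Rabs (t - s)).
  { intros t s. unfold c, Rmax, Rmin.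
    repeat destruct Rle_dec; unfold Rabs; repeat destruct Rcase_abs; lra. }
  assert (Hci : forall t, unit_I t -> c t = t).
  { intros t Ht. unfold unit_I, c, Rmax, Rmin in *. repeat destruct Rle_dec; lra. }
  set (chi := fun t => if excluded_middle_informative (phi (c t)) then 1 else 0).
  assert (H0 : Rabs (chi b - chi a) <= 0 * Rabs (b - a)).
  { apply (MVT_Rabs chi (fun _ => 0)). intros x _. split; [|rewrite Rabs_R0; lra].
    destruct (Hloc (c x) (Hc x)) as [d [Hd Hx]].
    apply (is_derive_ext_loc (fun _ => chi x)); [|apply is_derive_Rconst].
    exists (mkposreal d Hd). intros t Ht. change (Rabs (t - x) < d) in Ht.
    assert (E : phi (c t) <-> phi (c x)).
    { apply Hx; [apply Hc|]. eapply Rle_lt_trans; [apply Hcl | exact Ht]. }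
    unfold chi. do 2 destruct excluded_middle_informative; tauto. }
  rewrite Rmult_0_l in H0.
  destruct (excluded_middle_informative (phi b)) as [Hpb|Hpb]; [exact Hpb|exfalso].
  revert H0. unfold chi. rewrite !Hci by assumption.
  do 2 destruct excluded_middle_informative; try tauto.
  unfold Rabs; destruct Rcase_abs; lra.
Qed.

Definition near (z : R * R) (d : R) : R * R -> Prop := square (fst z) (snd z) d.

Lemma near_center z d : 0 < d -> near z d z.
Proof. intros Hd; split; rewrite Rminus_diag, Rabs_R0; exact Hd. Qed.

Lemma near_mono z d d' w : d <= d' -> near z d w -> near z d' w.
Proof. intros Hd [H1 H2]; split; lra. Qed.

Lemma near_locally (z : R * R) (S : R * R -> Prop) :
  locally z S <-> exists d, 0 < d /\ forall w, near z d w -> S w.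
Proof.
  destruct z as [z1 z2]. split.
  - intros [d Hd]. exists d. split; [apply cond_pos|]. intros w [H1 H2]. apply Hd.
    split; assumption.
  - intros [d [Hd H]]. exists (mkposreal d Hd). intros w [H1 H2]. apply H. split; assumption.
Qed.

Lemma near_open z d : open (near z d).
Proof.
  change (forall w : R * R, near z d w -> locally w (near z d)).
  intros w [H1 H2]. apply near_locally.
  exists (Rmin (d - Rabs (fst w - fst z)) (d - Rabs (snd w - snd z))). split.
  - apply Rmin_pos; lra.
  - intros x [K1 K2].
    pose proof (Rmin_l (d - Rabs (fst w - fst z)) (d - Rabs (snd w - snd z))).
    pose proof (Rmin_r (d - Rabs (fst w - fst z)) (d - Rabs (snd w - snd z))).
    split.
    + replace (fst x - fst z) with ((fst x - fst w) + (fst w - fst z)) by ring.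
      eapply Rle_lt_trans; [apply Rabs_triang | lra].
    + replace (snd x - snd z) with ((snd x - snd w) + (snd w - snd z)) by ring.
      eapply Rle_lt_trans; [apply Rabs_triang | lra].
Qed.

Lemma continuous_near (H : R * R -> R * R) z r :
  continuous H z -> 0 < r -> exists d, 0 < d /\ forall w, near z d w -> near (H z) r (H w).
Proof.
  intros Hc Hr. apply near_locally. apply Hc.
  apply near_open. now apply near_center.
Qed.

Lemma open_near D (z : R * R) : open D -> D z -> exists d, 0 < d /\ forall w, near z d w -> D w.
Proof. intros HD Hz. apply near_locally. now apply HD. Qed.

Lemma continuous_comp_snd (g : R -> R * R) (z : R * R) :
  continuous g (snd z) -> continuous (fun w : R * R => g (snd w)) z.
Proof.
  apply (continuous_comp (fun w : R * R => snd w) g).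
  apply (continuous_snd (U := R_UniformSpace) (V := R_UniformSpace)).
Qed.

Section Monodromy.
Variables (n : nat) (D : R * R -> Prop) (P Q : mfield).
Hypothesis openD : open D.
Hypothesis smoothP : msmooth_on n D P.
Hypothesis smoothQ : msmooth_on n D Q.
Hypothesis PQ_integrable : integrable n D P Q.

Definition good (p : R * R) (r K : R) : Prop := good_square n D P Q (fst p) (snd p) r K.

Definition veq (a b : Vec) : Prop := forall i, (i <= n)%nat -> a i = b i.

Definition at_point (y : R -> R -> Vec) (p : R * R) : Vec := y (fst p) (snd p).

(** The square is required to be good so that uniqueness of flat sections holds on it. *)
Definition flat_germ (p : R * R) (y : R -> R -> Vec) : Prop :=
  exists r K, good p r K /\ flat_section n P Q (near p r) y.

Lemma flat_section_subset (S S' : R * R -> Prop) y :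
  (forall q, S q -> S' q) -> flat_section n P Q S' y -> flat_section n P Q S y.
Proof. intros HS Hy u v i Huv Hi. apply Hy; auto. Qed.

Lemma good_exists p : D p -> exists r K, good p r K.
Proof. intros Hp. apply good_square_exists; trivial. now destruct p. Qed.

Lemma good_shrink p r K r' : good p r K -> 0 < r' -> r' <= r -> good p r' K.
Proof.
  intros [Hr [HK [HKr [HsD HPQ]]]] Hr' Hle.
  assert (Hs : forall q, square (fst p) (snd p) (4 * r') q -> square (fst p) (snd p) (4 * r) q).
  { intros q [H1 H2]; split; lra. }
  split; [exact Hr'|]. split; [exact HK|]. split; [|split].
  - eapply Rle_trans; [|exact HKr]. apply Rmult_le_compat_l; [|lra].
    apply Rmult_le_pos; [apply pos_INR | exact HK].
  - intros q Hq. now apply HsD, Hs.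
  - intros u v i j Hq Hi Hj. apply HPQ; auto.
Qed.

Lemma flat_germ_of_open (S : R * R -> Prop) p y :
  open S -> S p -> D p -> flat_section n P Q S y -> flat_germ p y.
Proof.
  intros openS Hp HDp Hy. destruct (good_exists p HDp) as [r [K G]].
  destruct (open_near S p openS Hp) as [d [Hd HS]].
  assert (Hr : 0 < r) by apply G.
  exists (Rmin r d), K. split.
  - apply (good_shrink p r K); [exact G | now apply Rmin_pos | apply Rmin_l].
  - apply (flat_section_subset _ S); [|exact Hy].
    intros q Hq. apply HS. apply (near_mono _ (Rmin r d)); [apply Rmin_r | exact Hq].
Qed.

Lemma flat_germ_local p c :
  D p -> exists r K y, good p r K /\ flat_section n P Q (near p r) y /\ veq (at_point y p) c.
Proof.
  intros Hp. destruct (good_exists p Hp) as [r [K G]].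
  destruct (flat_section_local n D P Q (fst p) (snd p) r K (fst p) (snd p) c) as [y [Hy Hc]];
    trivial.
  - destruct p; apply (near_center (_, _)), G.
  - exists r, K, y. split; [exact G|]. split; [exact Hy|]. intros i _. apply Hc.
Qed.

(** The point [q] of agreement need not be the centre: this makes both agreement and disagreement of
    two lifts open conditions. *)
Lemma flat_germ_agree p y z :
  flat_germ p y -> flat_germ p z ->
  exists r, 0 < r /\ forall q q', near p r q -> near p r q' ->
    veq (at_point y q) (at_point z q) -> veq (at_point y q') (at_point z q').
Proof.
  intros [r [K [G Hy]]] [r' [K' [G' Hz]]].
  assert (Hr : 0 < r) by apply G. assert (Hr' : 0 < r') by apply G'.
  exists (Rmin r r'). split; [now apply Rmin_pos|].
  intros q q' Hq Hq' E i Hi. apply Rminus_diag_uniq.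
  apply (flat_section_zero n D P Q (fst p) (snd p) (Rmin r r') K
     (fun u v i => y u v i - z u v i) (fst q) (snd q)); trivial.
  - apply (good_shrink p r K); [exact G | now apply Rmin_pos | apply Rmin_l].
  - apply flat_section_minus.
    + apply (flat_section_subset _ (near p r)); [|exact Hy].
      intros w. apply near_mono, Rmin_l.
    + apply (flat_section_subset _ (near p r')); [|exact Hz].
      intros w. apply near_mono, Rmin_r.
  - intros j Hj. specialize (E j Hj). unfold at_point in E. lra.
Qed.

(* [s] lifts [H] over [S]: near each point of [S] it is [y o H] for a flat section [y]. *)
Definition is_lift (S : R * R -> Prop) (H : R * R -> R * R) (s : R * R -> Vec) : Prop :=
  forall z, S z -> continuous H z /\ exists y, flat_germ (H z) y /\
    exists d, 0 < d /\ forall w, S w -> near z d w -> veq (s w) (at_point y (H w)).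

Definition convex (S : R * R -> Prop) : Prop :=
  forall z w t, S z -> S w -> unit_I t ->
    S (fst z + t * (fst w - fst z), snd z + t * (snd w - snd z)).

Definition closed_set (S : R * R -> Prop) : Prop :=
  forall z, ~ S z -> exists d, 0 < d /\ forall w, near z d w -> ~ S w.

Lemma is_lift_agree_locally S H s s' z :
  is_lift S H s -> is_lift S H s' -> S z ->
  exists d, 0 < d /\ forall w w', S w -> S w' -> near z d w -> near z d w' ->
    veq (s w) (s' w) -> veq (s w') (s' w').
Proof.
  intros Hs Hs' Hz.
  destruct (Hs z Hz) as [Hc [y [Gy [d [Hd Ey]]]]].
  destruct (Hs' z Hz) as [_ [y' [Gy' [d' [Hd' Ey']]]]].
  destruct (flat_germ_agree _ _ _ Gy Gy') as [r [Hr Hagree]].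
  destruct (continuous_near H z r Hc Hr) as [e [He HHe]].
  exists (Rmin e (Rmin d d')). split; [repeat apply Rmin_pos; assumption|].
  assert (M : forall w, near z (Rmin e (Rmin d d')) w -> near z e w /\ near z d w /\ near z d' w).
  { intros w Hw. pose proof (Rmin_l e (Rmin d d')). pose proof (Rmin_r e (Rmin d d')).
    pose proof (Rmin_l d d'). pose proof (Rmin_r d d').
    split; [|split]; apply (near_mono z (Rmin e (Rmin d d'))); trivial; lra. }
  intros w w' Sw Sw' Nw Nw' E.
  apply M in Nw. apply M in Nw'. destruct Nw as [N1 [N2 N3]], Nw' as [N1' [N2' N3']].
  intros i Hi. rewrite (Ey w' Sw' N2' i Hi), (Ey' w' Sw' N3' i Hi).
  apply (Hagree (H w) (H w')); auto.
  intros j Hj. rewrite <- (Ey w Sw N2 j Hj), <- (Ey' w Sw N3 j Hj). now apply E.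
Qed.

(** Along the segment from [z] to [w], agreement of the two lifts is locally constant. *)
Lemma is_lift_unique S H s s' z w :
  convex S -> is_lift S H s -> is_lift S H s' -> S z -> S w ->
  veq (s z) (s' z) -> veq (s w) (s' w).
Proof.
  intros HS Hs Hs' Hz Hw E.
  set (g := fun t => (fst z + t * (fst w - fst z), snd z + t * (snd w - snd z))).
  assert (g0 : g 0 = z) by (unfold g; rewrite !Rmult_0_l, !Rplus_0_r; now destruct z).
  assert (g1 : g 1 = w).
  { unfold g; rewrite !Rmult_1_l. destruct w as [w1 w2]; simpl. f_equal; ring. }
  rewrite <- g1. rewrite <- g0 in E.
  revert E. apply (locally_constant_segment (fun t => veq (s (g t)) (s' (g t))));
    [|split; lra | split; lra].
  intros t Ht.
  destruct (is_lift_agree_locally S H s s' (g t) Hs Hs') as [d [Hd Ha]]; [now apply HS|].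
  (* A Lipschitz constant of the segment, kept positive by the [1] when [z = w]. *)
  set (L := Rabs (fst w - fst z) + Rabs (snd w - snd z) + 1).
  pose proof (Rabs_pos (fst w - fst z)). pose proof (Rabs_pos (snd w - snd z)).
  assert (HL : 0 < L) by (unfold L; lra).
  exists (d / L). split; [now apply Rdiv_lt_0_compat|].
  intros t' Ht' Htt.
  assert (N : near (g t) d (g t')).
  { assert (Hd' : Rabs (t' - t) * L < d).
    { apply (Rmult_lt_compat_r L) in Htt; [|exact HL].
      replace (d / L * L) with d in Htt by (field; lra). exact Htt. }
    pose proof (Rabs_pos (t' - t)).
    split; unfold g; simpl.
    - replace (fst z + t' * (fst w - fst z) - (fst z + t * (fst w - fst z)))
        with ((t' - t) * (fst w - fst z)) by ring.
      rewrite Rabs_mult. eapply Rle_lt_trans; [|exact Hd'].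
      apply Rmult_le_compat_l; [assumption | unfold L; lra].
    - replace (snd z + t' * (snd w - snd z) - (snd z + t * (snd w - snd z)))
        with ((t' - t) * (snd w - snd z)) by ring.
      rewrite Rabs_mult. eapply Rle_lt_trans; [|exact Hd'].
      apply Rmult_le_compat_l; [assumption | unfold L; lra]. }
  split; apply Ha; try (now apply HS); trivial; now apply near_center.
Qed.

Lemma is_lift_subset (S S' : R * R -> Prop) H s :
  (forall z, S z -> S' z) -> is_lift S' H s -> is_lift S H s.
Proof.
  intros HS Hs z Hz. destruct (Hs z (HS z Hz)) as [Hc [y [Gy [d [Hd Ey]]]]].
  split; [exact Hc|]. exists y; split; [exact Gy|]. exists d; split; auto.
Qed.

Lemma is_lift_comp (S S' : R * R -> Prop) H s phi :
  (forall z, S z -> S' (phi z)) -> (forall z, S z -> continuous phi z) -> is_lift S' H s ->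
  is_lift S (fun z => H (phi z)) (fun z => s (phi z)).
Proof.
  intros HS Hphi Hs z Hz. destruct (Hs (phi z) (HS z Hz)) as [Hc [y [Gy [d [Hd Ey]]]]].
  split; [now apply continuous_comp; [apply Hphi|]|].
  exists y; split; [exact Gy|].
  destruct (continuous_near phi z d (Hphi z Hz) Hd) as [e [He Hn]].
  exists e; split; [exact He|]. intros w Sw Nw. apply Ey; auto.
Qed.

Lemma is_lift_ext (S : R * R -> Prop) H H' s :
  (forall z, S z -> H z = H' z) -> (forall z, S z -> continuous H' z) ->
  is_lift S H s -> is_lift S H' s.
Proof.
  intros E Hc Hs z Hz. destruct (Hs z Hz) as [_ [y [Gy [d [Hd Ey]]]]].
  split; [now apply Hc|]. exists y. rewrite <- E by exact Hz. split; [exact Gy|].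
  exists d; split; [exact Hd|]. intros w Sw Nw. rewrite <- E by exact Sw. now apply Ey.
Qed.

(** At a point of only one of the sets, closedness of the other gives a neighbourhood that avoids
    it. At a common point the two germs have the same value, hence coincide nearby. *)
Lemma is_lift_glue (S1 S2 : R * R -> Prop) H s1 s2 :
  closed_set S1 -> closed_set S2 -> is_lift S1 H s1 -> is_lift S2 H s2 ->
  (forall z, S1 z -> S2 z -> veq (s1 z) (s2 z)) ->
  exists s, is_lift (fun z => S1 z \/ S2 z) H s /\
    (forall z, S1 z -> veq (s z) (s1 z)) /\ (forall z, S2 z -> veq (s z) (s2 z)).
Proof.
  intros C1 C2 L1 L2 E.
  set (s := fun z => if excluded_middle_informative (S1 z) then s1 z else s2 z).
  assert (E1 : forall z, S1 z -> veq (s z) (s1 z)).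
  { intros z Hz i Hi. unfold s. destruct excluded_middle_informative; tauto. }
  assert (E2 : forall z, S2 z -> veq (s z) (s2 z)).
  { intros z Hz i Hi. unfold s. destruct excluded_middle_informative; [now apply E | reflexivity]. }
  exists s. split; [|split; assumption].
  intros z Hz.
  destruct (excluded_middle_informative (S1 z)) as [H1|H1];
    destruct (excluded_middle_informative (S2 z)) as [H2|H2].
  - destruct (L1 z H1) as [Hc [y [Gy [d [Hd Ey]]]]].
    destruct (L2 z H2) as [_ [y' [Gy' [d' [Hd' Ey']]]]].
    split; [exact Hc|]. exists y; split; [exact Gy|].
    destruct (flat_germ_agree _ _ _ Gy Gy') as [r [Hr Hagree]].
    destruct (continuous_near H z r Hc Hr) as [e [He HHe]].
    exists (Rmin e (Rmin d d')). split; [repeat apply Rmin_pos; assumption|].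
    intros w Hw Nw.
    pose proof (Rmin_l e (Rmin d d')). pose proof (Rmin_r e (Rmin d d')).
    pose proof (Rmin_l d d'). pose proof (Rmin_r d d').
    assert (Nd : near z d w) by (apply (near_mono z (Rmin e (Rmin d d'))); trivial; lra).
    assert (Nd' : near z d' w) by (apply (near_mono z (Rmin e (Rmin d d'))); trivial; lra).
    assert (Ne : near z e w) by (apply (near_mono z (Rmin e (Rmin d d'))); trivial; lra).
    intros i Hi. destruct Hw as [Hw|Hw].
    + rewrite E1 by assumption. now apply Ey.
    + rewrite E2, (Ey' w Hw Nd' i Hi) by assumption. symmetry.
      apply (Hagree (H z) (H w)); auto using near_center.
      intros j Hj. rewrite <- (Ey z H1 (near_center z d Hd) j Hj).
      rewrite <- (Ey' z H2 (near_center z d' Hd') j Hj). now apply E.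
  - destruct (L1 z H1) as [Hc [y [Gy [d [Hd Ey]]]]].
    split; [exact Hc|]. exists y; split; [exact Gy|].
    destruct (C2 z H2) as [e [He Hn]].
    exists (Rmin d e). split; [now apply Rmin_pos|]. intros w [Hw|Hw] Nw i Hi.
    + rewrite E1 by assumption. apply Ey; trivial.
      apply (near_mono z (Rmin d e)); [apply Rmin_l | exact Nw].
    + exfalso. apply (Hn w); [|exact Hw].
      apply (near_mono z (Rmin d e)); [apply Rmin_r | exact Nw].
  - destruct (L2 z H2) as [Hc [y [Gy [d [Hd Ey]]]]].
    split; [exact Hc|]. exists y; split; [exact Gy|].
    destruct (C1 z H1) as [e [He Hn]].
    exists (Rmin d e). split; [now apply Rmin_pos|]. intros w [Hw|Hw] Nw i Hi.
    + exfalso. apply (Hn w); [|exact Hw].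
      apply (near_mono z (Rmin d e)); [apply Rmin_r | exact Nw].
    + rewrite E2 by assumption. apply Ey; trivial.
      apply (near_mono z (Rmin d e)); [apply Rmin_l | exact Nw].
  - tauto.
Qed.

(** Base point and value are both arbitrary, so that a lift over one piece can be continued into a
    neighbouring one from either side. *)
Definition liftable (H : R * R -> R * R) (S : R * R -> Prop) : Prop :=
  forall z c, S z -> exists s, is_lift S H s /\ veq (s z) c.

Lemma liftable_equiv H (S S' : R * R -> Prop) :
  (forall z, S z <-> S' z) -> liftable H S -> liftable H S'.
Proof.
  intros E L z c Hz. destruct (L z c) as [s [Hs Hc]]; [now apply E|].
  exists s; split; [|exact Hc]. apply (is_lift_subset S' S); [|exact Hs]. intros; now apply E.
Qed.

(** The second lift is started at the common point [w] with the value of the first; convexity of the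
    intersection turns agreement at [w] into agreement on the whole overlap. *)
Lemma liftable_union H (S1 S2 : R * R -> Prop) w :
  closed_set S1 -> closed_set S2 -> convex (fun z => S1 z /\ S2 z) -> S1 w -> S2 w ->
  liftable H S1 -> liftable H S2 -> liftable H (fun z => S1 z \/ S2 z).
Proof.
  intros C1 C2 Cx W1 W2 L1 L2.
  assert (Hglue : forall (T1 T2 : R * R -> Prop) s1, closed_set T1 -> closed_set T2 ->
     convex (fun z => T1 z /\ T2 z) -> T1 w -> T2 w -> is_lift T1 H s1 -> liftable H T2 ->
     exists s, is_lift (fun z => T1 z \/ T2 z) H s /\ forall z, T1 z -> veq (s z) (s1 z)).
  { intros T1 T2 s1 D1 D2 Dx V1 V2 Hs1 M2. destruct (M2 w (s1 w) V2) as [s2 [Hs2 Ew]].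
    destruct (is_lift_glue T1 T2 H s1 s2) as [s [Hs [E1 _]]]; trivial.
    - intros z Z1 Z2.
      apply (is_lift_unique (fun z => T1 z /\ T2 z) H s1 s2 w z); trivial; try tauto.
      + apply (is_lift_subset _ T1); trivial; tauto.
      + apply (is_lift_subset _ T2); trivial; tauto.
      + intros i Hi. symmetry. now apply Ew.
    - now exists s. }
  intros z c [Hz|Hz].
  - destruct (L1 z c Hz) as [s1 [Hs1 Ez]].
    destruct (Hglue S1 S2 s1) as [s [Hs E]]; trivial.
    exists s; split; [exact Hs|]. intros i Hi. rewrite (E z Hz i Hi). now apply Ez.
  - destruct (L2 z c Hz) as [s2 [Hs2 Ez]].
    destruct (Hglue S2 S1 s2) as [s [Hs E]]; trivial.
    { intros a b t [A1 A2] [B1 B2] Ht. destruct (Cx a b t) as [X1 X2]; trivial; tauto. }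
    exists s; split.
    + apply (is_lift_subset _ (fun z => S2 z \/ S1 z)); [tauto | exact Hs].
    + intros i Hi. rewrite (E z Hz i Hi). now apply Ez.
Qed.

(** A single flat section on the good square, composed with [H], is the lift. *)
Lemma liftable_small H (S : R * R -> Prop) p r K :
  good p r K -> (forall z, S z -> continuous H z /\ near p r (H z)) -> liftable H S.
Proof.
  intros G HS z c Hz.
  assert (HD : forall q, near p r q -> D q).
  { intros q [H1 H2]. assert (Hr : 0 < r) by apply G. apply G. split; lra. }
  destruct (flat_section_local n D P Q (fst p) (snd p) r K (fst (H z)) (snd (H z)) c)
    as [y [Hy Hc]]; trivial.
  { now apply HS. }
  exists (fun w => at_point y (H w)). split.
  - intros w Hw. destruct (HS w Hw) as [Hcw Hn]. split; [exact Hcw|]. exists y. split.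
    + apply (flat_germ_of_open (near p r)); auto using near_open.
    + exists 1. split; [lra|]. now intros ? ? ? ? ?.
  - intros i Hi. apply Hc.
Qed.

(** * Lifting over the unit square by subdivision *)

Definition rect (a0 a1 b0 b1 : R) (z : R * R) : Prop :=
  a0 <= fst z <= a1 /\ b0 <= snd z <= b1.

Lemma rect_closed a0 a1 b0 b1 : closed_set (rect a0 a1 b0 b1).
Proof.
  intros z Hz.
  assert (C : fst z < a0 \/ a1 < fst z \/ snd z < b0 \/ b1 < snd z).
  { unfold rect in Hz. destruct (Rlt_dec (fst z) a0), (Rlt_dec a1 (fst z)),
      (Rlt_dec (snd z) b0), (Rlt_dec b1 (snd z)); try tauto. exfalso; apply Hz; lra. }
  destruct C as [C|[C|[C|C]]];
    [exists (a0 - fst z) | exists (fst z - a1) | exists (b0 - snd z) | exists (snd z - b1)];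
    (split; [lra|]; intros w [H1 H2] [R1 R2];
     apply Rabs_lt_between in H1; apply Rabs_lt_between in H2; lra).
Qed.

Lemma rect_convex a0 a1 b0 b1 : convex (rect a0 a1 b0 b1).
Proof.
  intros z w t [Z1 Z2] [W1 W2] [T0 T1]. unfold rect; simpl. repeat split; nra.
Qed.

Lemma liftable_split_h H a0 m a1 b0 b1 :
  a0 <= m <= a1 -> b0 <= b1 -> liftable H (rect a0 m b0 b1) -> liftable H (rect m a1 b0 b1) ->
  liftable H (rect a0 a1 b0 b1).
Proof.
  intros Hm Hb L1 L2.
  apply (liftable_equiv H (fun z => rect a0 m b0 b1 z \/ rect m a1 b0 b1 z)).
  { intros z. unfold rect. destruct (Rle_dec (fst z) m); split; intros; lra. }
  apply (liftable_union H _ _ (m, b0)); trivial using rect_closed.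
  - intros z w t [Z1 Z2] [W1 W2] Ht. split; now apply rect_convex.
  - unfold rect; simpl; lra.
  - unfold rect; simpl; lra.
Qed.

Lemma liftable_split_v H a0 a1 b0 m b1 :
  a0 <= a1 -> b0 <= m <= b1 -> liftable H (rect a0 a1 b0 m) -> liftable H (rect a0 a1 m b1) ->
  liftable H (rect a0 a1 b0 b1).
Proof.
  intros Ha Hm L1 L2.
  apply (liftable_equiv H (fun z => rect a0 a1 b0 m z \/ rect a0 a1 m b1 z)).
  { intros z. unfold rect. destruct (Rle_dec (snd z) m); split; intros; lra. }
  apply (liftable_union H _ _ (a0, m)); trivial using rect_closed.
  - intros z w t [Z1 Z2] [W1 W2] Ht. split; now apply rect_convex.
  - unfold rect; simpl; lra.
  - unfold rect; simpl; lra.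
Qed.

(** A Lebesgue number for the cover of the unit square by neighbourhoods that [H] maps into good
    squares. *)
Lemma good_square_lebesgue H :
  (forall z, rect 0 1 0 1 z -> continuous H z /\ D (H z)) ->
  exists d, 0 < d /\ forall S z, rect 0 1 0 1 z -> (forall w, S w -> rect 0 1 0 1 w /\ near z d w) ->
    liftable H S.
Proof.
  intros HH.
  (* The factor 2 leaves room for two steps: [z] lies within [delta] of the centre chosen by
     compactness, and [w] lies within [d <= delta] of [z]. *)
  assert (Hz : forall z, exists d : posreal, rect 0 1 0 1 z ->
     exists r K, good (H z) r K /\ forall w, near z (2 * d) w -> near (H z) r (H w)).
  { intros z. destruct (excluded_middle_informative (rect 0 1 0 1 z)) as [Rz|Rz].
    - destruct (HH z Rz) as [Hc HD]. destruct (good_exists _ HD) as [r [K G]].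
      destruct (continuous_near H z r Hc ltac:(apply G)) as [d [Hd Hn]].
      exists (mkposreal (d / 2) ltac:(lra)). intros _. exists r, K. split; [exact G|].
      intros w Nw. apply Hn. apply (near_mono z (2 * (d / 2))); [lra | exact Nw].
    - exists (mkposreal 1 Rlt_0_1). tauto. }
  set (delta := fun z => proj1_sig (constructive_indefinite_description _ (Hz z))).
  assert (Hdelta : forall z, rect 0 1 0 1 z ->
     exists r K, good (H z) r K /\ forall w, near z (2 * delta z) w -> near (H z) r (H w)).
  { intros z. unfold delta. destruct constructive_indefinite_description as [d Hd]. exact Hd. }
  destruct (compactness_value_2d 0 1 0 1 (fun a b => delta (a, b))) as [d Hd].
  exists d. split; [apply cond_pos|]. intros S z Rz HS.
  destruct (NNPP _ (Hd (fst z) (snd z) (proj1 Rz) (proj2 Rz))) as [u [v [Hu [Hv [Nu [Nv Hle]]]]]].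
  destruct (Hdelta (u, v)) as [r [K [G Hn]]]; [split; assumption|].
  apply (liftable_small H S (H (u, v)) r K G). intros w Sw. destruct (HS w Sw) as [Rw [N1 N2]].
  split; [now apply HH|]. apply Hn. split; simpl.
  - replace (fst w - u) with ((fst w - fst z) + (fst z - u)) by ring.
    eapply Rle_lt_trans; [apply Rabs_triang | lra].
  - replace (snd w - v) with ((snd w - snd z) + (snd z - v)) by ring.
    eapply Rle_lt_trans; [apply Rabs_triang | lra].
Qed.

(** Bisection: first the width and then the height is allowed to grow from the Lebesgue number [d]
    up to 1, the bounds [d * 2 ^ N] and [d * 2 ^ M] doubling with each halving of the rectangle. *)
Lemma liftable_unit_square H :
  (forall z, rect 0 1 0 1 z -> continuous H z /\ D (H z)) -> liftable H (rect 0 1 0 1).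
Proof.
  intros HH. destruct (good_square_lebesgue H HH) as [d [Hd HS]].
  assert (Hsmall : forall a l b k, 0 <= a -> 0 <= b -> 0 <= l < d -> 0 <= k < d ->
            a + l <= 1 -> b + k <= 1 -> liftable H (rect a (a + l) b (b + k))).
  { intros a l b k Ha Hb Hl Hk Hal Hbk. apply (HS _ (a, b)); [unfold rect; simpl; lra|].
    intros w [W1 W2]. split; [unfold rect; lra|].
    split; apply Rabs_lt_between; simpl; lra. }
  assert (Hwide : forall N a l b k, 0 <= a -> 0 <= b -> 0 <= l < d * 2 ^ N -> 0 <= k < d ->
            a + l <= 1 -> b + k <= 1 -> liftable H (rect a (a + l) b (b + k))).
  { induction N as [|N IH]; intros a l b k Ha Hb Hl Hk Hal Hbk.
    - apply Hsmall; trivial. simpl in Hl. lra.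
    - rewrite <- tech_pow_Rmult in Hl.
      apply (liftable_split_h H a (a + l / 2)); try lra.
      + apply IH; trivial; lra.
      + replace (a + l) with ((a + l / 2) + l / 2) by lra. apply IH; trivial; lra. }
  destruct (pow_lt_1_zero (/ 2) ltac:(rewrite Rabs_pos_eq; lra) d Hd) as [N HN].
  specialize (HN N (Nat.le_refl N)). rewrite Rabs_pos_eq in HN by (apply pow_le; lra).
  assert (H2N : 1 < d * 2 ^ N).
  { rewrite pow_inv in HN. assert (0 < 2 ^ N) by (apply pow_lt; lra).
    apply (Rmult_lt_compat_r (2 ^ N)) in HN; [|assumption].
    rewrite Rinv_l in HN by lra. exact HN. }
  assert (Htall : forall M a l b k, 0 <= a -> 0 <= b -> 0 <= l <= 1 -> 0 <= k < d * 2 ^ M ->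
            a + l <= 1 -> b + k <= 1 -> liftable H (rect a (a + l) b (b + k))).
  { induction M as [|M IH]; intros a l b k Ha Hb Hl Hk Hal Hbk.
    - apply (Hwide N); trivial; [|simpl in Hk]; lra.
    - rewrite <- tech_pow_Rmult in Hk.
      apply (liftable_split_v H a (a + l) b (b + k / 2)); try lra.
      + apply IH; trivial; lra.
      + replace (b + k) with ((b + k / 2) + k / 2) by lra. apply IH; trivial; lra. }
  apply (liftable_equiv H (rect 0 (0 + 1) 0 (0 + 1))).
  - intros z. now rewrite !Rplus_0_l.
  - apply (Htall N); lra.
Qed.

(* A path is lifted over [{0} x [0, 1]], so that lifts of paths and of homotopies are
   the same notion. *)
Definition path_lift (g : R -> R * R) (a b : R) (s : R * R -> Vec) : Prop :=
  is_lift (rect 0 0 a b) (fun z => g (snd z)) s.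

(** Parallel transport of [c] along some path; it is a relation until independence of the path makes
    it a function of [q]. *)
Definition reaches (p q : R * R) (c w : Vec) : Prop :=
  exists g s, path_in D g /\ g 0 = p /\ g 1 = q /\ path_lift g 0 1 s /\
    veq (s (0, 0)) c /\ veq (s (0, 1)) w.

Definition clamp01 (t : R) : R := Rmax 0 (Rmin 1 t).

Lemma clamp01_id t : unit_I t -> clamp01 t = t.
Proof. unfold unit_I, clamp01, Rmax, Rmin. intros. repeat destruct Rle_dec; lra. Qed.

Lemma clamp01_le0 t : t <= 0 -> clamp01 t = 0.
Proof. unfold clamp01, Rmax, Rmin. intros. repeat destruct Rle_dec; lra. Qed.

Lemma clamp01_ge1 t : 1 <= t -> clamp01 t = 1.
Proof. unfold clamp01, Rmax, Rmin. intros. repeat destruct Rle_dec; lra. Qed.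

Lemma continuous_clamp01 t : continuous clamp01 t.
Proof.
  apply (continuous_ext (clamp (/ 2) (/ 2))); [|apply continuous_clamp].
  intros x. unfold clamp, clamp01. f_equal; [lra | f_equal; lra].
Qed.

(* Both halves are extended by constants, so the concatenation is the sum of the two
   minus their common point. *)
Definition path_cat (g g' : R -> R * R) (t : R) : R * R :=
  (fst (g (clamp01 (2 * t))) + fst (g' (clamp01 (2 * t - 1))) - fst (g 1),
   snd (g (clamp01 (2 * t))) + snd (g' (clamp01 (2 * t - 1))) - snd (g 1)).

Lemma path_cat_left g g' t : g 1 = g' 0 -> unit_I (2 * t) -> path_cat g g' t = g (2 * t).
Proof.
  intros E [T0 T1]. unfold path_cat. rewrite (clamp01_le0 (2 * t - 1)) by lra.
  rewrite clamp01_id by (split; lra). rewrite <- E. destruct (g (2 * t)); simpl. f_equal; ring.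
Qed.

Lemma path_cat_right g g' t :
  g 1 = g' 0 -> unit_I (2 * t - 1) -> path_cat g g' t = g' (2 * t - 1).
Proof.
  intros E [T0 T1]. unfold path_cat. rewrite (clamp01_ge1 (2 * t)) by lra.
  rewrite clamp01_id by (split; lra). destruct (g' (2 * t - 1)); simpl. f_equal; ring.
Qed.

Lemma continuous_pair (f g : R -> R) t :
  continuous f t -> continuous g t -> continuous (fun s => (f s, g s)) t.
Proof.
  intros Hf Hg. apply (continuous_comp_2 f g (fun a b => (a, b))); trivial.
  apply (continuous_ext (fun p => p)); [now intros []|]. apply continuous_id.
Qed.

Lemma path_cat_continuous (g g' : R -> R * R) :
  (forall t, continuous g t) -> (forall t, continuous g' t) ->
  forall t, continuous (path_cat g g') t.
Proof.
  intros Hg Hg' t.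
  assert (C1 : continuous (fun t => g (clamp01 (2 * t))) t).
  { apply (continuous_comp (fun t => clamp01 (2 * t)) g); [|apply Hg].
    apply (continuous_comp (fun t => 2 * t) clamp01); [|apply continuous_clamp01].
    apply continuity_pt_filterlim; reg. }
  assert (C2 : continuous (fun t => g' (clamp01 (2 * t - 1))) t).
  { apply (continuous_comp (fun t => clamp01 (2 * t - 1)) g'); [|apply Hg'].
    apply (continuous_comp (fun t => 2 * t - 1) clamp01); [|apply continuous_clamp01].
    apply continuity_pt_filterlim; reg. }
  apply continuous_pair;
    apply (continuous_minus (V := R_NormedModule)); try apply continuous_const;
    apply (continuous_plus (V := R_NormedModule)).
  - apply (continuous_comp _ fst _ C1). apply continuous_fst.
  - apply (continuous_comp _ fst _ C2). apply continuous_fst.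
  - apply (continuous_comp _ snd _ C1). apply continuous_snd.
  - apply (continuous_comp _ snd _ C2). apply continuous_snd.
Qed.

Lemma path_in_cat g g' :
  path_in D g -> path_in D g' -> g 1 = g' 0 -> path_in D (path_cat g g').
Proof.
  intros [Cg Dg] [Cg' Dg'] E. split; [now apply path_cat_continuous|].
  intros t [T0 T1]. destruct (Rle_dec (2 * t) 1).
  - rewrite path_cat_left by (trivial; split; lra). apply Dg; split; lra.
  - rewrite path_cat_right by (trivial; split; lra). apply Dg'; split; lra.
Qed.

Lemma continuous_snd_affine (a b : R) z : continuous (fun w : R * R => (0, a * snd w + b)) z.
Proof.
  apply (continuous_comp (fun w : R * R => snd w) (fun t => (0, a * t + b))).
  - apply (continuous_snd (U := R_UniformSpace) (V := R_UniformSpace)).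
  - apply continuous_pair; [apply continuous_const|].
    apply continuity_pt_filterlim. reg.
Qed.

Lemma path_lift_reparam g g' a b a' b' m k s :
  (forall t, a <= t <= b -> a' <= m * t + k <= b' /\ g t = g' (m * t + k)) ->
  (forall t, continuous g t) -> path_lift g' a' b' s ->
  path_lift g a b (fun z => s (0, m * snd z + k)).
Proof.
  intros Hg Cg Hs.
  apply (is_lift_ext _ (fun z => g' (m * snd z + k))).
  - intros z [_ Hz]. now rewrite (proj2 (Hg _ Hz)).
  - intros z _. apply (continuous_comp_snd g); apply Cg.
  - apply (is_lift_comp _ (rect 0 0 a' b') (fun z => g' (snd z)) s
             (fun z => (0, m * snd z + k))); trivial.
    + intros z [_ Hz]. split; simpl; [lra | now apply Hg].
    + intros z _. apply continuous_snd_affine.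
Qed.

(* Along a closed path that bounds a homotopy the lift over the square is constant on the
   three sides where the homotopy is constant, so it comes back to its initial value. *)
Lemma lift_closed_path g c :
  simply_connected_domain D -> path_in D g -> g 0 = g 1 ->
  exists s, path_lift g 0 1 s /\ veq (s (0, 0)) c /\ veq (s (0, 1)) c.
Proof.
  intros [_ [_ [_ SC]]] Pg E. destruct (SC g Pg E) as [H [CH [DH [H0 [H1 Hs]]]]].
  assert (LH : liftable H (rect 0 1 0 1)).
  { apply liftable_unit_square. intros [a b] [Ha Hb]. split; [apply CH | now apply DH]. }
  destruct (LH (0, 0) c) as [S [HS Sc]]; [unfold rect; simpl; lra|].
  exists S. split; [|split; [exact Sc|]].
  { apply (is_lift_ext _ H).
    - intros [a b] [[A0 A1] _]. simpl in *. replace a with 0 by lra. apply H0.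
    - intros z _. apply (continuous_comp_snd g); apply Pg.
    - apply (is_lift_subset _ (rect 0 1 0 1)); [|exact HS]. unfold rect; intros; lra. }
  (* Where [H] is constant, the constant function with value [S z] is a lift as well, so [S] equals
     it by uniqueness. *)
  assert (Hconst : forall T z w, convex T -> (forall z, T z -> rect 0 1 0 1 z /\ H z = g 0) ->
            T z -> T w -> veq (S w) (S z)).
  { intros T z w CT HT Tz Tw.
    apply (is_lift_unique T H S (fun _ => S z) z w CT); trivial; [| |now intros i _].
    - apply (is_lift_subset _ (rect 0 1 0 1)); [|exact HS]. intros; now apply HT.
    - intros x Tx. split; [apply CH|].
      rewrite (proj2 (HT x Tx)). rewrite <- (proj2 (HT z Tz)).
      destruct (HT z Tz) as [Rz Ez].
      destruct (HS z Rz) as [_ [y [Gy [d [Hd Ey]]]]].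
      exists y. split; [exact Gy|]. exists 1. split; [lra|].
      intros w' Tw' _ i Hi. rewrite (proj2 (HT w' Tw')), <- Ez.
      apply Ey; trivial. now apply near_center. }
  assert (E1 : veq (S (1, 0)) (S (0, 0))).
  { apply (Hconst (rect 0 1 0 0)); [apply rect_convex | | unfold rect; simpl; lra ..].
    intros [a b] [Ha [B0 B1]]; simpl in *. replace b with 0 by lra.
    split; [unfold rect; simpl; lra | apply Hs]. }
  assert (E2 : veq (S (1, 1)) (S (1, 0))).
  { apply (Hconst (rect 1 1 0 1)); [apply rect_convex | | unfold rect; simpl; lra ..].
    intros [a b] [[A0 A1] Hb]; simpl in *. replace a with 1 by lra.
    split; [unfold rect; simpl; lra | apply H1]. }
  assert (E3 : veq (S (0, 1)) (S (1, 1))).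
  { apply (Hconst (rect 0 1 1 1)); [apply rect_convex | | unfold rect; simpl; lra ..].
    intros [a b] [Ha [B0 B1]]; simpl in *. replace b with 1 by lra.
    split; [unfold rect; simpl; lra | apply Hs]. }
  intros i Hi. rewrite (E3 i Hi), (E2 i Hi), (E1 i Hi). now apply Sc.
Qed.

Lemma reaches_total p q c :
  simply_connected_domain D -> D p -> D q -> exists w, reaches p q c w.
Proof.
  intros [_ [_ [PC _]]] Hp Hq. destruct (PC p q Hp Hq) as [g [[Cg Dg] [g0 g1]]].
  assert (L : liftable (fun z => g (snd z)) (rect 0 1 0 1)).
  { apply liftable_unit_square. intros z [_ Hz]. split; [|now apply Dg].
    apply (continuous_comp_snd g); apply Cg. }
  destruct (L (0, 0) c) as [s [Hs Hc]]; [unfold rect; simpl; lra|].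
  exists (s (0, 1)), g, s. split; [now split|].
  split; [exact g0 | split; [exact g1 | split; [| split; [exact Hc | now intros i _]]]].
  apply (is_lift_subset _ (rect 0 1 0 1)); [|exact Hs]. unfold rect; intros; lra.
Qed.

Lemma path_lift_unique g a b s s' :
  a <= b -> path_lift g a b s -> path_lift g a b s' -> veq (s (0, a)) (s' (0, a)) ->
  veq (s (0, b)) (s' (0, b)).
Proof.
  intros Hab Hs Hs'. apply (is_lift_unique (rect 0 0 a b) (fun z => g (snd z)));
    trivial using rect_convex; unfold rect; simpl; lra.
Qed.

(** The first path followed by the reverse of the second is closed, so its lift [S] starts and ends
    at [c]. Read forwards from 0 and backwards from 1, the halves of [S] lift the two paths, and
    they meet at the parameter 1/2. *)
Lemma reaches_functional p q c w w' :
  simply_connected_domain D -> reaches p q c w -> reaches p q c w' -> veq w w'.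
Proof.
  intros SC [g [s [Pg [g0 [g1 [Ls [Es Ew]]]]]]] [g' [s' [Pg' [g0' [g1' [Ls' [Es' Ew']]]]]]].
  set (gr := fun t => g' (1 - t)).
  assert (Pr : path_in D gr).
  { split.
    - intros t. apply (continuous_comp (fun t => 1 - t) g'); [|apply Pg'].
      apply continuity_pt_filterlim. reg.
    - intros t [T0 T1]. apply Pg'. split; lra. }
  assert (E : g 1 = gr 0) by (unfold gr; rewrite Rminus_0_r; congruence).
  assert (Pl : path_in D (path_cat g gr)) by now apply path_in_cat.
  destruct (lift_closed_path (path_cat g gr) c SC Pl) as [S [LS [S0 S1]]].
  { rewrite path_cat_left by (trivial; split; lra). rewrite Rmult_0_r.
    rewrite path_cat_right by (trivial; split; lra). unfold gr.
    replace (1 - (2 * 1 - 1)) with 0 by ring. congruence. }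
  assert (L1 : path_lift g 0 1 (fun z => S (0, / 2 * snd z + 0))).
  { apply (path_lift_reparam g (path_cat g gr) 0 1 0 1); [|apply Pg|exact LS].
    intros t Ht. split; [lra|]. rewrite path_cat_left by (trivial; split; lra). f_equal; lra. }
  assert (L2 : path_lift g' 0 1 (fun z => S (0, - / 2 * snd z + 1))).
  { apply (path_lift_reparam g' (path_cat g gr) 0 1 0 1); [|apply Pg'|exact LS].
    intros t Ht. split; [lra|]. rewrite path_cat_right by (trivial; split; lra).
    unfold gr. f_equal; lra. }
  assert (V1 : veq (s (0, 1)) (S (0, / 2 * 1 + 0))).
  { apply (path_lift_unique g 0 1 s (fun z => S (0, / 2 * snd z + 0))); trivial; [lra|].
    simpl. rewrite Rmult_0_r, Rplus_0_r. intros i Hi. rewrite Es, S0; trivial. }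
  assert (V2 : veq (s' (0, 1)) (S (0, - / 2 * 1 + 1))).
  { apply (path_lift_unique g' 0 1 s' (fun z => S (0, - / 2 * snd z + 1))); trivial; [lra|].
    simpl. rewrite Rmult_0_r, Rplus_0_l. intros i Hi. rewrite Es', S1; trivial. }
  intros i Hi. rewrite <- Ew, <- Ew', V1, V2 by exact Hi.
  replace (- / 2 * 1 + 1) with (/ 2 * 1 + 0) by lra. reflexivity.
Qed.

(** The path is prolonged by a straight segment inside the good square, over which the lift is given
    by the section [y]. *)
Lemma reaches_extend p q q' c w r K y :
  reaches p q c w -> good q r K -> flat_section n P Q (near q r) y -> veq (at_point y q) w ->
  near q r q' -> reaches p q' c (at_point y q').
Proof.
  intros [g [s [Pg [g0 [g1 [Ls [Es Ew]]]]]]] G Hy Eq Hq'.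
  set (l := fun t => (fst q + t * (fst q' - fst q), snd q + t * (snd q' - snd q))).
  assert (l0 : l 0 = q) by (unfold l; rewrite !Rmult_0_l, !Rplus_0_r; now destruct q).
  assert (l1 : l 1 = q').
  { unfold l; rewrite !Rmult_1_l. destruct q' as [a b]; simpl. f_equal; ring. }
  assert (Hr : 0 < r) by apply G.
  assert (HD : forall x, near q r x -> D x) by (intros x [X1 X2]; apply G; split; lra).
  assert (Hl : forall t, unit_I t -> near q r (l t)).
  { intros t [T0 T1]. destruct Hq' as [A B]. apply Rabs_lt_between in A. apply Rabs_lt_between in B.
    split; simpl; apply Rabs_lt_between; nra. }
  assert (Pl : path_in D l).
  { split; [|intros t Ht; now apply HD, Hl].
    intros t. apply continuous_pair; apply continuity_pt_filterlim; reg. }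
  assert (E : g 1 = l 0) by congruence.
  assert (Pc : path_in D (path_cat g l)) by now apply path_in_cat.
  assert (Cc : forall z : R * R, continuous (fun z => path_cat g l (snd z)) z).
  { intros z. apply (continuous_comp_snd (path_cat g l)); apply Pc. }
  destruct (is_lift_glue (rect 0 0 0 (/ 2)) (rect 0 0 (/ 2) 1) (fun z => path_cat g l (snd z))
    (fun z => s (0, 2 * snd z + 0)) (fun z => at_point y (path_cat g l (snd z))))
    as [S [LS [S1 S2]]]; try apply rect_closed.
  - apply (path_lift_reparam (path_cat g l) g 0 (/ 2) 0 1); [|apply Pc|exact Ls].
    intros t Ht. split; [lra|]. rewrite path_cat_left by (trivial; split; lra). f_equal; ring.
  - intros z [_ Hz]. split; [apply Cc|]. exists y. split.
    + assert (N : near q r (path_cat g l (snd z))).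
      { rewrite path_cat_right by (trivial; split; lra). apply Hl. split; lra. }
      apply (flat_germ_of_open (near q r)); auto using near_open.
    + exists 1. split; [lra|]. now intros ? ? ? ? ?.
  - intros z [_ Z1] [_ Z2]. replace (snd z) with (/ 2) by lra. intros i Hi.
    rewrite path_cat_right by (trivial; split; lra).
    replace (2 * / 2 - 1) with 0 by field. replace (2 * / 2 + 0) with 1 by field.
    rewrite l0, (Ew i Hi). symmetry. now apply Eq.
  - exists (path_cat g l), S. split; [exact Pc|].
    assert (R0 : rect 0 0 0 (/ 2) (0, 0)) by (unfold rect; simpl; lra).
    assert (R1 : rect 0 0 (/ 2) 1 (0, 1)) by (unfold rect; simpl; lra).
    assert (c1 : path_cat g l 1 = q').
    { rewrite path_cat_right by (trivial; split; lra).
      replace (2 * 1 - 1) with 1 by ring. exact l1. }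
    split; [|split; [exact c1|split; [|split]]].
    + rewrite path_cat_left by (trivial; split; lra). now rewrite Rmult_0_r.
    + apply (is_lift_subset _ (fun z => rect 0 0 0 (/ 2) z \/ rect 0 0 (/ 2) 1 z)); [|exact LS].
      intros z. unfold rect. destruct (Rle_dec (snd z) (/ 2)); intros; lra.
    + intros i Hi. rewrite (S1 _ R0 i Hi). simpl. rewrite Rmult_0_r, Rplus_0_r. now apply Es.
    + intros i Hi. rewrite (S2 _ R1 i Hi). simpl. now rewrite c1.
Qed.

Theorem flat_section_exists p (c : Vec) :
  simply_connected_domain D -> D p ->
  exists y, flat_section n P Q D y /\ forall i, (i <= n)%nat -> y (fst p) (snd p) i = c i.
Proof.
  intros SC Hp.
  assert (Hw : forall q, exists w, D q -> reaches p q c w).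
  { intros q. destruct (excluded_middle_informative (D q)) as [Hq|Hq].
    - destruct (reaches_total p q c SC Hp Hq) as [w Hw]. now exists w.
    - exists c. tauto. }
  set (Yp := fun q => proj1_sig (constructive_indefinite_description _ (Hw q))).
  assert (HY : forall q, D q -> reaches p q c (Yp q)).
  { intros q. unfold Yp. destruct constructive_indefinite_description as [w H]. exact H. }
  exists (fun u v => Yp (u, v)). split.
  - intros u v i Huv Hi.
    destruct (flat_germ_local (u, v) (Yp (u, v)) Huv) as [r [K [y [G [Hy Ey]]]]].
    assert (Hr : 0 < r) by apply G.
    (* Near [(u, v)] the chosen values are those of one local flat section, which therefore supplies
       both derivatives. *)
    assert (E : forall q, near (u, v) r q -> veq (Yp q) (at_point y q)).
    { intros q Nq. apply (reaches_functional p q c); trivial.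
      - apply HY. destruct Nq. apply G. split; lra.
      - apply (reaches_extend p (u, v) q c (Yp (u, v)) r K); auto. }
    pose proof (near_center (u, v) r Hr) as N0.
    destruct (Hy u v i N0 Hi) as [Du Dv].
    assert (EP : forall M, mvmul n M (Yp (u, v)) i = mvmul n M (y u v) i).
    { intros M. apply sum_eq. intros j Hj. f_equal. now apply (E (u, v)). }
    rewrite !EP. split.
    + apply (is_derive_ext_loc (fun t => y t v i)); [|exact Du].
      exists (mkposreal r Hr). intros t Ht. symmetry. apply (E (t, v)); trivial.
      split; [exact Ht | apply N0].
    + apply (is_derive_ext_loc (fun t => y u t i)); [|exact Dv].
      exists (mkposreal r Hr). intros t Ht. symmetry. apply (E (u, t)); trivial.
      split; [apply N0 | exact Ht].
  - destruct p as [p1 p2]. simpl.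
    apply (reaches_functional (p1, p2) (p1, p2) c); trivial; [now apply HY|].
    destruct (flat_germ_local (p1, p2) c Hp) as [r [K [y [G [Hy Ey]]]]].
    assert (Cg : forall z : R * R, continuous (fun _ : R * R => (p1, p2)) z)
      by (intros; apply continuous_const).
    exists (fun _ => (p1, p2)), (fun _ => c). split.
    { split; [intros; apply continuous_const | now intros]. }
    split; [reflexivity | split; [reflexivity | split; [| now split; intros i _]]].
    intros z _. split; [apply Cg|].
    exists y. split; [now exists r, K|]. exists 1. split; [lra|].
    intros w _ _ i Hi. symmetry. now apply Ey.
Qed.
End Monodromy.

(** * Orthogonal frames *)

Definition Jsig (L0 : R) (i : nat) : R := if Nat.eqb i 4 then sgnL L0 else 1.

Lemma sgnL_sqr L0 : sgnL L0 * sgnL L0 = 1.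
Proof. unfold sgnL. destruct Rlt_dec; ring. Qed.

Lemma Jsig_sqr L0 i : Jsig L0 i * Jsig L0 i = 1.
Proof. unfold Jsig. destruct Nat.eqb; [apply sgnL_sqr | ring]. Qed.

Lemma ip_sum L0 x y : ip L0 x y = sum_f_R0 (fun i => Jsig L0 i * x i * y i) 4.
Proof. unfold ip, Jsig; simpl. ring. Qed.

Lemma ip_ext L0 x x' y y' :
  (forall i, (i <= 4)%nat -> x i = x' i) -> (forall i, (i <= 4)%nat -> y i = y' i) ->
  ip L0 x y = ip L0 x' y'.
Proof.
  intros Hx Hy. rewrite !ip_sum. apply sum_eq. intros i Hi. now rewrite Hx, Hy.
Qed.

Lemma ip_sym L0 x y : ip L0 x y = ip L0 y x.
Proof. unfold ip. ring. Qed.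

Lemma kron_diag i : kron i i = 1.
Proof. unfold kron. now rewrite Nat.eqb_refl. Qed.

Lemma kron_sym i j : kron i j = kron j i.
Proof. unfold kron. now rewrite Nat.eqb_sym. Qed.

Lemma kron_neq i j : i <> j -> kron i j = 0.
Proof. intros H. unfold kron. now rewrite (proj2 (Nat.eqb_neq i j) H). Qed.

Lemma sum_f_R0_kron (c : nat -> R) i n :
  (i <= n)%nat -> sum_f_R0 (fun k => c k * kron k i) n = c i.
Proof.
  induction n as [|n IH]; intros Hi; simpl.
  - replace i with 0%nat by lia. rewrite kron_diag. ring.
  - destruct (Nat.eq_dec i (S n)) as [->|Hn].
    + rewrite kron_diag, (sum_eq _ (fun _ => 0)).
      * rewrite sum_cte. ring.
      * intros k Hk. rewrite kron_neq by lia. ring.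
    + rewrite IH, kron_neq by lia. ring.
Qed.

Definition is_frame (L0 : R) (g : nat -> R) (E : nat -> Vec) : Prop :=
  forall a b, (a <= 4)%nat -> (b <= 4)%nat -> ip L0 (E a) (E b) = g a * kron a b.

(** For the matrix [E] with rows [E a], this is [E^T g^-1 E = J], whereas [is_frame] is
    [E J E^T = g]. *)
Definition is_coframe (L0 : R) (g : nat -> R) (E : nat -> Vec) : Prop :=
  forall i j, (i <= 4)%nat -> (j <= 4)%nat ->
    sum_f_R0 (fun a => E a i * E a j / g a) 4 = Jsig L0 i * kron i j.

Lemma frame_right_inverse L0 g E :
  (forall a, g a <> 0) -> is_frame L0 g E ->
  forall a b, (a <= 4)%nat -> (b <= 4)%nat ->
  sum_f_R0 (fun k => (E a k / g a) * (Jsig L0 k * E b k)) 4 = kron a b.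
Proof.
  intros Hg HE a b Ha Hb.
  rewrite (sum_eq _ (fun k => Jsig L0 k * E a k * E b k * / g a)).
  - rewrite <- scal_sum, <- ip_sum, HE by assumption. field. apply Hg.
  - intros k _. field. apply Hg.
Qed.

(** [E J E^T = g] says that [J E^T] is a right inverse of [g^-1 E]; as a left inverse it gives
    [J E^T g^-1 E = 1], and [J] is its own inverse. *)
Lemma frame_coframe L0 g E : (forall a, g a <> 0) -> is_frame L0 g E -> is_coframe L0 g E.
Proof.
  intros Hg HE i j Hi Hj.
  pose proof (SquareMatrices.right_inverse_left_inverse 4 _ _ (frame_right_inverse L0 g E Hg HE))
    as H.
  rewrite <- (H i j Hi Hj), scal_sum. apply sum_eq. intros a _.
  transitivity (E a i * E a j / g a * (Jsig L0 i * Jsig L0 i)).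
  - rewrite Jsig_sqr. ring.
  - unfold Rdiv; ring.
Qed.

Lemma coframe_frame L0 g E : (forall a, g a <> 0) -> is_coframe L0 g E -> is_frame L0 g E.
Proof.
  intros Hg HE a b Ha Hb.
  assert (H : forall i j, (i <= 4)%nat -> (j <= 4)%nat ->
     sum_f_R0 (fun c => (Jsig L0 i * E c i) * (E c j / g c)) 4 = kron i j).
  { intros i j Hi Hj.
    rewrite (sum_eq _ (fun c => E c i * E c j / g c * Jsig L0 i)).
    - rewrite <- scal_sum, HE, <- Rmult_assoc, Jsig_sqr by assumption. ring.
    - intros c _. unfold Rdiv; ring. }
  pose proof (SquareMatrices.right_inverse_left_inverse 4
    (fun i c => Jsig L0 i * E c i) (fun c j => E c j / g c) H a b Ha Hb) as K.
  rewrite <- K, ip_sum, scal_sum. apply sum_eq. intros i _. field. apply Hg.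
Qed.

Lemma frame_expansion L0 g E w i :
  (forall a, g a <> 0) -> is_frame L0 g E -> (i <= 4)%nat ->
  w i = sum_f_R0 (fun a => ip L0 w (E a) / g a * E a i) 4.
Proof.
  intros Hg HE Hi.
  rewrite (sum_eq _ (fun a => sum_f_R0 (fun k => E a k * E a i / g a * (Jsig L0 k * w k)) 4)).
  - rewrite sum_f_R0_swap.
    rewrite (sum_eq _ (fun k => w k * kron k i)).
    + symmetry. now apply sum_f_R0_kron.
    + intros k Hk.
      rewrite <- scal_sum.
      rewrite (frame_coframe L0 g E Hg HE k i Hk Hi).
      transitivity (w k * kron k i * (Jsig L0 k * Jsig L0 k)); [ring|].
      rewrite Jsig_sqr; ring.
  - intros a _. rewrite ip_sum. unfold Rdiv.
    rewrite Rmult_assoc, Rmult_comm, scal_sum. apply sum_eq. intros k _. ring.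
Qed.

Lemma frame_detn_neq0 L0 g E :
  (forall a, g a <> 0) -> is_frame L0 g E -> detn 5 E <> 0.
Proof.
  intros Hg HE.
  apply (SquareMatrices.detn_neq0 4 E (fun k b => Jsig L0 k * E b k * / g b)).
  intros a b Ha Hb.
  rewrite (sum_eq _ (fun k => Jsig L0 k * E a k * E b k * / g b)) by (intros; ring).
  rewrite <- scal_sum, <- ip_sum, HE by assumption.
  destruct (Nat.eq_dec a b) as [->|Hn].
  - rewrite kron_diag. field. apply Hg.
  - rewrite kron_neq by exact Hn. ring.
Qed.

(** * The frame of an immersion *)

(** Indices 0 to 4 stand for [F], [T1], [T2], [N1], [N2]. On the indices 1 to 4 the matrix is [lu]
    times the identity plus a skew part, since these four vectors share the squared length [e]; the
    entry [- (L0 * e)] is the component of the second derivative of [F] along [F]. *)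
Definition Pmat (L0 e lu lv a1 b1 a2 b2 m1 : R) (a b : nat) : R :=
  match a, b with
  | 0%nat, 1%nat => 1
  | 1%nat, 0%nat => - (L0 * e) | 1%nat, 1%nat => lu | 1%nat, 2%nat => - lv
  | 1%nat, 3%nat => a1 | 1%nat, 4%nat => b1
  | 2%nat, 1%nat => lv | 2%nat, 2%nat => lu | 2%nat, 3%nat => a2 | 2%nat, 4%nat => b2
  | 3%nat, 1%nat => - a1 | 3%nat, 2%nat => - a2 | 3%nat, 3%nat => lu | 3%nat, 4%nat => m1
  | 4%nat, 1%nat => - b1 | 4%nat, 2%nat => - b2 | 4%nat, 3%nat => - m1 | 4%nat, 4%nat => lu
  | _, _ => 0
  end.

Definition Qmat (L0 e lu lv a2 b2 a3 b3 m2 : R) (a b : nat) : R :=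
  match a, b with
  | 0%nat, 2%nat => 1
  | 1%nat, 1%nat => lv | 1%nat, 2%nat => lu | 1%nat, 3%nat => a2 | 1%nat, 4%nat => b2
  | 2%nat, 0%nat => - (L0 * e) | 2%nat, 1%nat => - lu | 2%nat, 2%nat => lv
  | 2%nat, 3%nat => a3 | 2%nat, 4%nat => b3
  | 3%nat, 1%nat => - a2 | 3%nat, 2%nat => - a3 | 3%nat, 3%nat => lv | 3%nat, 4%nat => m2
  | 4%nat, 1%nat => - b2 | 4%nat, 2%nat => - b3 | 4%nat, 3%nat => - m2 | 4%nat, 4%nat => lv
  | _, _ => 0
  end.

Definition sqlen (L0 e : R) (a : nat) : R := match a with O => / L0 | _ => e end.

Lemma sqlen_neq0 L0 e a : L0 <> 0 -> e <> 0 -> sqlen L0 e a <> 0.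
Proof. intros H1 H2. destruct a; [now apply Rinv_neq_0_compat | exact H2]. Qed.

Lemma is_derive_ip L0 (x y : R -> Vec) t (dx dy : Vec) :
  (forall i, (i <= 4)%nat -> is_derive (fun s => x s i) t (dx i)) ->
  (forall i, (i <= 4)%nat -> is_derive (fun s => y s i) t (dy i)) ->
  is_derive (fun s => ip L0 (x s) (y s)) t (ip L0 dx (y t) + ip L0 (x t) dy).
Proof.
  intros Hx Hy.
  apply (is_derive_ext (fun s => sum_f_R0 (fun i => Jsig L0 i * (x s i * y s i)) 4)).
  { intros s. rewrite ip_sum. apply sum_eq. intros; ring. }
  replace (ip L0 dx (y t) + ip L0 (x t) dy)
    with (sum_f_R0 (fun i => Jsig L0 i * (dx i * y t i + x t i * dy i)) 4).
  - apply (is_derive_sum_f_R0 4 (fun i s => Jsig L0 i * (x s i * y s i))). intros i Hi.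
    apply (is_derive_scal (fun s => x s i * y s i) t (Jsig L0 i)).
    apply (is_derive_Rmult (fun s => x s i) (fun s => y s i)); auto.
  - rewrite !ip_sum, <- plus_sum. apply sum_eq. intros; ring.
Qed.

Lemma ip_tanproj L0 x w z : ip L0 x z = 0 -> ip L0 (tanproj L0 x w) z = ip L0 w z.
Proof.
  intros H. transitivity (ip L0 w z - L0 * ip L0 w x * ip L0 x z).
  - unfold tanproj. set (c := L0 * ip L0 w x). unfold ip. ring.
  - rewrite H. ring.
Qed.

Lemma smooth_on_sum_f_R0 D n (f : nat -> R -> R -> R) :
  open D -> (forall i, (i <= n)%nat -> smooth_on D (f i)) ->
  smooth_on D (fun u v => sum_f_R0 (fun i => f i u v) n).
Proof.
  intros HD H. apply smooth_on_Ck; [exact HD|]. intros k. apply Ck_sum_f_R0.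
  intros i Hi. apply smooth_on_Ck; auto.
Qed.

Lemma smooth_on_ip L0 D A B : open D -> vsmooth_on D A -> vsmooth_on D B ->
  smooth_on D (fun u v => ip L0 (A u v) (B u v)).
Proof.
  intros HD HA HB.
  apply (smooth_on_ext D HD (fun u v => sum_f_R0 (fun i => Jsig L0 i * A u v i * B u v i) 4)).
  { intros. symmetry. apply ip_sum. }
  apply smooth_on_sum_f_R0; [exact HD|]. intros i Hi.
  apply smooth_on_mult; [exact HD | | apply HB; lia].
  apply smooth_on_mult; [exact HD | now apply smooth_on_const | apply HA; lia].
Qed.

Lemma vsmooth_on_dU D A : vsmooth_on D A -> vsmooth_on D (dU A).
Proof. intros HA i Hi. exact (smooth_on_du D _ (HA i Hi)). Qed.

Lemma vsmooth_on_dV D A : vsmooth_on D A -> vsmooth_on D (dV A).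
Proof. intros HA i Hi. exact (smooth_on_dv D _ (HA i Hi)). Qed.

Lemma du_ip L0 D A B u v : vsmooth_on D A -> vsmooth_on D B -> D (u, v) ->
  is_derive (fun t => ip L0 (A t v) (B t v)) u
    (ip L0 (dU A u v) (B u v) + ip L0 (A u v) (dU B u v)).
Proof.
  intros HA HB Huv. apply (is_derive_ip L0 (fun t => A t v) (fun t => B t v)); intros i Hi.
  - destruct (smooth_on_partials D _ (HA i ltac:(lia)) u v Huv) as [H _]. exact H.
  - destruct (smooth_on_partials D _ (HB i ltac:(lia)) u v Huv) as [H _]. exact H.
Qed.

Lemma dv_ip L0 D A B u v : vsmooth_on D A -> vsmooth_on D B -> D (u, v) ->
  is_derive (fun t => ip L0 (A u t) (B u t)) v
    (ip L0 (dV A u v) (B u v) + ip L0 (A u v) (dV B u v)).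
Proof.
  intros HA HB Huv. apply (is_derive_ip L0 (fun t => A u t) (fun t => B u t)); intros i Hi.
  - destruct (smooth_on_partials D _ (HA i ltac:(lia)) u v Huv) as [_ H]. exact H.
  - destruct (smooth_on_partials D _ (HB i ltac:(lia)) u v Huv) as [_ H]. exact H.
Qed.

Lemma coef_cramer (W X Y Z : bool -> R -> R -> R) s u v phi psi :
  Dlt W X Y Z s u v <> 0 ->
  (brk1 X Y s u v = sg s * W (negb s) u v * phi - Z (negb s) u v * psi /\
   brk2 W Z s u v = - sg s * Y s u v * phi - X s u v * psi) <->
  (Acoef W X Y Z s u v = phi /\ Bneg W X Y Z s u v = psi).
Proof.
  unfold Acoef, Bneg. set (b1 := brk1 X Y s u v). set (b2 := brk2 W Z s u v).
  unfold Dlt. intros HD.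
  assert (S : sg s * sg s = 1) by (destruct s; simpl; ring).
  set (w := W (negb s) u v) in *. set (x := X s u v) in *.
  set (y := Y s u v) in *. set (z := Z (negb s) u v) in *.
  split; intros [E1 E2].
  - rewrite E1, E2. split.
    + transitivity (sg s * sg s * phi); [field; exact HD | rewrite S; ring].
    + field. exact HD.
  - rewrite <- E1, <- E2. split.
    + transitivity (sg s * sg s * (w * x * b1 - w * z * b2) / (w * x + y * z)
        + (z * y * b1 + z * w * b2) / (w * x + y * z)); [rewrite S|]; field; exact HD.
    + transitivity (sg s * sg s * (y * (z * b2 - x * b1)) / (w * x + y * z)
        + x * (y * b1 + w * b2) / (w * x + y * z)); [rewrite S|]; field; exact HD.
Qed.

Section LocalData.
Variables (L0 : R) (D : R * R -> Prop) (F : R -> R -> Vec) (lam : R -> R -> R).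
Variables (N1 N2 : R -> R -> Vec) (o : R).
Hypothesis L0_neq0 : L0 <> 0.
Hypothesis openD : open D.
Hypothesis data : local_data L0 F lam N1 N2 D o.

Definition frame (a : nat) : R -> R -> Vec :=
  match a with
  | 0%nat => F | 1%nat => T1 F | 2%nat => T2 F | 3%nat => N1 | _ => N2
  end.

Let e := e2l lam.

Lemma e2l_neq0 u v : e u v <> 0.
Proof. apply Rgt_not_eq, exp_pos. Qed.

Lemma frame_orthogonal u v :
  D (u, v) -> is_frame L0 (sqlen L0 (e u v)) (fun a => frame a u v).
Proof.
  intros Huv. destruct data as [_ [_ [_ [_ [_ H]]]]]. specialize (H u v Huv).
  destruct H as [H1 [H2 [H3 [H4 [H5 [H6 [H7 [H8 [H9 [H10 [H11 [H12 [H13 _]]]]]]]]]]]]].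
  pose proof (du_ip L0 D F F u v ltac:(apply data) ltac:(apply data) Huv) as K1.
  pose proof (dv_ip L0 D F F u v ltac:(apply data) ltac:(apply data) Huv) as K2.
  (* Orthogonality of [F] to its derivatives comes from differentiating the constant
     [<F, F> = 1 / L0]. *)
  assert (Z1 : ip L0 (F u v) (T1 F u v) = 0).
  { assert (E : is_derive (fun t => ip L0 (F t v) (F t v)) u 0).
    { apply (is_derive_ext_loc (fun _ => / L0)); [|apply is_derive_Rconst].
      generalize (open_slice_u D u v openD Huv). apply filter_imp. intros t Ht.
      symmetry. now apply data. }
    apply is_derive_unique in E. apply is_derive_unique in K1.
    rewrite E in K1. rewrite (ip_sym L0 (dU F u v)) in K1. unfold T1. lra. }
  assert (Z2 : ip L0 (F u v) (T2 F u v) = 0).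
  { assert (E : is_derive (fun t => ip L0 (F u t) (F u t)) v 0).
    { apply (is_derive_ext_loc (fun _ => / L0)); [|apply is_derive_Rconst].
      generalize (open_slice_v D u v openD Huv). apply filter_imp. intros t Ht.
      symmetry. now apply data. }
    apply is_derive_unique in E. apply is_derive_unique in K2.
    rewrite E in K2. rewrite (ip_sym L0 (dV F u v)) in K2. unfold T2. lra. }
  intros a b Ha Hb. unfold e.
  destruct a as [|[|[|[|[|a]]]]]; try lia; destruct b as [|[|[|[|[|b]]]]]; try lia;
    unfold kron; simpl; rewrite ?Rmult_1_r, ?Rmult_0_r; trivial;
    rewrite ip_sym; trivial.
Qed.

Lemma frame_smooth a : vsmooth_on D (frame a).
Proof.
  destruct data as [HF [_ [H1 [H2 _]]]].
  destruct a as [|[|[|[|a]]]]; simpl; trivial; [now apply vsmooth_on_dU | now apply vsmooth_on_dV].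
Qed.

Lemma e2l_derive u v :
  D (u, v) -> is_derive (fun t => e t v) u (2 * du lam u v * e u v) /\
              is_derive (fun t => e u t) v (2 * dv lam u v * e u v).
Proof.
  intros Huv. destruct data as [_ [Hl _]].
  destruct (smooth_on_partials D lam Hl u v Huv) as [H1 H2].
  split; unfold e, e2l.
  - replace (2 * du lam u v * exp (2 * lam u v)) with ((2 * du lam u v) * exp (2 * lam u v)) by ring.
    apply (is_derive_Rcomp exp (fun t => 2 * lam t v)).
    + apply is_derive_exp.
    + now apply (is_derive_scal (fun t => lam t v) u 2).
  - replace (2 * dv lam u v * exp (2 * lam u v)) with ((2 * dv lam u v) * exp (2 * lam u v)) by ring.
    apply (is_derive_Rcomp exp (fun t => 2 * lam u t)).
    + apply is_derive_exp.
    + now apply (is_derive_scal (fun t => lam u t) v 2).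
Qed.

(** The derivative of the orthogonality relations, which becomes [P g + g P^T = g_u], and likewise
    for [Q]. *)
Lemma frame_derive_skew u v a b :
  D (u, v) -> (a <= 4)%nat -> (b <= 4)%nat ->
  ip L0 (dU (frame a) u v) (frame b u v) + ip L0 (dU (frame b) u v) (frame a u v)
    = kron a b * match a with O => 0 | _ => 2 * du lam u v * e u v end /\
  ip L0 (dV (frame a) u v) (frame b u v) + ip L0 (dV (frame b) u v) (frame a u v)
    = kron a b * match a with O => 0 | _ => 2 * dv lam u v * e u v end.
Proof.
  intros Huv Ha Hb. rewrite (ip_sym L0 (dU (frame b) u v)), (ip_sym L0 (dV (frame b) u v)).
  split.
  - transitivity (Derive (fun t => ip L0 (frame a t v) (frame b t v)) u).
    + symmetry. apply is_derive_unique. apply (du_ip L0 D); trivial; apply frame_smooth.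
    + apply is_derive_unique.
      apply (is_derive_ext_loc (fun t => kron a b * sqlen L0 (e t v) a)).
      * generalize (open_slice_u D u v openD Huv). apply filter_imp. intros t Ht.
        rewrite (frame_orthogonal t v Ht a b Ha Hb). apply Rmult_comm.
      * apply (is_derive_scal (fun t => sqlen L0 (e t v) a)).
        destruct a; simpl; [apply is_derive_Rconst | now apply e2l_derive].
  - transitivity (Derive (fun t => ip L0 (frame a u t) (frame b u t)) v).
    + symmetry. apply is_derive_unique. apply (dv_ip L0 D); trivial; apply frame_smooth.
    + apply is_derive_unique.
      apply (is_derive_ext_loc (fun t => kron a b * sqlen L0 (e u t) a)).
      * generalize (open_slice_v D u v openD Huv). apply filter_imp. intros t Ht.
        rewrite (frame_orthogonal u t Ht a b Ha Hb). apply Rmult_comm.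
      * apply (is_derive_scal (fun t => sqlen L0 (e u t) a)).
        destruct a; simpl; [apply is_derive_Rconst | now apply e2l_derive].
Qed.

Definition framePF : mfield := fun u v =>
  Pmat L0 (e2l lam u v) (du lam u v) (dv lam u v) (al1 L0 F lam N1 u v) (be1 L0 F lam N2 u v)
    (al2 L0 F lam N1 u v) (be2 L0 F lam N2 u v) (mu1 L0 F lam N1 N2 u v).
Definition frameQF : mfield := fun u v =>
  Qmat L0 (e2l lam u v) (du lam u v) (dv lam u v) (al2 L0 F lam N1 u v) (be2 L0 F lam N2 u v)
    (al3 L0 F lam N1 u v) (be3 L0 F lam N2 u v) (mu2 L0 F lam N1 N2 u v).

(** As in the Koszul formula, the tangential products are determined by the differentiated
    orthogonality relations and [F_uv = F_vu]; the products with the normals are the definitions of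
    the [al], [be] and [mu]. All entries then follow linearly. *)
Lemma frame_derive_coef u v a b :
  D (u, v) -> (a <= 4)%nat -> (b <= 4)%nat ->
  ip L0 (dU (frame a) u v) (frame b u v) = framePF u v a b * sqlen L0 (e u v) b /\
  ip L0 (dV (frame a) u v) (frame b u v) = frameQF u v a b * sqlen L0 (e u v) b.
Proof.
  intros Huv Ha Hb.
  pose proof (frame_orthogonal u v Huv) as G.
  pose proof (fun a b Ha Hb => proj1 (frame_derive_skew u v a b Huv Ha Hb)) as SU.
  pose proof (fun a b Ha Hb => proj2 (frame_derive_skew u v a b Huv Ha Hb)) as SV.
  assert (U0 : forall b, (b <= 4)%nat -> ip L0 (dU (frame 0) u v) (frame b u v)
                 = sqlen L0 (e u v) 1 * kron 1 b) by (intros c Hc; apply (G 1%nat c); lia).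
  assert (V0 : forall b, (b <= 4)%nat -> ip L0 (dV (frame 0) u v) (frame b u v)
                 = sqlen L0 (e u v) 2 * kron 2 b) by (intros c Hc; apply (G 2%nat c); lia).
  assert (UV : forall b, ip L0 (dU (frame 2) u v) (frame b u v)
                 = ip L0 (dV (frame 1) u v) (frame b u v)).
  { intros c. apply ip_ext; trivial. intros i Hi. symmetry.
    change (dv (du (fun u v => F u v i)) u v = du (dv (fun u v => F u v i)) u v).
    apply smooth_on_du_dv_comm with (D := D); trivial.
    destruct data as [HF _]. apply HF. lia. }
  assert (E0 := e2l_neq0 u v).
  assert (T3 : ip L0 (F u v) (N1 u v) = 0)
    by (etransitivity; [apply (G 0%nat 3%nat); lia | apply Rmult_0_r]).
  assert (T4 : ip L0 (F u v) (N2 u v) = 0)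
    by (etransitivity; [apply (G 0%nat 4%nat); lia | apply Rmult_0_r]).
  (* The normals are orthogonal to [F], so the tangential projection in [nab_u] and [nab_v] does not
     change products with them. *)
  assert (C : forall w z, ip L0 (F u v) z = 0 ->
     ip L0 w z = ip L0 (tanproj L0 (F u v) w) z / e u v * e u v).
  { intros w z Hz. rewrite ip_tanproj by exact Hz. field. exact E0. }
  assert (C1 : ip L0 (dU (frame 1) u v) (frame 3 u v) = al1 L0 F lam N1 u v * e u v) by now apply C.
  assert (C2 : ip L0 (dU (frame 1) u v) (frame 4 u v) = be1 L0 F lam N2 u v * e u v) by now apply C.
  assert (C3 : ip L0 (dU (frame 2) u v) (frame 3 u v) = al2 L0 F lam N1 u v * e u v) by now apply C.
  assert (C4 : ip L0 (dU (frame 2) u v) (frame 4 u v) = be2 L0 F lam N2 u v * e u v) by now apply C.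
  assert (C5 : ip L0 (dV (frame 2) u v) (frame 3 u v) = al3 L0 F lam N1 u v * e u v) by now apply C.
  assert (C6 : ip L0 (dV (frame 2) u v) (frame 4 u v) = be3 L0 F lam N2 u v * e u v) by now apply C.
  assert (C7 : ip L0 (dU (frame 3) u v) (frame 4 u v) = mu1 L0 F lam N1 N2 u v * e u v) by now apply C.
  assert (C8 : ip L0 (dV (frame 3) u v) (frame 4 u v) = mu2 L0 F lam N1 N2 u v * e u v) by now apply C.
  pose proof (UV 1%nat) as X1. pose proof (UV 2%nat) as X2.
  pose proof (UV 3%nat) as X3. pose proof (UV 4%nat) as X4.
  clear UV C. unfold e in *.
  assert (S := fun a b Ha Hb => conj (SU a b Ha Hb) (SV a b Ha Hb)). clear SU SV G.
  pose proof (U0 0%nat ltac:(lia)) as u00. pose proof (U0 1%nat ltac:(lia)) as u01.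
  pose proof (U0 2%nat ltac:(lia)) as u02. pose proof (U0 3%nat ltac:(lia)) as u03.
  pose proof (U0 4%nat ltac:(lia)) as u04.
  pose proof (V0 0%nat ltac:(lia)) as v00. pose proof (V0 1%nat ltac:(lia)) as v01.
  pose proof (V0 2%nat ltac:(lia)) as v02. pose proof (V0 3%nat ltac:(lia)) as v03.
  pose proof (V0 4%nat ltac:(lia)) as v04. clear U0 V0.
  destruct (S 0%nat 1%nat ltac:(lia) ltac:(lia)) as [su01 sv01].
  destruct (S 0%nat 2%nat ltac:(lia) ltac:(lia)) as [su02 sv02].
  destruct (S 0%nat 3%nat ltac:(lia) ltac:(lia)) as [su03 sv03].
  destruct (S 0%nat 4%nat ltac:(lia) ltac:(lia)) as [su04 sv04].
  destruct (S 1%nat 1%nat ltac:(lia) ltac:(lia)) as [su11 sv11].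
  destruct (S 1%nat 2%nat ltac:(lia) ltac:(lia)) as [su12 sv12].
  destruct (S 1%nat 3%nat ltac:(lia) ltac:(lia)) as [su13 sv13].
  destruct (S 1%nat 4%nat ltac:(lia) ltac:(lia)) as [su14 sv14].
  destruct (S 2%nat 2%nat ltac:(lia) ltac:(lia)) as [su22 sv22].
  destruct (S 2%nat 3%nat ltac:(lia) ltac:(lia)) as [su23 sv23].
  destruct (S 2%nat 4%nat ltac:(lia) ltac:(lia)) as [su24 sv24].
  destruct (S 3%nat 3%nat ltac:(lia) ltac:(lia)) as [su33 sv33].
  destruct (S 3%nat 4%nat ltac:(lia) ltac:(lia)) as [su34 sv34].
  destruct (S 4%nat 4%nat ltac:(lia) ltac:(lia)) as [su44 sv44].
  clear S. unfold framePF, frameQF.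
  assert (L1 : - (L0 * e2l lam u v) * / L0 = - e2l lam u v) by (field; exact L0_neq0).
  unfold kron in *. 
  destruct a as [|[|[|[|[|a]]]]]; try lia; destruct b as [|[|[|[|[|b]]]]]; try lia;
    cbn [Pmat Qmat sqlen Nat.eqb] in *; rewrite ?L1; split; lra.
Qed.

Lemma frame_structure u v a i :
  D (u, v) -> (a <= 4)%nat -> (i <= 4)%nat ->
  dU (frame a) u v i = mvmul 4 (framePF u v) (fun b => frame b u v i) a /\
  dV (frame a) u v i = mvmul 4 (frameQF u v) (fun b => frame b u v i) a.
Proof.
  intros Huv Ha Hi.
  assert (G0 : forall a, sqlen L0 (e u v) a <> 0).
  { intros; apply sqlen_neq0; [exact L0_neq0 | apply e2l_neq0]. }
  pose proof (frame_orthogonal u v Huv) as G. unfold mvmul.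
  split.
  - rewrite (frame_expansion L0 _ _ (dU (frame a) u v) i G0 G Hi). apply sum_eq. intros b Hb.
    rewrite (proj1 (frame_derive_coef u v a b Huv Ha Hb)). field. apply G0.
  - rewrite (frame_expansion L0 _ _ (dV (frame a) u v) i G0 G Hi). apply sum_eq. intros b Hb.
    rewrite (proj2 (frame_derive_coef u v a b Huv Ha Hb)). field. apply G0.
Qed.

Lemma e2l_smooth : smooth_on D e.
Proof.
  destruct data as [_ [Hl _]].
  apply (smooth_on_exp D openD (fun u v => 2 * lam u v)).
  apply (smooth_on_mult D openD (fun _ _ => 2) lam); [now apply smooth_on_const | exact Hl].
Qed.

(** By [frame_derive_coef] all entries alike are quotients of inner products of smooth fields. *)
Lemma framePF_smooth : msmooth_on 4 D framePF.
Proof.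
  intros a b Ha Hb.
  apply (smooth_on_ext D openD
    (fun u v => ip L0 (dU (frame a) u v) (frame b u v) / sqlen L0 (e u v) b)).
  - intros u v Huv. rewrite (proj1 (frame_derive_coef u v a b Huv Ha Hb)). field.
    apply sqlen_neq0; [exact L0_neq0 | apply e2l_neq0].
  - apply smooth_on_div; trivial.
    + intros. apply sqlen_neq0; [exact L0_neq0 | apply e2l_neq0].
    + apply smooth_on_ip; trivial; [apply vsmooth_on_dU |]; apply frame_smooth.
    + destruct b as [|b]; simpl; [now apply smooth_on_const|].
      exact e2l_smooth.
Qed.

Lemma frameQF_smooth : msmooth_on 4 D frameQF.
Proof.
  intros a b Ha Hb.
  apply (smooth_on_ext D openD
    (fun u v => ip L0 (dV (frame a) u v) (frame b u v) / sqlen L0 (e u v) b)).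
  - intros u v Huv. rewrite (proj2 (frame_derive_coef u v a b Huv Ha Hb)). field.
    apply sqlen_neq0; [exact L0_neq0 | apply e2l_neq0].
  - apply smooth_on_div; trivial.
    + intros. apply sqlen_neq0; [exact L0_neq0 | apply e2l_neq0].
    + apply smooth_on_ip; trivial; [apply vsmooth_on_dV |]; apply frame_smooth.
    + destruct b as [|b]; simpl; [now apply smooth_on_const|].
      exact e2l_smooth.
Qed.

Lemma frame_independent u v (c : nat -> R) b :
  D (u, v) -> (b <= 4)%nat ->
  (forall i, (i <= 4)%nat -> sum_f_R0 (fun a => c a * frame a u v i) 4 = 0) -> c b = 0.
Proof.
  intros Huv Hb Hc.
  assert (H : ip L0 (fun i => sum_f_R0 (fun a => c a * frame a u v i) 4) (frame b u v)
              = c b * sqlen L0 (e u v) b).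
  { rewrite ip_sum.
    rewrite (sum_eq _ (fun i => sum_f_R0 (fun a =>
               c a * (Jsig L0 i * frame a u v i * frame b u v i)) 4)).
    - rewrite sum_f_R0_swap.
      rewrite (sum_eq _ (fun a => (c a * sqlen L0 (e u v) a) * kron a b)).
      + apply (sum_f_R0_kron (fun a => c a * sqlen L0 (e u v) a)); exact Hb.
      + intros a Ha.
        rewrite (sum_eq _ (fun i => (Jsig L0 i * frame a u v i * frame b u v i) * c a))
          by (intros; ring).
        rewrite <- scal_sum, <- ip_sum, (frame_orthogonal u v Huv a b Ha Hb). ring.
    - intros i _. rewrite Rmult_assoc, (Rmult_comm (sum_f_R0 _ _)), <- Rmult_assoc, scal_sum.
      apply sum_eq. intros; ring. }
  rewrite (ip_ext L0 _ (fun _ => 0) _ (frame b u v) Hc) in H by trivial.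
  assert (Z : ip L0 (fun _ => 0) (frame b u v) = 0) by (unfold ip; ring).
  rewrite Z in H. symmetry in H. apply Rmult_integral in H. destruct H as [H|H]; [exact H|].
  exfalso. revert H. apply sqlen_neq0; [exact L0_neq0 | apply e2l_neq0].
Qed.

(** Commuting the second derivatives of the frame shows that [P_v + P Q - Q_u - Q P] annihilates it,
    and the frame vectors are independent. The entries contain the Gauss, Codazzi and Ricci
    equations together. *)
Lemma frame_integrable : integrable 4 D framePF frameQF.
Proof.
  intros u v a b Huv Ha Hb. apply Rminus_diag_uniq.
  set (Pv := fun a b => dv (fun x y => framePF x y a b) u v).
  set (Qu := fun a b => du (fun x y => frameQF x y a b) u v).
  apply (frame_independent u v (fun c => Pv a c + mmul 4 (framePF u v) (frameQF u v) a c
            - (Qu a c + mmul 4 (frameQF u v) (framePF u v) a c)) b Huv Hb).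
  intros i Hi.
  set (E := fun c => frame c u v i).
  assert (DPQ : dv (du (fun x y => frame a x y i)) u v
                = mvmul 4 Pv E a + mvmul 4 (framePF u v) (mvmul 4 (frameQF u v) E) a).
  { apply is_derive_unique.
    apply (is_derive_ext_loc (fun t => mvmul 4 (framePF u t) (fun c => frame c u t i) a)).
    - generalize (open_slice_v D u v openD Huv). apply filter_imp. intros t Ht.
      symmetry. now apply frame_structure.
    - unfold mvmul at 1 2 3. rewrite <- plus_sum.
      apply (is_derive_sum_f_R0 4 (fun c t => framePF u t a c * frame c u t i)).
      intros c Hc. apply (is_derive_Rmult (fun t => framePF u t a c) (fun t => frame c u t i)).
      + destruct (smooth_on_partials D _ (framePF_smooth a c Ha Hc) u v Huv) as [_ H]. exact H.
      + destruct (smooth_on_partials D _ (frame_smooth c i ltac:(lia)) u v Huv) as [_ H].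
        change (mvmul 4 (frameQF u v) E c)
          with (mvmul 4 (frameQF u v) (fun b => frame b u v i) c).
        rewrite <- (proj2 (frame_structure u v c i Huv Hc Hi)). exact H. }
  assert (DQP : du (dv (fun x y => frame a x y i)) u v
                = mvmul 4 Qu E a + mvmul 4 (frameQF u v) (mvmul 4 (framePF u v) E) a).
  { apply is_derive_unique.
    apply (is_derive_ext_loc (fun t => mvmul 4 (frameQF t v) (fun c => frame c t v i) a)).
    - generalize (open_slice_u D u v openD Huv). apply filter_imp. intros t Ht.
      symmetry. now apply frame_structure.
    - unfold mvmul at 1 2 3. rewrite <- plus_sum.
      apply (is_derive_sum_f_R0 4 (fun c t => frameQF t v a c * frame c t v i)).
      intros c Hc. apply (is_derive_Rmult (fun t => frameQF t v a c) (fun t => frame c t v i)).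
      + destruct (smooth_on_partials D _ (frameQF_smooth a c Ha Hc) u v Huv) as [H _]. exact H.
      + destruct (smooth_on_partials D _ (frame_smooth c i ltac:(lia)) u v Huv) as [H _].
        change (mvmul 4 (framePF u v) E c)
          with (mvmul 4 (framePF u v) (fun b => frame b u v i) c).
        rewrite <- (proj1 (frame_structure u v c i Huv Hc Hi)). exact H. }
  rewrite (smooth_on_du_dv_comm D openD _ u v (frame_smooth a i ltac:(lia)) Huv), DQP in DPQ.
  rewrite !mvmul_mmul in DPQ.
  unfold mvmul in DPQ. rewrite <- !plus_sum in DPQ. symmetry in DPQ.
  apply Rminus_diag_eq in DPQ. rewrite <- minus_sum in DPQ. rewrite <- DPQ.
  apply sum_eq. intros c _. unfold E. ring.
Qed.

(** * Codazzi equations and nondegeneracy of the twistor lifts *)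

Let W := Wf L0 F lam N1 N2.
Let X := Xf L0 F lam N1 N2.
Let Y := Yf L0 F lam N1 N2.
Let Z := Zf L0 F lam N1 N2.

(** The Codazzi equations are the entries with row 1 or 2 and column 3 or 4; each bracket is a sum
    or difference of two of them. *)
Lemma frame_brackets s u v :
  D (u, v) ->
  brk1 X Y s u v = sg s * W (negb s) u v * phif L0 F lam N1 N2 s u v
                   - Z (negb s) u v * psif L0 F lam N1 N2 (negb s) u v /\
  brk2 W Z s u v = - sg s * Y s u v * phif L0 F lam N1 N2 s u v
                   - X s u v * psif L0 F lam N1 N2 (negb s) u v.
Proof.
  intros Huv.
  pose proof (frame_integrable u v 1%nat 3%nat Huv ltac:(lia) ltac:(lia)) as C13.
  pose proof (frame_integrable u v 1%nat 4%nat Huv ltac:(lia) ltac:(lia)) as C14.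
  pose proof (frame_integrable u v 2%nat 3%nat Huv ltac:(lia) ltac:(lia)) as C23.
  pose proof (frame_integrable u v 2%nat 4%nat Huv ltac:(lia) ltac:(lia)) as C24.
  pose proof (fun a b Ha Hb => smooth_on_partials D _ (framePF_smooth a b Ha Hb) u v Huv) as DP.
  pose proof (fun a b Ha Hb => smooth_on_partials D _ (frameQF_smooth a b Ha Hb) u v Huv) as DQ.
  destruct (DP 1%nat 3%nat ltac:(lia) ltac:(lia)) as [_ Da1].
  destruct (DP 1%nat 4%nat ltac:(lia) ltac:(lia)) as [_ Db1].
  destruct (DP 2%nat 3%nat ltac:(lia) ltac:(lia)) as [Da2 Da2'].
  destruct (DP 2%nat 4%nat ltac:(lia) ltac:(lia)) as [Db2 Db2'].
  destruct (DQ 2%nat 3%nat ltac:(lia) ltac:(lia)) as [Da3 _].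
  destruct (DQ 2%nat 4%nat ltac:(lia) ltac:(lia)) as [Db3 _].
  assert (EY : dv (Y s) u v = dv (be2 L0 F lam N2) u v + sg s * dv (al1 L0 F lam N1) u v).
  { apply is_derive_unique. apply is_derive_Rplus; [exact Db2'|].
    apply (is_derive_scal (fun t => al1 L0 F lam N1 u t)). exact Da1. }
  assert (EX : du (X s) u v = du (al2 L0 F lam N1) u v + sg s * du (be3 L0 F lam N2) u v).
  { apply is_derive_unique. apply is_derive_Rplus; [exact Da2|].
    apply (is_derive_scal (fun t => be3 L0 F lam N2 t v)). exact Db3. }
  assert (EW : dv (W (negb s)) u v
               = dv (al2 L0 F lam N1) u v + sg (negb s) * dv (be1 L0 F lam N2) u v).
  { apply is_derive_unique. apply is_derive_Rplus; [exact Da2'|].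
    apply (is_derive_scal (fun t => be1 L0 F lam N2 u t)). exact Db1. }
  assert (EZ : du (Z (negb s)) u v
               = du (be2 L0 F lam N2) u v + sg (negb s) * du (al3 L0 F lam N1) u v).
  { apply is_derive_unique. apply is_derive_Rplus; [exact Db2|].
    apply (is_derive_scal (fun t => al3 L0 F lam N1 t v)). exact Da3. }
  unfold mmul in C13, C14, C23, C24. simpl in C13, C14, C23, C24.
  change (dv (fun a b => al1 L0 F lam N1 a b) u v) with (dv (al1 L0 F lam N1) u v) in C13.
  change (du (fun a b => al2 L0 F lam N1 a b) u v) with (du (al2 L0 F lam N1) u v) in C13.
  change (dv (fun a b => be1 L0 F lam N2 a b) u v) with (dv (be1 L0 F lam N2) u v) in C14.
  change (du (fun a b => be2 L0 F lam N2 a b) u v) with (du (be2 L0 F lam N2) u v) in C14.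
  change (dv (fun a b => al2 L0 F lam N1 a b) u v) with (dv (al2 L0 F lam N1) u v) in C23.
  change (du (fun a b => al3 L0 F lam N1 a b) u v) with (du (al3 L0 F lam N1) u v) in C23.
  change (dv (fun a b => be2 L0 F lam N2 a b) u v) with (dv (be2 L0 F lam N2) u v) in C24.
  change (du (fun a b => be3 L0 F lam N2 a b) u v) with (du (be3 L0 F lam N2) u v) in C24.
  unfold brk1, brk2. rewrite EY, EX, EW, EZ.
  unfold W, X, Y, Z, Wf, Xf, Yf, Zf, phif, psif.
  destruct s; simpl; split; lra.
Qed.

Lemma du_conformal_factor u v :
  D (u, v) ->
  du (fun a b => L0 * e2l lam a b) u v = L0 * e2l lam u v * (2 * du lam u v) /\
  dv (fun a b => L0 * e2l lam a b) u v = L0 * e2l lam u v * (2 * dv lam u v).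
Proof.
  intros Huv. destruct (e2l_derive u v Huv) as [H1 H2]. fold e. split; apply is_derive_unique.
  - replace (L0 * e u v * (2 * du lam u v)) with (L0 * (2 * du lam u v * e u v)) by ring.
    now apply (is_derive_scal (fun t => e t v)).
  - replace (L0 * e u v * (2 * dv lam u v)) with (L0 * (2 * dv lam u v * e u v)) by ring.
    now apply (is_derive_scal (fun t => e u t)).
Qed.

Lemma frame_orthogonal_F u v a :
  D (u, v) -> (1 <= a <= 4)%nat -> ip L0 (frame a u v) (F u v) = 0.
Proof.
  intros Huv Ha. etransitivity; [apply (frame_orthogonal u v Huv a 0%nat); lia|].
  rewrite kron_neq by lia. apply Rmult_0_r.
Qed.

(** Normalizing by [exp (- lam)] removes the diagonal of the structure matrix, and the projection to
    the tangent space removes its column 0: the skew part remains. *)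
Lemma nab_normalized_frame u v a i :
  D (u, v) -> (1 <= a <= 4)%nat -> (i <= 4)%nat ->
  let V := fun x y => vscal (exp (- lam x y)) (frame a x y) in
  let E := fun b => frame b u v i in
  nab_u L0 F V u v i = exp (- lam u v) *
    (mvmul 4 (framePF u v) E a - du lam u v * E a - framePF u v a 0%nat * F u v i) /\
  nab_v L0 F V u v i = exp (- lam u v) *
    (mvmul 4 (frameQF u v) E a - dv lam u v * E a - frameQF u v a 0%nat * F u v i).
Proof.
  intros Huv Ha Hi V E.
  destruct data as [_ [Hl _]].
  destruct (smooth_on_partials D lam Hl u v Huv) as [Lu Lv].
  assert (HU : forall j, (j <= 4)%nat -> dU V u v j
            = exp (- lam u v) * dU (frame a) u v j - exp (- lam u v) * du lam u v * frame a u v j).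
  { intros j Hj. apply is_derive_unique.
    replace (exp (- lam u v) * dU (frame a) u v j - exp (- lam u v) * du lam u v * frame a u v j)
      with ((- du lam u v * exp (- lam u v)) * frame a u v j
            + exp (- lam u v) * dU (frame a) u v j) by ring.
    apply (is_derive_Rmult (fun t => exp (- lam t v)) (fun t => frame a t v j)).
    - apply (is_derive_Rcomp exp (fun t => - lam t v));
        [apply is_derive_exp|].
      apply (is_derive_opp (K := R_AbsRing) (V := R_NormedModule)). exact Lu.
    - destruct (smooth_on_partials D _ (frame_smooth a j ltac:(lia)) u v Huv) as [H _]. exact H. }
  assert (HV : forall j, (j <= 4)%nat -> dV V u v j
            = exp (- lam u v) * dV (frame a) u v j - exp (- lam u v) * dv lam u v * frame a u v j).
  { intros j Hj. apply is_derive_unique.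
    replace (exp (- lam u v) * dV (frame a) u v j - exp (- lam u v) * dv lam u v * frame a u v j)
      with ((- dv lam u v * exp (- lam u v)) * frame a u v j
            + exp (- lam u v) * dV (frame a) u v j) by ring.
    apply (is_derive_Rmult (fun t => exp (- lam u t)) (fun t => frame a u t j)).
    - apply (is_derive_Rcomp exp (fun t => - lam u t));
        [apply is_derive_exp|].
      apply (is_derive_opp (K := R_AbsRing) (V := R_NormedModule)). exact Lv.
    - destruct (smooth_on_partials D _ (frame_smooth a j ltac:(lia)) u v Huv) as [_ H]. exact H. }
  assert (I : forall (c d : R) (x y z : Vec), ip L0 (fun j => c * x j - d * y j) z
            = c * ip L0 x z - d * ip L0 y z) by (intros; unfold ip; ring).
  assert (Fa := frame_orthogonal_F u v a Huv Ha).
  destruct (frame_derive_coef u v a 0%nat Huv ltac:(lia) ltac:(lia)) as [PU PV].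
  destruct (frame_structure u v a i Huv ltac:(lia) Hi) as [SU SV].
  simpl in PU, PV.
  unfold nab_u, nab_v, tanproj. rewrite HU, HV by exact Hi.
  rewrite (ip_ext L0 (dU V u v) _ (F u v) (F u v) HU) by trivial.
  rewrite (ip_ext L0 (dV V u v) _ (F u v) (F u v) HV) by trivial.
  rewrite !I, Fa, PU, PV, SU, SV. unfold E.
  split; field; exact L0_neq0.
Qed.

(** Together with [Theta s] these two span the bivectors of the same duality type; [Theta s] has
    constant length in this parallel subbundle, so its derivative has only these components. *)
Definition twistor_basis1 (s : bool) u v : Biv :=
  badd (wedge (T1 F u v) (N1 u v)) (bscal (- sg s) (wedge (T2 F u v) (N2 u v))).
Definition twistor_basis2 (s : bool) u v : Biv :=
  badd (wedge (T1 F u v) (N2 u v)) (bscal (sg s) (wedge (T2 F u v) (N1 u v))).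

Lemma nabhat_Theta_coords s u v i j :
  D (u, v) -> (i <= 4)%nat -> (j <= 4)%nat ->
  let k := / sqrt 2 * (exp (- lam u v) * exp (- lam u v)) in
  nabhat_Theta F lam N1 N2 (nab_u L0 F) s u v i j =
    k * (W s u v * twistor_basis1 s u v i j + Y (negb s) u v * twistor_basis2 s u v i j) /\
  nabhat_Theta F lam N1 N2 (nab_v L0 F) s u v i j =
    k * (sg s * Z s u v * twistor_basis1 s u v i j
         - sg s * X (negb s) u v * twistor_basis2 s u v i j).
Proof.
  intros Huv Hi Hj k.
  pose proof (fun a Ha l Hl => nab_normalized_frame u v a l Huv Ha Hl) as H. cbv zeta in H.
  unfold nabhat_Theta, badd, bscal, wedge.
  destruct (H 1%nat ltac:(lia) i Hi) as [U1i V1i]. destruct (H 1%nat ltac:(lia) j Hj) as [U1j V1j].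
  destruct (H 2%nat ltac:(lia) i Hi) as [U2i V2i]. destruct (H 2%nat ltac:(lia) j Hj) as [U2j V2j].
  destruct (H 3%nat ltac:(lia) i Hi) as [U3i V3i]. destruct (H 3%nat ltac:(lia) j Hj) as [U3j V3j].
  destruct (H 4%nat ltac:(lia) i Hi) as [U4i V4i]. destruct (H 4%nat ltac:(lia) j Hj) as [U4j V4j].
  clear H.
  change (fun x y => vscal (exp (- lam x y)) (frame 1 x y)) with (ef1 F lam) in *.
  change (fun x y => vscal (exp (- lam x y)) (frame 2 x y)) with (ef2 F lam) in *.
  change (fun x y => vscal (exp (- lam x y)) (frame 3 x y)) with (ef3 lam N1) in *.
  change (fun x y => vscal (exp (- lam x y)) (frame 4 x y)) with (ef4 lam N2) in *.
  rewrite U1i, U1j, U2i, U2j, U3i, U3j, U4i, U4j, V1i, V1j, V2i, V2j, V3i, V3j, V4i, V4j.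
  clear U1i U1j U2i U2j U3i U3j U4i U4j V1i V1j V2i V2j V3i V3j V4i V4j.
  unfold mvmul, framePF, frameQF, ef1, ef2, ef3, ef4, vscal,
    twistor_basis1, twistor_basis2, badd, bscal, wedge, W, X, Y, Z, Wf, Xf, Yf, Zf, k.
  cbn [sum_f_R0 Pmat Qmat frame].
  destruct s; cbn [sg negb]; split; ring.
Qed.

Lemma twistor_basis_independent s u v p q :
  D (u, v) ->
  (forall i j, (i <= 4)%nat -> (j <= 4)%nat ->
     p * twistor_basis1 s u v i j + q * twistor_basis2 s u v i j = 0) -> p = 0 /\ q = 0.
Proof.
  intros Huv H.
  (* Contraction of a bivector with two vectors through the ambient metric: [T1, N1] isolates [p],
     and [T1, N2] isolates [q]. *)
  set (ctr := fun (B : Biv) (x y : Vec) =>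
    sum_f_R0 (fun i => sum_f_R0 (fun j => Jsig L0 i * x i * (Jsig L0 j * y j) * B i j) 4) 4).
  assert (Cw : forall a b c d x y, ctr (fun i j =>
      p * badd (wedge a b) (bscal c (wedge x y)) i j
      + q * badd (wedge a y) (bscal d (wedge x b)) i j) a b
      = (p * (ip L0 a a * ip L0 b b - ip L0 a b * ip L0 b a)
         + p * c * (ip L0 x a * ip L0 y b - ip L0 x b * ip L0 y a)
         + q * (ip L0 a a * ip L0 y b - ip L0 a b * ip L0 y a)
         + q * d * (ip L0 x a * ip L0 b b - ip L0 x b * ip L0 b a)) /\ ctr (fun i j =>
      p * badd (wedge a b) (bscal c (wedge x y)) i j
      + q * badd (wedge a y) (bscal d (wedge x b)) i j) a y
      = (p * (ip L0 a a * ip L0 b y - ip L0 a y * ip L0 b a)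
         + p * c * (ip L0 x a * ip L0 y y - ip L0 x y * ip L0 y a)
         + q * (ip L0 a a * ip L0 y y - ip L0 a y * ip L0 y a)
         + q * d * (ip L0 x a * ip L0 b y - ip L0 x y * ip L0 b a))).
  { intros a b c d x y. unfold ctr, badd, bscal, wedge, ip, Jsig. simpl. split; ring. }
  assert (Z0 : forall B x y, (forall i j, (i <= 4)%nat -> (j <= 4)%nat -> B i j = 0) ->
                ctr B x y = 0).
  { intros B x y HB. unfold ctr.
    rewrite (sum_eq _ (fun _ => 0)); [rewrite sum_cte; ring|]. intros i Hi.
    rewrite (sum_eq _ (fun _ => 0)); [rewrite sum_cte; ring|]. intros j Hj.
    rewrite HB by assumption. ring. }
  destruct (Cw (T1 F u v) (N1 u v) (- sg s) (sg s) (T2 F u v) (N2 u v)) as [C1 C2].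
  rewrite Z0 in C1, C2 by exact H.
  pose proof (frame_orthogonal u v Huv) as G.
  assert (E : forall a b, (a <= 4)%nat -> (b <= 4)%nat ->
     ip L0 (frame a u v) (frame b u v) = sqlen L0 (e u v) a * kron a b) by exact G.
  pose proof (E 1%nat 1%nat ltac:(lia) ltac:(lia)) as g11.
  pose proof (E 1%nat 3%nat ltac:(lia) ltac:(lia)) as g13.
  pose proof (E 1%nat 4%nat ltac:(lia) ltac:(lia)) as g14.
  pose proof (E 2%nat 1%nat ltac:(lia) ltac:(lia)) as g21.
  pose proof (E 2%nat 3%nat ltac:(lia) ltac:(lia)) as g23.
  pose proof (E 2%nat 4%nat ltac:(lia) ltac:(lia)) as g24.
  pose proof (E 3%nat 1%nat ltac:(lia) ltac:(lia)) as g31.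
  pose proof (E 3%nat 3%nat ltac:(lia) ltac:(lia)) as g33.
  pose proof (E 3%nat 4%nat ltac:(lia) ltac:(lia)) as g34.
  pose proof (E 4%nat 1%nat ltac:(lia) ltac:(lia)) as g41.
  pose proof (E 4%nat 3%nat ltac:(lia) ltac:(lia)) as g43.
  pose proof (E 4%nat 4%nat ltac:(lia) ltac:(lia)) as g44.
  unfold kron in *; cbn [frame sqlen Nat.eqb] in *.
  rewrite g11, g13, g14, g21, g23, g24, g31, g33, g34, g41, g43, g44 in *.
  assert (E0 := e2l_neq0 u v).
  assert (EE : e u v * e u v <> 0) by now apply Rmult_integral_contrapositive.
  split.
  - apply (Rmult_eq_reg_r (e u v * e u v)); [|exact EE]. rewrite Rmult_0_l, C1. ring.
  - apply (Rmult_eq_reg_r (e u v * e u v)); [|exact EE]. rewrite Rmult_0_l, C2. ring.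
Qed.

(** In the coordinates above the determinant of the two derivatives is [- sg s] times
    [Dlt (negb s)]: the lift of one sign governs the determinant of the opposite sign. *)
Lemma twistor_independent_iff s u v :
  D (u, v) ->
  lin_indep2 (nabhat_Theta F lam N1 N2 (nab_u L0 F) s u v)
             (nabhat_Theta F lam N1 N2 (nab_v L0 F) s u v)
  <-> Dlt W X Y Z (negb s) u v <> 0.
Proof.
  intros Huv.
  set (k := / sqrt 2 * (exp (- lam u v) * exp (- lam u v))).
  assert (Hk : k <> 0).
  { apply Rmult_integral_contrapositive_currified.
    - apply Rinv_neq_0_compat, Rgt_not_eq, sqrt_lt_R0. lra.
    - apply Rgt_not_eq, Rmult_lt_0_compat; apply exp_pos. }
  assert (S : sg s * sg s = 1) by (destruct s; simpl; ring).
  assert (HD : Dlt W X Y Z (negb s) u v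
     = W s u v * X (negb s) u v + Y (negb s) u v * Z s u v)
    by (unfold Dlt; now rewrite Bool.negb_involutive).
  set (w := W s u v) in *. set (x := X (negb s) u v) in *.
  set (y := Y (negb s) u v) in *. set (z := Z s u v) in *.
  assert (Hcomb : forall a b i j, (i <= 4)%nat -> (j <= 4)%nat ->
    a * nabhat_Theta F lam N1 N2 (nab_u L0 F) s u v i j
    + b * nabhat_Theta F lam N1 N2 (nab_v L0 F) s u v i j
    = k * ((a * w + b * (sg s * z)) * twistor_basis1 s u v i j
           + (a * y - b * (sg s * x)) * twistor_basis2 s u v i j)).
  { intros a b i j Hi Hj. destruct (nabhat_Theta_coords s u v i j Huv Hi Hj) as [E1 E2].
    rewrite E1, E2. unfold k, w, x, y, z. ring. }
  split.
  - intros L HD0. rewrite HD in HD0.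
    assert (L' : forall a b, a * w + b * (sg s * z) = 0 -> a * y - b * (sg s * x) = 0 ->
                  a = 0 /\ b = 0).
    { intros a b E1 E2. apply L. intros i j Hi Hj.
      rewrite Hcomb, E1, E2 by lia. ring. }
    (* If the determinant vanished, the adjugate of the coordinate matrix would supply relations;
       independence makes its entries vanish, and then [(1, 0)] is a nontrivial relation. *)
    destruct (L' (sg s * x) y) as [X0 Y0].
    { transitivity (sg s * (w * x + y * z)); [ring | rewrite HD0; ring]. }
    { ring. }
    destruct (L' (- (sg s * z)) w) as [Z0 W0].
    { ring. }
    { transitivity (- (sg s * (w * x + y * z))); [ring | rewrite HD0; ring]. }
    destruct (L' 1 0) as [O _]; [| | lra].
    + rewrite W0. ring.
    + rewrite Y0. ring.
  - intros HD0 a b Hab. rewrite HD in HD0.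
    destruct (twistor_basis_independent s u v (a * w + b * (sg s * z)) (a * y - b * (sg s * x)) Huv)
      as [E1 E2].
    { intros i j Hi Hj. apply (Rmult_eq_reg_l k); [|exact Hk].
      rewrite Rmult_0_r, <- Hcomb by assumption. apply Hab; lia. }
    split; apply (Rmult_eq_reg_r (w * x + y * z)); trivial; rewrite Rmult_0_l.
    + transitivity (x * (a * w + b * (sg s * z)) + z * (a * y - b * (sg s * x))); [ring|].
      rewrite E1, E2; ring.
    + transitivity (sg s * sg s * (b * (w * x + y * z))); [rewrite S; ring|].
      transitivity (sg s * (y * (a * w + b * (sg s * z)) - w * (a * y - b * (sg s * x)))); [ring|].
      rewrite E1, E2; ring.
Qed.

Lemma frame_coefs s u v :
  D (u, v) -> Dlt W X Y Z s u v <> 0 ->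
  Acoef W X Y Z s u v = phif L0 F lam N1 N2 s u v /\
  Bneg W X Y Z s u v = psif L0 F lam N1 N2 (negb s) u v.
Proof.
  intros Huv HD. apply coef_cramer; [exact HD | now apply frame_brackets].
Qed.

(** For a fixed ambient coordinate [k], the [k]-th coordinates of the five frame vectors form one
    solution of the linear system. *)
Lemma frame_columns_flat k :
  (k <= 4)%nat -> flat_section 4 framePF frameQF D (fun u v a => frame a u v k).
Proof.
  intros Hk u v a Huv Ha.
  destruct (smooth_on_partials D _ (frame_smooth a k ltac:(lia)) u v Huv) as [H1 H2].
  destruct (frame_structure u v a k Huv Ha Hk) as [E1 E2].
  rewrite <- E1, <- E2. split; assumption.
Qed.
End LocalData.

(** * Reconstruction of the immersion *)

(** Half sums and half differences over the sign invert the definitions of the associated functions: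
    for instance [W] yields [alpha_2] and [beta_1]. *)
Definition half_sum (g : bool -> R -> R -> R) (u v : R) : R := (g true u v + g false u v) / 2.
Definition half_diff (g : bool -> R -> R -> R) (u v : R) : R := (g true u v - g false u v) / 2.

Lemma half_sum_derive D g u v :
  (forall s, smooth_on D (g s)) -> D (u, v) ->
  du (half_sum g) u v = (du (g true) u v + du (g false) u v) / 2 /\
  dv (half_sum g) u v = (dv (g true) u v + dv (g false) u v) / 2.
Proof.
  intros Hg Huv.
  destruct (smooth_on_partials D _ (Hg true) u v Huv) as [T1 T2].
  destruct (smooth_on_partials D _ (Hg false) u v Huv) as [F1 F2].
  split; apply is_derive_unique; unfold half_sum.
  - apply (is_derive_ext (fun t => / 2 * (g true t v + g false t v)));
      [intros; apply Rmult_comm|].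
    replace ((du (g true) u v + du (g false) u v) / 2)
      with (/ 2 * (du (g true) u v + du (g false) u v)) by (unfold Rdiv; ring).
    apply (is_derive_scal (fun t => g true t v + g false t v)). now apply is_derive_Rplus.
  - apply (is_derive_ext (fun t => / 2 * (g true u t + g false u t)));
      [intros; apply Rmult_comm|].
    replace ((dv (g true) u v + dv (g false) u v) / 2)
      with (/ 2 * (dv (g true) u v + dv (g false) u v)) by (unfold Rdiv; ring).
    apply (is_derive_scal (fun t => g true u t + g false u t)). now apply is_derive_Rplus.
Qed.

Lemma half_diff_derive D g u v :
  (forall s, smooth_on D (g s)) -> D (u, v) ->
  du (half_diff g) u v = (du (g true) u v - du (g false) u v) / 2 /\
  dv (half_diff g) u v = (dv (g true) u v - dv (g false) u v) / 2.
Proof.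
  intros Hg Huv.
  destruct (smooth_on_partials D _ (Hg true) u v Huv) as [T1 T2].
  destruct (smooth_on_partials D _ (Hg false) u v Huv) as [F1 F2].
  split; apply is_derive_unique; unfold half_diff.
  - apply (is_derive_ext (fun t => / 2 * (g true t v - g false t v)));
      [intros; apply Rmult_comm|].
    replace ((du (g true) u v - du (g false) u v) / 2)
      with (/ 2 * (du (g true) u v - du (g false) u v)) by (unfold Rdiv; ring).
    apply (is_derive_scal (fun t => g true t v - g false t v)). now apply is_derive_Rminus.
  - apply (is_derive_ext (fun t => / 2 * (g true u t - g false u t)));
      [intros; apply Rmult_comm|].
    replace ((dv (g true) u v - dv (g false) u v) / 2)
      with (/ 2 * (dv (g true) u v - dv (g false) u v)) by (unfold Rdiv; ring).
    apply (is_derive_scal (fun t => g true u t - g false u t)). now apply is_derive_Rminus.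
Qed.

Lemma smooth_on_half_sum D g :
  open D -> (forall s, smooth_on D (g s)) -> smooth_on D (half_sum g).
Proof.
  intros HD Hg.
  apply (smooth_on_mult D HD (fun u v => g true u v + g false u v) (fun _ _ => / 2)).
  - now apply (smooth_on_plus D HD (g true) (g false)).
  - now apply smooth_on_const.
Qed.

Lemma smooth_on_half_diff D g :
  open D -> (forall s, smooth_on D (g s)) -> smooth_on D (half_diff g).
Proof.
  intros HD Hg.
  apply (smooth_on_mult D HD (fun u v => g true u v - g false u v) (fun _ _ => / 2)).
  - now apply (smooth_on_minus D HD (g true) (g false)).
  - now apply smooth_on_const.
Qed.

Lemma dudv_ext D g h u v :
  open D -> D (u, v) -> (forall u v, D (u, v) -> g u v = h u v) ->
  du g u v = du h u v /\ dv g u v = dv h u v.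
Proof.
  intros HD Huv E. split; apply Derive_ext_loc.
  - generalize (open_slice_u D u v HD Huv). apply filter_imp. intros; now apply E.
  - generalize (open_slice_v D u v HD Huv). apply filter_imp. intros; now apply E.
Qed.

Lemma du_opp g u v : du (fun a b => - g a b) u v = - du g u v.
Proof. apply Derive_opp. Qed.

Lemma dv_opp g u v : dv (fun a b => - g a b) u v = - dv g u v.
Proof. apply Derive_opp. Qed.

Lemma du_scal c g u v : du (fun a b => c * g a b) u v = c * du g u v.
Proof. apply Derive_scal. Qed.

Lemma dv_scal c g u v : dv (fun a b => c * g a b) u v = c * dv g u v.
Proof. apply Derive_scal. Qed.

Lemma du_const c u v : du (fun _ _ => c) u v = 0.
Proof. exact (Derive_const c _). Qed.

Lemma dv_const c u v : dv (fun _ _ => c) u v = 0.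
Proof. exact (Derive_const c _). Qed.

Lemma partials_zero_locally_constant (D : R * R -> Prop) h z d :
  (forall w, near z d w -> D w) -> has_partials D h (fun _ _ => 0) (fun _ _ => 0) ->
  forall w, near z d w -> h (fst w) (snd w) = h (fst z) (snd z).
Proof.
  intros HD Hh w [W1 W2].
  assert (Z0 : forall x, Rabs (x - x) < d).
  { intros x. rewrite Rminus_diag, Rabs_R0. eapply Rle_lt_trans; [apply Rabs_pos | exact W1]. }
  assert (E1 : Rabs (h (fst w) (snd z) - h (fst z) (snd z)) <= 0 * Rabs (fst w - fst z)).
  { apply (MVT_Rabs (fun t => h t (snd z)) (fun _ => 0)). intros t Ht.
    rewrite Rabs_R0. split; [|lra].
    destruct (Hh t (snd z)) as [H _]; [|exact H]. apply HD.
    split; [now apply (Rabs_between_lt (fst z) (fst w)) | apply Z0]. }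
  assert (E2 : Rabs (h (fst w) (snd w) - h (fst w) (snd z)) <= 0 * Rabs (snd w - snd z)).
  { apply (MVT_Rabs (fun t => h (fst w) t) (fun _ => 0)). intros t Ht.
    rewrite Rabs_R0. split; [|lra].
    destruct (Hh (fst w) t) as [_ H]; [|exact H]. apply HD.
    split; [exact W1 | now apply (Rabs_between_lt (snd z) (snd w))]. }
  rewrite Rmult_0_l in E1, E2. apply Rabs_le_between in E1. apply Rabs_le_between in E2. lra.
Qed.

Lemma locally_constant_domain (D S : R * R -> Prop) p q :
  simply_connected_domain D ->
  (forall z, D z -> exists d, 0 < d /\ forall w, D w -> near z d w -> (S w <-> S z)) ->
  D p -> D q -> S p -> S q.
Proof.
  intros [_ [_ [PC _]]] HS Hp Hq Sp.
  destruct (PC p q Hp Hq) as [g [[Cg Dg] [g0 g1]]]. rewrite <- g1. rewrite <- g0 in Sp.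
  revert Sp. apply (locally_constant_segment (fun t => S (g t)));
    [|split; lra | split; lra].
  intros t Ht. destruct (HS (g t) (Dg t Ht)) as [d [Hd Hw]].
  assert (L : locally t (fun s => near (g t) d (g s))).
  { apply (Cg t). apply near_open. now apply near_center. }
  destruct L as [r Hr]. exists r. split; [apply cond_pos|].
  intros t' Ht' Htt. apply Hw; [now apply Dg | now apply Hr].
Qed.

Lemma partials_zero_constant D h p q :
  simply_connected_domain D -> has_partials D h (fun _ _ => 0) (fun _ _ => 0) ->
  D p -> D q -> h (fst p) (snd p) = h (fst q) (snd q).
Proof.
  intros SC Hh Hp Hq. symmetry.
  apply (locally_constant_domain D (fun z => h (fst z) (snd z) = h (fst p) (snd p)) p q); trivial.
  intros z Hz. destruct (open_near D z (proj1 SC) Hz) as [d [Hd HD]].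
  exists d. split; [exact Hd|]. intros w _ Nw.
  now rewrite (partials_zero_locally_constant D h z d HD Hh w Nw).
Qed.

(** Applied to the determinant of the frame, this selects the orientation of the space form. *)
Lemma nonvanishing_constant_sign D h :
  simply_connected_domain D -> cont_on D h -> (forall u v, D (u, v) -> h u v <> 0) ->
  exists o, (o = 1 \/ o = -1) /\ forall u v, D (u, v) -> 0 < o * h u v.
Proof.
  intros SC Ch Hh. pose proof SC as [_ [[p Hp] _]].
  assert (L : forall z, D z -> exists d, 0 < d /\
     forall w, D w -> near z d w -> (0 < h (fst w) (snd w) <-> 0 < h (fst z) (snd z))).
  { intros [a b] Hz.
    assert (Hpos : 0 < Rabs (h a b)) by now apply Rabs_pos_lt, Hh.
    destruct (proj1 (near_locally (a, b) (fun w => Rabs (h (fst w) (snd w) - h a b) < Rabs (h a b))))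
      as [d [Hd Hn]].
    { apply (proj1 (filterlim_locally _ _) (Ch a b Hz) (mkposreal _ Hpos)). }
    exists d. split; [exact Hd|]. intros w _ Nw. specialize (Hn w Nw). simpl.
    revert Hn. unfold Rabs. repeat destruct Rcase_abs; intros; lra. }
  destruct (Rlt_dec 0 (h (fst p) (snd p))) as [P|N].
  - exists 1. split; [now left|]. intros u v Huv. rewrite Rmult_1_l.
    exact (locally_constant_domain D (fun z => 0 < h (fst z) (snd z)) p (u, v) SC L Hp Huv P).
  - exists (-1). split; [now right|]. intros u v Huv.
    assert (N' : ~ 0 < h u v).
    { intros P. apply N.
      exact (locally_constant_domain D (fun z => 0 < h (fst z) (snd z)) (u, v) p SC L Huv Hp P). }
    specialize (Hh u v Huv). lra.
Qed.

Lemma smooth_on_detn D n (M : nat -> nat -> R -> R -> R) :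
  open D -> (forall i j, (i < n)%nat -> (j < n)%nat -> smooth_on D (M i j)) ->
  smooth_on D (fun u v => detn n (fun i j => M i j u v)).
Proof.
  intros HD. revert M. induction n as [|n IH]; intros M HM.
  - now apply (smooth_on_const D HD 1).
  - simpl. apply (smooth_on_sum_f_R0 D n (fun j u v => (-1) ^ j * M 0%nat j u v *
      detn n (fun i k => M (S i) (if Nat.ltb k j then k else S k) u v)) HD).
    intros j Hj.
    apply (smooth_on_mult D HD (fun u v => (-1) ^ j * M 0%nat j u v)
      (fun u v => detn n (fun i k => M (S i) (if Nat.ltb k j then k else S k) u v))).
    + apply (smooth_on_mult D HD (fun _ _ => (-1) ^ j) (M 0%nat j)).
      * now apply smooth_on_const.
      * apply HM; lia.
    + apply (IH (fun i k => M (S i) (if Nat.ltb k j then k else S k))).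
      intros i k Hi Hk. apply HM; [lia|]. destruct Nat.ltb; lia.
Qed.

Definition pairing (L0 e : R) (y z : Vec) : R :=
  sum_f_R0 (fun a => y a * z a / sqlen L0 e a) 4.

(** Both kinds of matrix satisfy [M g + g M^T = dg] for the diagonal matrix [g] of the squared
    lengths, and this cancels the derivative of [g^-1]. The disjunction serves the two directions at
    once. *)
Lemma pairing_derive L0 (y z : R -> Vec) (e : R -> R) (M : nat -> nat -> R) (t de : R) :
  L0 <> 0 -> e t <> 0 -> is_derive e t de ->
  (forall a, (a <= 4)%nat -> is_derive (fun s => y s a) t (mvmul 4 M (y t) a)) ->
  (forall a, (a <= 4)%nat -> is_derive (fun s => z s a) t (mvmul 4 M (z t) a)) ->
  (exists lu lv a1 b1 a2 b2 m, M = Pmat L0 (e t) lu lv a1 b1 a2 b2 m /\ de = 2 * lu * e t) \/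
  (exists lu lv a2 b2 a3 b3 m, M = Qmat L0 (e t) lu lv a2 b2 a3 b3 m /\ de = 2 * lv * e t) ->
  is_derive (fun s => pairing L0 (e s) (y s) (z s)) t 0.
Proof.
  intros HL He Hde Hy Hz HM.
  set (dg := fun a => match a with O => 0 | _ => - de / (e t * e t) end).
  assert (Hg : forall a, is_derive (fun s => / sqlen L0 (e s) a) t (dg a)).
  { intros [|a]; simpl; [apply is_derive_Rconst|].
    replace (- de / (e t * e t)) with (- de / e t ^ 2) by (field; exact He).
    now apply is_derive_inv. }
  replace 0 with (sum_f_R0 (fun a => (mvmul 4 M (y t) a * z t a + y t a * mvmul 4 M (z t) a)
      * / sqlen L0 (e t) a + y t a * z t a * dg a) 4).
  - apply (is_derive_sum_f_R0 4 (fun a s => y s a * z s a * / sqlen L0 (e s) a)).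
    intros a Ha. apply (is_derive_Rmult (fun s => y s a * z s a) (fun s => / sqlen L0 (e s) a)); [|apply Hg].
    apply (is_derive_Rmult (fun s => y s a) (fun s => z s a)); auto.
  - unfold dg, mvmul.
    destruct HM as [[lu [lv [a1 [b1 [a2 [b2 [m [-> ->]]]]]]]]|[lu [lv [a2 [b2 [a3 [b3 [m [-> ->]]]]]]]]];
      cbn [sum_f_R0 Pmat Qmat sqlen]; field; split; assumption.
Qed.

(* Unification would otherwise unfold iterated derivatives to compare functions. *)
Opaque smooth_on.

(** * The integrable system attached to the given functions *)

Section Existence.
Variables (L0 : R) (D : R * R -> Prop) (W X Y Z : bool -> R -> R -> R).
Hypothesis L0_neq0 : L0 <> 0.
Hypothesis openD : open D.
Hypothesis smoothWXYZ :
  forall s, smooth_on D (W s) /\ smooth_on D (X s) /\ smooth_on D (Y s) /\ smooth_on D (Z s).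
Hypothesis sumWX : forall u v, D (u, v) -> W true u v + W false u v = X true u v + X false u v.
Hypothesis sumYZ : forall u v, D (u, v) -> Y true u v + Y false u v = Z true u v + Z false u v.
Hypothesis Dlt_neq0 : forall u v s, D (u, v) -> Dlt W X Y Z s u v <> 0.
Let A := Acoef W X Y Z.
Let B := Bcoef W X Y Z.
Hypothesis ricci : forall u v, D (u, v) ->
  Dlt W X Y Z true u v - Dlt W X Y Z false u v =
  du (fun a b => A true a b - A false a b) u v - dv (fun a b => B true a b - B false a b) u v.
Let f := fun u v => Dlt W X Y Z true u v - du (A true) u v - dv (B false) u v.
Hypothesis f_pos : forall u v, D (u, v) -> f u v / L0 > 0.
Hypothesis f_du : forall u v, D (u, v) -> du f u v = f u v * (A true u v + A false u v).
Hypothesis f_dv : forall u v, D (u, v) -> dv f u v = f u v * (B true u v + B false u v).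
Let lam := fun u v => / 2 * ln (f u v / L0).

Let smoothW s : smooth_on D (W s) := proj1 (smoothWXYZ s).
Let smoothX s : smooth_on D (X s) := proj1 (proj2 (smoothWXYZ s)).
Let smoothY s : smooth_on D (Y s) := proj1 (proj2 (proj2 (smoothWXYZ s))).
Let smoothZ s : smooth_on D (Z s) := proj2 (proj2 (proj2 (smoothWXYZ s))).

Lemma Dlt_smooth s : smooth_on D (Dlt W X Y Z s).
Proof.
  apply (smooth_on_plus D openD (fun u v => W (negb s) u v * X s u v)
           (fun u v => Y s u v * Z (negb s) u v)).
  - now apply (smooth_on_mult D openD (W (negb s)) (X s)).
  - now apply (smooth_on_mult D openD (Y s) (Z (negb s))).
Qed.

Lemma brk1_smooth s : smooth_on D (brk1 X Y s).
Proof.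
  apply (smooth_on_minus D openD (dv (Y s)) (fun u v => sg s * du (X s) u v)).
  - exact (smooth_on_dv D _ (smoothY s)).
  - apply (smooth_on_mult D openD (fun _ _ => sg s) (du (X s))); [now apply smooth_on_const|].
    exact (smooth_on_du D _ (smoothX s)).
Qed.

Lemma brk2_smooth s : smooth_on D (brk2 W Z s).
Proof.
  apply (smooth_on_plus D openD (dv (W (negb s))) (fun u v => sg s * du (Z (negb s)) u v)).
  - exact (smooth_on_dv D _ (smoothW (negb s))).
  - apply (smooth_on_mult D openD (fun _ _ => sg s) (du (Z (negb s)))); [now apply smooth_on_const|].
    exact (smooth_on_du D _ (smoothZ (negb s))).
Qed.

Lemma Acoef_smooth s : smooth_on D (A s).
Proof.
  apply (smooth_on_mult D openD (fun u v => - sg s / Dlt W X Y Z s u v)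
    (fun u v => - X s u v * brk1 X Y s u v + Z (negb s) u v * brk2 W Z s u v)).
  - apply (smooth_on_div D openD (fun _ _ => - sg s) (Dlt W X Y Z s)).
    + intros; now apply Dlt_neq0.
    + now apply smooth_on_const.
    + apply Dlt_smooth.
  - apply (smooth_on_plus D openD (fun u v => - X s u v * brk1 X Y s u v)
             (fun u v => Z (negb s) u v * brk2 W Z s u v)).
    + apply (smooth_on_mult D openD (fun u v => - X s u v) (brk1 X Y s)); [|apply brk1_smooth].
      exact (smooth_on_opp D openD (X s) (smoothX s)).
    + apply (smooth_on_mult D openD (Z (negb s)) (brk2 W Z s)); [trivial | apply brk2_smooth].
Qed.

Lemma Bcoef_smooth t : smooth_on D (B t).
Proof.
  set (s := negb t).
  apply (smooth_on_mult D openD (fun u v => - / Dlt W X Y Z s u v)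
    (fun u v => Y s u v * brk1 X Y s u v + W (negb s) u v * brk2 W Z s u v)).
  - apply (smooth_on_opp D openD (fun u v => / Dlt W X Y Z s u v)).
    apply (smooth_on_inv D openD (Dlt W X Y Z s)); [|apply Dlt_smooth].
    intros; now apply Dlt_neq0.
  - apply (smooth_on_plus D openD (fun u v => Y s u v * brk1 X Y s u v)
             (fun u v => W (negb s) u v * brk2 W Z s u v)).
    + apply (smooth_on_mult D openD (Y s) (brk1 X Y s)); [trivial | apply brk1_smooth].
    + apply (smooth_on_mult D openD (W (negb s)) (brk2 W Z s)); [trivial | apply brk2_smooth].
Qed.

Lemma f_smooth : smooth_on D f.
Proof.
  apply (smooth_on_minus D openD (fun u v => Dlt W X Y Z true u v - du (A true) u v)
           (dv (B false))).
  - apply (smooth_on_minus D openD (Dlt W X Y Z true) (du (A true))); [apply Dlt_smooth|].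
    exact (smooth_on_du D _ (Acoef_smooth true)).
  - exact (smooth_on_dv D _ (Bcoef_smooth false)).
Qed.

Let e := fun u v => f u v / L0.

Lemma e_smooth : smooth_on D e.
Proof.
  apply (smooth_on_mult D openD f (fun _ _ => / L0)); [apply f_smooth | now apply smooth_on_const].
Qed.

Lemma lam_smooth : smooth_on D lam.
Proof.
  apply (smooth_on_mult D openD (fun _ _ => / 2) (fun u v => ln (e u v))).
  - now apply smooth_on_const.
  - apply (smooth_on_ln D openD e); [exact f_pos | apply e_smooth].
Qed.

Lemma e2l_lam u v : D (u, v) -> e2l lam u v = e u v.
Proof.
  intros Huv. unfold e2l, lam. rewrite <- Rmult_assoc, Rinv_r, Rmult_1_l by lra.
  apply exp_ln. now apply f_pos.
Qed.

Lemma e_derive u v : D (u, v) ->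
  du e u v = e u v * (2 * half_sum A u v) /\ dv e u v = e u v * (2 * half_sum B u v).
Proof.
  intros Huv.
  assert (E : forall a b, e a b = / L0 * f a b) by (intros; unfold e, Rdiv; ring).
  destruct (dudv_ext D e (fun a b => / L0 * f a b) u v openD Huv ltac:(auto)) as [E1 E2].
  rewrite E1, E2. split.
  - transitivity (/ L0 * du f u v); [apply Derive_scal|]. rewrite f_du by exact Huv.
    unfold e, half_sum. field. exact L0_neq0.
  - transitivity (/ L0 * dv f u v); [apply Derive_scal|]. rewrite f_dv by exact Huv.
    unfold e, half_sum. field. exact L0_neq0.
Qed.

(** The hypotheses on [f] say that the logarithm of [f / L0] has the partials [A_+ + A_-] and
    [B_+ + B_-]; [lam] is half of it. *)
Lemma lam_derive u v : D (u, v) ->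
  du lam u v = half_sum A u v /\ dv lam u v = half_sum B u v.
Proof.
  intros Huv. assert (Hp : 0 < e u v) by now apply f_pos.
  destruct (smooth_on_partials D e e_smooth u v Huv) as [H1 H2].
  destruct (e_derive u v Huv) as [E1 E2]. rewrite E1 in H1. rewrite E2 in H2.
  split; apply is_derive_unique.
  - replace (half_sum A u v) with (/ 2 * ((e u v * (2 * half_sum A u v)) * / e u v)) by (field; lra).
    apply (is_derive_scal (fun t => ln (e t v))).
    apply (is_derive_Rcomp ln (fun t => e t v)); trivial.
    now apply is_derive_ln.
  - replace (half_sum B u v) with (/ 2 * ((e u v * (2 * half_sum B u v)) * / e u v)) by (field; lra).
    apply (is_derive_scal (fun t => ln (e u t))).
    apply (is_derive_Rcomp ln (fun t => e u t)); trivial.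
    now apply is_derive_ln.
Qed.

(* The normal connection form: [mu_1 = (B_- - B_+) / 2] and [mu_2 = (A_- - A_+) / 2]. *)
Let An := fun s => A (negb s).
Let Bn := fun s => B (negb s).

(** [half_sum W] takes the place of [alpha_2] and [half_sum Y] that of [beta_2]; the two sum
    hypotheses say that [X] and [Z] yield the same values. *)
Definition solP : mfield := fun u v =>
  Pmat L0 (e u v) (half_sum A u v) (half_sum B u v) (half_diff Y u v) (half_diff W u v)
    (half_sum W u v) (half_sum Y u v) (half_diff Bn u v).
Definition solQ : mfield := fun u v =>
  Qmat L0 (e u v) (half_sum A u v) (half_sum B u v) (half_sum W u v) (half_sum Y u v)
    (half_diff Z u v) (half_diff X u v) (half_diff An u v).

Lemma Pmat_smooth (e' lu lv a1 b1 a2 b2 m1 : R -> R -> R) :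
  smooth_on D e' -> smooth_on D lu -> smooth_on D lv -> smooth_on D a1 -> smooth_on D b1 ->
  smooth_on D a2 -> smooth_on D b2 -> smooth_on D m1 ->
  msmooth_on 4 D (fun u v => Pmat L0 (e' u v) (lu u v) (lv u v) (a1 u v) (b1 u v)
                               (a2 u v) (b2 u v) (m1 u v)).
Proof.
  intros He Hlu Hlv Ha1 Hb1 Ha2 Hb2 Hm a b Ha Hb.
  destruct a as [|[|[|[|[|a]]]]]; try lia; destruct b as [|[|[|[|[|b]]]]]; try lia;
    cbn [Pmat]; try assumption; try (now apply smooth_on_const);
    try (now apply smooth_on_opp).
  apply (smooth_on_opp D openD (fun u v => L0 * e' u v)).
  apply (smooth_on_mult D openD (fun _ _ => L0) e'); [now apply smooth_on_const | exact He].
Qed.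

Lemma Qmat_smooth (e' lu lv a2 b2 a3 b3 m2 : R -> R -> R) :
  smooth_on D e' -> smooth_on D lu -> smooth_on D lv -> smooth_on D a2 -> smooth_on D b2 ->
  smooth_on D a3 -> smooth_on D b3 -> smooth_on D m2 ->
  msmooth_on 4 D (fun u v => Qmat L0 (e' u v) (lu u v) (lv u v) (a2 u v) (b2 u v)
                               (a3 u v) (b3 u v) (m2 u v)).
Proof.
  intros He Hlu Hlv Ha1 Hb1 Ha2 Hb2 Hm a b Ha Hb.
  destruct a as [|[|[|[|[|a]]]]]; try lia; destruct b as [|[|[|[|[|b]]]]]; try lia;
    cbn [Qmat]; try assumption; try (now apply smooth_on_const);
    try (now apply smooth_on_opp).
  apply (smooth_on_opp D openD (fun u v => L0 * e' u v)).
  apply (smooth_on_mult D openD (fun _ _ => L0) e'); [now apply smooth_on_const | exact He].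
Qed.

Lemma solP_smooth : msmooth_on 4 D solP.
Proof.
  apply Pmat_smooth; first
    [ exact e_smooth
    | exact (smooth_on_half_sum D _ openD Acoef_smooth)
    | exact (smooth_on_half_sum D _ openD Bcoef_smooth)
    | exact (smooth_on_half_sum D _ openD smoothW)
    | exact (smooth_on_half_sum D _ openD smoothY)
    | exact (smooth_on_half_diff D _ openD smoothW)
    | exact (smooth_on_half_diff D _ openD smoothX)
    | exact (smooth_on_half_diff D _ openD smoothY)
    | exact (smooth_on_half_diff D _ openD smoothZ)
    | exact (smooth_on_half_diff D _ openD (fun s => Acoef_smooth (negb s)))
    | exact (smooth_on_half_diff D _ openD (fun s => Bcoef_smooth (negb s))) ].
Qed.

Lemma solQ_smooth : msmooth_on 4 D solQ.
Proof.
  apply Qmat_smooth; first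
    [ exact e_smooth
    | exact (smooth_on_half_sum D _ openD Acoef_smooth)
    | exact (smooth_on_half_sum D _ openD Bcoef_smooth)
    | exact (smooth_on_half_sum D _ openD smoothW)
    | exact (smooth_on_half_sum D _ openD smoothY)
    | exact (smooth_on_half_diff D _ openD smoothW)
    | exact (smooth_on_half_diff D _ openD smoothX)
    | exact (smooth_on_half_diff D _ openD smoothY)
    | exact (smooth_on_half_diff D _ openD smoothZ)
    | exact (smooth_on_half_diff D _ openD (fun s => Acoef_smooth (negb s)))
    | exact (smooth_on_half_diff D _ openD (fun s => Bcoef_smooth (negb s))) ].
Qed.

Lemma given_brackets s u v : D (u, v) ->
  brk1 X Y s u v = sg s * W (negb s) u v * A s u v - Z (negb s) u v * B (negb s) u v /\
  brk2 W Z s u v = - sg s * Y s u v * A s u v - X s u v * B (negb s) u v.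
Proof.
  intros Huv. apply (coef_cramer W X Y Z s u v); [now apply Dlt_neq0|]. split; [reflexivity|].
  unfold B, Bcoef. now rewrite Bool.negb_involutive.
Qed.

(** The Gauss equation is half the sum of the two expressions for [f], and the Ricci equation
    expresses that these agree. The Codazzi entries are [given_brackets], the diagonal is the
    symmetry of the second derivatives of [lam], and column 0 involves the derivative of [e]. *)
Lemma sol_integrable : integrable 4 D solP solQ.
Proof.
  intros u v a b Huv Ha Hb.
  destruct (half_sum_derive D A u v Acoef_smooth Huv) as [dA1 dA2].
  destruct (half_sum_derive D B u v Bcoef_smooth Huv) as [dB1 dB2].
  destruct (half_sum_derive D W u v smoothW Huv) as [dW1 dW2].
  destruct (half_sum_derive D X u v smoothX Huv) as [dX1 dX2].
  destruct (half_sum_derive D Y u v smoothY Huv) as [dY1 dY2].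
  destruct (half_sum_derive D Z u v smoothZ Huv) as [dZ1 dZ2].
  destruct (half_diff_derive D W u v smoothW Huv) as [hW1 hW2].
  destruct (half_diff_derive D X u v smoothX Huv) as [hX1 hX2].
  destruct (half_diff_derive D Y u v smoothY Huv) as [hY1 hY2].
  destruct (half_diff_derive D Z u v smoothZ Huv) as [hZ1 hZ2].
  destruct (half_diff_derive D An u v (fun s => Acoef_smooth (negb s)) Huv) as [hA1 hA2].
  destruct (half_diff_derive D Bn u v (fun s => Bcoef_smooth (negb s)) Huv) as [hB1 hB2].
  destruct (e_derive u v Huv) as [e1 e2].
  assert (EWX : forall x y, D (x, y) -> half_sum W x y = half_sum X x y)
    by (intros; unfold half_sum; now rewrite sumWX).
  assert (EYZ : forall x y, D (x, y) -> half_sum Y x y = half_sum Z x y)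
    by (intros; unfold half_sum; now rewrite sumYZ).
  destruct (dudv_ext D _ _ u v openD Huv EWX) as [WX1 WX2].
  destruct (dudv_ext D _ _ u v openD Huv EYZ) as [YZ1 YZ2].
  rewrite dW1, dX1 in WX1. rewrite dW2, dX2 in WX2.
  rewrite dY1, dZ1 in YZ1. rewrite dY2, dZ2 in YZ2.
  assert (schwarz : dv (half_sum A) u v = du (half_sum B) u v).
  { destruct (dudv_ext D (du lam) (half_sum A) u v openD Huv) as [_ <-].
    { intros x y Hxy. now apply lam_derive. }
    destruct (dudv_ext D (dv lam) (half_sum B) u v openD Huv) as [<- _].
    { intros x y Hxy. now apply lam_derive. }
    exact (smooth_on_du_dv_comm D openD lam u v lam_smooth Huv). }
  rewrite dA2, dB1 in schwarz.
  destruct (given_brackets true u v Huv) as [K1 K2].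
  destruct (given_brackets false u v Huv) as [K3 K4].
  pose proof (ricci u v Huv) as R.
  destruct (smooth_on_partials D _ (Acoef_smooth true) u v Huv) as [At1 _].
  destruct (smooth_on_partials D _ (Acoef_smooth false) u v Huv) as [Af1 _].
  destruct (smooth_on_partials D _ (Bcoef_smooth true) u v Huv) as [_ Bt2].
  destruct (smooth_on_partials D _ (Bcoef_smooth false) u v Huv) as [_ Bf2].
  assert (RA : du (fun a b => A true a b - A false a b) u v = du (A true) u v - du (A false) u v)
    by (apply is_derive_unique; now apply is_derive_Rminus).
  assert (RB : dv (fun a b => B true a b - B false a b) u v = dv (B true) u v - dv (B false) u v)
    by (apply is_derive_unique; now apply is_derive_Rminus).
  rewrite RA, RB in R. clear RA RB At1 Af1 Bt2 Bf2 EWX EYZ.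
  assert (G : L0 * e u v = Dlt W X Y Z true u v - du (A true) u v - dv (B false) u v).
  { unfold e, f. field. exact L0_neq0. }
  pose proof (sumWX u v Huv) as SX. pose proof (sumYZ u v Huv) as SZ.
  (* With [X_+] and [Z_+] eliminated, every entry is a linear combination of the collected equations
     in which products count as atoms, so [lra] suffices. *)
  assert (SX' : X true u v = W true u v + W false u v - X false u v) by lra.
  assert (SZ' : Z true u v = Y true u v + Y false u v - Z false u v) by lra.
  clear SX SZ.
  unfold Dlt, brk1, brk2 in *. unfold An, Bn in hA1, hA2, hB1, hB2.
  cbn [negb sg] in *. rewrite SX', SZ' in *.
  destruct a as [|[|[|[|[|a]]]]]; try lia; destruct b as [|[|[|[|[|b]]]]]; try lia;
    unfold solP, solQ, mmul; cbn [sum_f_R0 Pmat Qmat];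
    rewrite ?du_opp, ?dv_opp, ?du_scal, ?dv_scal, ?du_const, ?dv_const;
    change (fun a b => e a b) with e;
    change (fun a b => half_sum A a b) with (half_sum A);
    change (fun a b => half_sum B a b) with (half_sum B);
    change (fun a b => half_sum W a b) with (half_sum W);
    change (fun a b => half_sum Y a b) with (half_sum Y);
    change (fun a b => half_diff W a b) with (half_diff W);
    change (fun a b => half_diff X a b) with (half_diff X);
    change (fun a b => half_diff Y a b) with (half_diff Y);
    change (fun a b => half_diff Z a b) with (half_diff Z);
    change (fun a b => half_diff An a b) with (half_diff An);
    change (fun a b => half_diff Bn a b) with (half_diff Bn);
    unfold An, Bn; rewrite ?dA1, ?dA2, ?dB1, ?dB2, ?dW1, ?dW2, ?dY1, ?dY2, ?hW1, ?hW2, ?hX1, ?hX2, ?hY1, ?hY2,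
      ?hZ1, ?hZ2, ?hA1, ?hA2, ?hB1, ?hB2, ?e1, ?e2;
    unfold half_sum, half_diff; cbn [negb]; rewrite ?SX', ?SZ'; lra.
Qed.

(** * Construction of the immersion from a flat orthogonal frame *)

Hypothesis SC : simply_connected_domain D.

Lemma e_neq0 u v : D (u, v) -> e u v <> 0.
Proof. intros Huv. apply Rgt_not_eq. now apply f_pos. Qed.

Lemma pairing_constant y z u v u' v' :
  flat_section 4 solP solQ D y -> flat_section 4 solP solQ D z -> D (u, v) -> D (u', v') ->
  pairing L0 (e u v) (y u v) (z u v) = pairing L0 (e u' v') (y u' v') (z u' v').
Proof.
  intros Hy Hz Huv Huv'.
  apply (partials_zero_constant D (fun u v => pairing L0 (e u v) (y u v) (z u v))
           (u, v) (u', v') SC); trivial.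
  intros a b Hab.
  destruct (smooth_on_partials D e e_smooth a b Hab) as [De1 De2].
  destruct (e_derive a b Hab) as [E1 E2].
  split.
  - apply (pairing_derive L0 (fun t => y t b) (fun t => z t b) (fun t => e t b) (solP a b) a
             (du e a b)); trivial.
    + now apply e_neq0.
    + intros k Hk. destruct (Hy a b k Hab Hk) as [H _]. exact H.
    + intros k Hk. destruct (Hz a b k Hab Hk) as [H _]. exact H.
    + left. do 7 eexists. split; [reflexivity|]. rewrite E1. ring.
  - apply (pairing_derive L0 (fun t => y a t) (fun t => z a t) (fun t => e a t) (solQ a b) b
             (dv e a b)); trivial.
    + now apply e_neq0.
    + intros k Hk. destruct (Hy a b k Hab Hk) as [_ H]. exact H.
    + intros k Hk. destruct (Hz a b k Hab Hk) as [_ H]. exact H.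
    + right. do 7 eexists. split; [reflexivity|]. rewrite E2. ring.
Qed.

(** The position vector is placed on axis 4, the timelike one when [L0 < 0], since its squared
    length [1 / L0] has the sign of [L0]; the other four vectors take the spacelike axes. *)
Definition initial_frame (e0 : R) (a : nat) : Vec :=
  fun k => match a with
           | O => kron k 4 * / sqrt (Rabs L0)
           | S b => kron k b * sqrt e0
           end.

Lemma initial_frame_orthogonal e0 :
  0 < e0 -> is_frame L0 (sqlen L0 e0) (initial_frame e0).
Proof.
  intros He.
  assert (HL : 0 < Rabs L0) by now apply Rabs_pos_lt.
  assert (Hs : 0 < sqrt (Rabs L0)) by now apply sqrt_lt_R0.
  assert (S : sgnL L0 * (/ sqrt (Rabs L0) * / sqrt (Rabs L0)) = / L0).
  { rewrite <- Rinv_mult, sqrt_sqrt by lra. unfold sgnL, Rabs.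
    destruct Rlt_dec, Rcase_abs; try lra; field; lra. }
  assert (Q : sqrt e0 * sqrt e0 = e0) by (apply sqrt_sqrt; lra).
  intros a b Ha Hb.
  destruct a as [|[|[|[|[|a]]]]]; try lia; destruct b as [|[|[|[|[|b]]]]]; try lia;
    unfold ip, initial_frame, kron, sqlen; cbn [Nat.eqb]; try ring;
    first [ rewrite <- S; ring
          | transitivity (sqrt e0 * sqrt e0); [ring | rewrite Q; ring] ].
Qed.

Definition flat_frame (E : nat -> R -> R -> Vec) : Prop :=
  (forall k, (k <= 4)%nat -> flat_section 4 solP solQ D (fun u v a => E a u v k)) /\
  (forall u v, D (u, v) -> is_frame L0 (sqlen L0 (e u v)) (fun a => E a u v)).

Lemma sqlen_e_neq0 u v a : D (u, v) -> sqlen L0 (e u v) a <> 0.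
Proof. intros Huv. apply sqlen_neq0; [exact L0_neq0 | now apply e_neq0]. Qed.

(** The columns are solved for independently. Their constant pairings carry the coframe relation
    from the base point to all of [D], and [coframe_frame] converts it into orthogonality of the
    frame vectors. *)
Lemma flat_frame_exists : exists E, flat_frame E.
Proof.
  pose proof SC as [_ [[[u0 v0] Hp] _]].
  assert (Hy : forall k, exists y, flat_section 4 solP solQ D y /\
            forall a, (a <= 4)%nat -> y u0 v0 a = initial_frame (e u0 v0) a k).
  { intros k. exact (flat_section_exists 4 D solP solQ openD solP_smooth solQ_smooth sol_integrable
      (u0, v0) (fun a => initial_frame (e u0 v0) a k) SC Hp). }
  set (y := fun k => proj1_sig (constructive_indefinite_description _ (Hy k))).
  assert (Y1 : forall k, flat_section 4 solP solQ D (y k) /\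
            forall a, (a <= 4)%nat -> y k u0 v0 a = initial_frame (e u0 v0) a k).
  { intros k. unfold y. destruct constructive_indefinite_description as [z Hz]. exact Hz. }
  exists (fun a u v k => y k u v a). split; [intros k _; apply Y1|].
  intros u v Huv.
  apply coframe_frame; [intros; now apply sqlen_e_neq0|].
  intros i j Hi Hj.
  transitivity (pairing L0 (e u0 v0) (y i u0 v0) (y j u0 v0)).
  { apply pairing_constant; trivial; apply Y1. }
  rewrite <- (frame_coframe L0 (sqlen L0 (e u0 v0)) (initial_frame (e u0 v0))); trivial.
  - apply sum_eq. intros a Ha. now rewrite !(proj2 (Y1 _)).
  - intros; now apply sqlen_e_neq0.
  - apply initial_frame_orthogonal. now apply f_pos.
Qed.

Section FlatFrame.
Variable E : nat -> R -> R -> Vec.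
Hypothesis HE : flat_frame E.

Lemma flat_frame_derive a u v k :
  D (u, v) -> (a <= 4)%nat -> (k <= 4)%nat ->
  dU (E a) u v k = mvmul 4 (solP u v) (fun b => E b u v k) a /\
  dV (E a) u v k = mvmul 4 (solQ u v) (fun b => E b u v k) a.
Proof.
  intros Huv Ha Hk. destruct (proj1 HE k Hk u v a Huv Ha) as [H1 H2].
  split; now apply is_derive_unique.
Qed.

(** Row 0 of [solP] and of [solQ] is a coordinate unit vector, so [E 1] and [E 2] are the partial
    derivatives of [E 0]. *)
Lemma flat_frame_eq a u v k :
  D (u, v) -> (a <= 4)%nat -> (k <= 4)%nat ->
  frame (E 0) (E 3) (E 4) a u v k = E a u v k.
Proof.
  intros Huv Ha Hk. destruct (flat_frame_derive 0 u v k Huv ltac:(lia) Hk) as [H1 H2].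
  destruct a as [|[|[|[|[|a]]]]]; try lia; cbn [frame]; try reflexivity.
  - unfold T1. rewrite H1. unfold mvmul, solP. cbn [sum_f_R0 Pmat]. ring.
  - unfold T2. rewrite H2. unfold mvmul, solQ. cbn [sum_f_R0 Qmat]. ring.
Qed.

Lemma flat_frame_smooth a : (a <= 4)%nat -> vsmooth_on D (E a).
Proof.
  intros Ha k Hk.
  exact (flat_section_smooth 4 D solP solQ _ openD solP_smooth solQ_smooth
           (proj1 HE k ltac:(lia)) a Ha).
Qed.

Lemma flat_frame_local_data : exists o, local_data L0 (E 0) lam (E 3) (E 4) D o.
Proof.
  set (rows := fun u v => rows5 (E 0 u v) (T1 (E 0) u v) (T2 (E 0) u v) (E 3 u v) (E 4 u v)).
  assert (Hrows : forall u v a k, (a <= 4)%nat ->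
            rows u v a k = frame (E 0) (E 3) (E 4) a u v k).
  { intros u v a k Ha. destruct a as [|[|[|[|[|a]]]]]; try lia; reflexivity. }
  assert (G : forall u v a b, D (u, v) -> (a <= 4)%nat -> (b <= 4)%nat ->
     ip L0 (frame (E 0) (E 3) (E 4) a u v) (frame (E 0) (E 3) (E 4) b u v)
     = sqlen L0 (e u v) a * kron a b).
  { intros u v a b Huv Ha Hb. rewrite <- (proj2 HE u v Huv a b Ha Hb).
    apply ip_ext; intros; now apply flat_frame_eq. }
  assert (smooth_rows : forall a k, (a < 5)%nat -> (k < 5)%nat -> smooth_on D (fun u v => rows u v a k)).
  { intros a k Ha Hk. apply (smooth_on_ext D openD (fun u v => E a u v k)).
    - intros u v Huv. rewrite Hrows, flat_frame_eq by (trivial; lia). reflexivity.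
    - apply flat_frame_smooth; lia. }
  destruct (nonvanishing_constant_sign D (fun u v => detn 5 (rows u v))) as [o [Ho Hdet]].
  - exact SC.
  - apply (Ck_cont 0). apply smooth_on_Ck; [exact openD|].
    exact (smooth_on_detn D 5 (fun i j u v => rows u v i j) openD smooth_rows).
  - intros u v Huv. apply (frame_detn_neq0 L0 (sqlen L0 (e u v))).
    + intros; now apply sqlen_e_neq0.
    + intros a b Ha Hb. rewrite <- (G u v a b Huv Ha Hb).
      apply ip_ext; intros; now apply Hrows.
  - exists o. unfold local_data.
    split; [apply flat_frame_smooth; lia|]. split; [exact lam_smooth|].
    split; [apply flat_frame_smooth; lia|]. split; [apply flat_frame_smooth; lia|].
    split; [exact Ho|]. intros u v Huv. rewrite e2l_lam by exact Huv.
    pose proof (fun a b Ha Hb => G u v a b Huv Ha Hb) as g.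
    pose proof (g 0%nat 0%nat ltac:(lia) ltac:(lia)) as g00.
    pose proof (g 1%nat 1%nat ltac:(lia) ltac:(lia)) as g11.
    pose proof (g 2%nat 2%nat ltac:(lia) ltac:(lia)) as g22.
    pose proof (g 1%nat 2%nat ltac:(lia) ltac:(lia)) as g12.
    pose proof (g 3%nat 0%nat ltac:(lia) ltac:(lia)) as g30.
    pose proof (g 4%nat 0%nat ltac:(lia) ltac:(lia)) as g40.
    pose proof (g 3%nat 1%nat ltac:(lia) ltac:(lia)) as g31.
    pose proof (g 3%nat 2%nat ltac:(lia) ltac:(lia)) as g32.
    pose proof (g 4%nat 1%nat ltac:(lia) ltac:(lia)) as g41.
    pose proof (g 4%nat 2%nat ltac:(lia) ltac:(lia)) as g42.
    pose proof (g 3%nat 3%nat ltac:(lia) ltac:(lia)) as g33.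
    pose proof (g 4%nat 4%nat ltac:(lia) ltac:(lia)) as g44.
    pose proof (g 3%nat 4%nat ltac:(lia) ltac:(lia)) as g34.
    unfold kron in *. cbn [frame sqlen Nat.eqb] in *. rewrite ?Rmult_1_r, ?Rmult_0_r in *.
    repeat (split; [assumption|]). exact (Hdet u v Huv).
Qed.

(** Both matrices express the derivatives of one and the same independent frame, so their entries
    coincide. *)
Lemma flat_frame_matrices o u v a b :
  local_data L0 (E 0) lam (E 3) (E 4) D o -> D (u, v) -> (a <= 4)%nat -> (b <= 4)%nat ->
  framePF L0 (E 0) lam (E 3) (E 4) u v a b = solP u v a b /\
  frameQF L0 (E 0) lam (E 3) (E 4) u v a b = solQ u v a b.
Proof.
  intros data Huv Ha Hb.
  assert (EU : forall k, (k <= 4)%nat -> dU (frame (E 0) (E 3) (E 4) a) u v k = dU (E a) u v k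
            /\ dV (frame (E 0) (E 3) (E 4) a) u v k = dV (E a) u v k).
  { intros k Hk. apply (dudv_ext D (fun u v => frame (E 0) (E 3) (E 4) a u v k)
      (fun u v => E a u v k) u v openD Huv). intros x y Hxy. now apply flat_frame_eq. }
  split; apply Rminus_diag_uniq.
  - apply (frame_independent L0 D (E 0) lam (E 3) (E 4) o L0_neq0 openD data u v
      (fun b => framePF L0 (E 0) lam (E 3) (E 4) u v a b - solP u v a b) b Huv Hb).
    intros k Hk.
    pose proof (proj1 (frame_structure L0 D (E 0) lam (E 3) (E 4) o L0_neq0 openD data u v a k
      Huv Ha Hk)) as H1.
    rewrite (proj1 (EU k Hk)), (proj1 (flat_frame_derive a u v k Huv Ha Hk)) in H1.
    symmetry in H1. apply Rminus_diag_eq in H1. unfold mvmul in H1. rewrite <- minus_sum in H1.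
    rewrite <- H1. apply sum_eq. intros c Hc. rewrite flat_frame_eq by assumption. ring.
  - apply (frame_independent L0 D (E 0) lam (E 3) (E 4) o L0_neq0 openD data u v
      (fun b => frameQF L0 (E 0) lam (E 3) (E 4) u v a b - solQ u v a b) b Huv Hb).
    intros k Hk.
    pose proof (proj2 (frame_structure L0 D (E 0) lam (E 3) (E 4) o L0_neq0 openD data u v a k
      Huv Ha Hk)) as H1.
    rewrite (proj2 (EU k Hk)), (proj2 (flat_frame_derive a u v k Huv Ha Hk)) in H1.
    symmetry in H1. apply Rminus_diag_eq in H1. unfold mvmul in H1. rewrite <- minus_sum in H1.
    rewrite <- H1. apply sum_eq. intros c Hc. rewrite flat_frame_eq by assumption. ring.
Qed.

Lemma flat_frame_functions o s u v :
  local_data L0 (E 0) lam (E 3) (E 4) D o -> D (u, v) ->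
  Wf L0 (E 0) lam (E 3) (E 4) s u v = W s u v /\ Xf L0 (E 0) lam (E 3) (E 4) s u v = X s u v /\
  Yf L0 (E 0) lam (E 3) (E 4) s u v = Y s u v /\ Zf L0 (E 0) lam (E 3) (E 4) s u v = Z s u v.
Proof.
  intros data Huv.
  pose proof (fun a b Ha Hb => flat_frame_matrices o u v a b data Huv Ha Hb) as M.
  pose proof (proj1 (M 1%nat 3%nat ltac:(lia) ltac:(lia))) as A1.
  pose proof (proj1 (M 1%nat 4%nat ltac:(lia) ltac:(lia))) as B1.
  pose proof (proj1 (M 2%nat 3%nat ltac:(lia) ltac:(lia))) as A2.
  pose proof (proj1 (M 2%nat 4%nat ltac:(lia) ltac:(lia))) as B2.
  pose proof (proj2 (M 2%nat 3%nat ltac:(lia) ltac:(lia))) as A3.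
  pose proof (proj2 (M 2%nat 4%nat ltac:(lia) ltac:(lia))) as B3.
  unfold framePF, frameQF, solP, solQ in *. cbn [Pmat Qmat] in *.
  unfold half_sum, half_diff in *.
  pose proof (sumWX u v Huv). pose proof (sumYZ u v Huv).
  unfold Wf, Xf, Yf, Zf. rewrite A1, B1, A2, B2, A3, B3.
  destruct s; cbn [sg]; repeat split; lra.
Qed.

End FlatFrame.

(** * Immersions with the given associated functions *)

Section MatchingData.
Variables (G M1 M2 : R -> R -> Vec) (o : R).
Hypothesis data : local_data L0 G lam M1 M2 D o.
Hypothesis matching : forall s u v, D (u, v) ->
  Wf L0 G lam M1 M2 s u v = W s u v /\ Xf L0 G lam M1 M2 s u v = X s u v /\
  Yf L0 G lam M1 M2 s u v = Y s u v /\ Zf L0 G lam M1 M2 s u v = Z s u v.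

Let WG := Wf L0 G lam M1 M2.
Let XG := Xf L0 G lam M1 M2.
Let YG := Yf L0 G lam M1 M2.
Let ZG := Zf L0 G lam M1 M2.

Lemma matching_Dlt s u v : D (u, v) -> Dlt WG XG YG ZG s u v = Dlt W X Y Z s u v.
Proof.
  intros Huv. destruct (matching s u v Huv) as [_ [E1 [E2 _]]].
  destruct (matching (negb s) u v Huv) as [E3 [_ [_ E4]]].
  unfold Dlt, WG, XG, YG, ZG. now rewrite E1, E2, E3, E4.
Qed.

(** The coefficients [mu1], [mu2] are not among the matched functions; they are recovered because
    [phif] and [psif] are determined by the associated functions through Cramer's rule. *)
Lemma matching_connection s u v : D (u, v) ->
  phif L0 G lam M1 M2 s u v = A s u v /\ psif L0 G lam M1 M2 s u v = B s u v.
Proof.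
  assert (H : forall t, D (u, v) ->
     phif L0 G lam M1 M2 t u v = A t u v /\ psif L0 G lam M1 M2 (negb t) u v = B (negb t) u v).
  { intros t Huv.
    assert (HD : Dlt WG XG YG ZG t u v <> 0) by (rewrite matching_Dlt; auto).
    destruct (frame_coefs L0 D G lam M1 M2 o L0_neq0 openD data t u v Huv HD) as [<- <-].
    assert (K1 : brk1 XG YG t u v = brk1 X Y t u v).
    { unfold brk1. f_equal; [|f_equal];
        apply (dudv_ext D _ _ u v openD Huv); intros; now apply matching. }
    assert (K2 : brk2 WG ZG t u v = brk2 W Z t u v).
    { unfold brk2. f_equal; [|f_equal];
        apply (dudv_ext D _ _ u v openD Huv); intros; now apply matching. }
    assert (KD := matching_Dlt t u v Huv).
    destruct (matching t u v Huv) as [_ [E1 [E2 _]]].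
    destruct (matching (negb t) u v Huv) as [E3 [_ [_ E4]]].
    unfold B, Bcoef, A. rewrite Bool.negb_involutive.
    split.
    - unfold Acoef. fold WG XG YG ZG. rewrite K1, K2, KD.
      unfold WG, XG, YG, ZG. now rewrite E1, E4.
    - unfold Bneg. fold WG XG YG ZG. rewrite K1, K2, KD.
      unfold WG, XG, YG, ZG. now rewrite E2, E3. }
  intros Huv. split; [now apply H|].
  rewrite <- (Bool.negb_involutive s). now apply H.
Qed.

Lemma matching_matrices u v : D (u, v) ->
  framePF L0 G lam M1 M2 u v = solP u v /\ frameQF L0 G lam M1 M2 u v = solQ u v.
Proof.
  intros Huv.
  destruct (matching true u v Huv) as [E1 [E2 [E3 E4]]].
  destruct (matching false u v Huv) as [F1 [F2 [F3 F4]]].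
  destruct (matching_connection true u v Huv) as [C1 C2].
  destruct (matching_connection false u v Huv) as [C3 C4].
  destruct (lam_derive u v Huv) as [L1 L2].
  unfold Wf, Xf, Yf, Zf, phif, psif in *. cbn [sg] in *.
  unfold framePF, frameQF, solP, solQ. rewrite e2l_lam, L1, L2 by exact Huv.
  unfold half_sum, half_diff, An, Bn in *. cbn [negb].
  split; f_equal; lra.
Qed.

Lemma matching_columns_flat k :
  (k <= 4)%nat -> flat_section 4 solP solQ D (fun u v a => frame G M1 M2 a u v k).
Proof.
  intros Hk u v a Huv Ha. destruct (matching_matrices u v Huv) as [<- <-].
  exact (frame_columns_flat L0 D G lam M1 M2 o L0_neq0 openD data k Hk u v a Huv Ha).
Qed.

Lemma matching_twistor_nondeg : twistor_nondeg L0 G lam M1 M2 D.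
Proof.
  intros s u v Huv.
  apply (twistor_independent_iff L0 D G lam M1 M2 o L0_neq0 openD data s u v Huv).
  fold WG XG YG ZG. rewrite matching_Dlt by exact Huv. now apply Dlt_neq0.
Qed.

(* If [C i j] is the constant pairing of column [i] of the first frame with column [j] of the
   second one, then the second frame is the first one times [J C], and [C] is [J]-orthogonal. *)
Lemma matching_congruent E :
  flat_frame E ->
  exists P, lin_isometry L0 P /\
    forall u v i, D (u, v) -> (i < 5)%nat -> G u v i = mapply P (E 0%nat u v) i.
Proof.
  intros HE. pose proof SC as [_ [[[u0 v0] Hp] _]].
  set (C := fun i j => pairing L0 (e u0 v0) (fun a => E a u0 v0 i)
                         (fun a => frame G M1 M2 a u0 v0 j)).
  assert (HC : forall u v i j, D (u, v) -> (i <= 4)%nat -> (j <= 4)%nat ->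
     sum_f_R0 (fun a => E a u v i * frame G M1 M2 a u v j / sqlen L0 (e u v) a) 4 = C i j).
  { intros u v i j Huv Hi Hj.
    apply (pairing_constant (fun u v a => E a u v i) (fun u v a => frame G M1 M2 a u v j)
             u v u0 v0); trivial; [now apply HE | now apply matching_columns_flat]. }
  assert (N : forall a, sqlen L0 (e u0 v0) a <> 0) by (intros; now apply sqlen_e_neq0).
  assert (FG : is_frame L0 (sqlen L0 (e u0 v0)) (fun a => frame G M1 M2 a u0 v0)).
  { rewrite <- e2l_lam by exact Hp.
    exact (frame_orthogonal L0 D G lam M1 M2 o openD data u0 v0 Hp). }
  assert (CE : is_coframe L0 (sqlen L0 (e u0 v0)) (fun a => E a u0 v0)).
  { apply frame_coframe; [exact N | now apply HE]. }
  (* With [E'] the second frame and [C = E^T g^-1 E']: [C J C^T = E^T g^-1 (E' J E'^T) g^-1 E = E^T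
     g^-1 E = J], first by [FG] and then by [CE]. *)
  assert (CC : forall i k, (i <= 4)%nat -> (k <= 4)%nat ->
     sum_f_R0 (fun j => Jsig L0 j * C i j * C k j) 4 = Jsig L0 i * kron i k).
  { intros i k Hi Hk. rewrite <- (CE i k Hi Hk).
    rewrite (sum_eq _ (fun j => sum_f_R0 (fun a =>
       (E a u0 v0 i / sqlen L0 (e u0 v0) a)
         * (Jsig L0 j * frame G M1 M2 a u0 v0 j * C k j)) 4)).
    - rewrite sum_f_R0_swap. apply sum_eq. intros a Ha.
      rewrite (sum_eq _ (fun j => (Jsig L0 j * frame G M1 M2 a u0 v0 j * C k j)
                 * (E a u0 v0 i / sqlen L0 (e u0 v0) a))) by (intros; ring).
      rewrite <- scal_sum.
      replace (sum_f_R0 (fun j => Jsig L0 j * frame G M1 M2 a u0 v0 j * C k j) 4)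
        with (E a u0 v0 k); [unfold Rdiv; ring|].
      rewrite (sum_eq _ (fun j => sum_f_R0 (fun b => (E b u0 v0 k / sqlen L0 (e u0 v0) b)
         * (Jsig L0 j * frame G M1 M2 a u0 v0 j * frame G M1 M2 b u0 v0 j)) 4)).
      + rewrite sum_f_R0_swap.
        rewrite (sum_eq _ (fun b => E b u0 v0 k * kron b a)).
        * symmetry. now apply (sum_f_R0_kron (fun b => E b u0 v0 k)).
        * intros b Hb.
          rewrite (sum_eq _ (fun j => (Jsig L0 j * frame G M1 M2 a u0 v0 j * frame G M1 M2 b u0 v0 j)
                     * (E b u0 v0 k / sqlen L0 (e u0 v0) b))) by (intros; ring).
          rewrite <- scal_sum, <- ip_sum, (FG a b Ha Hb), kron_sym.
          destruct (Nat.eq_dec a b) as [->|Hn]; [field; apply N|].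
          rewrite kron_neq by auto. ring.
      + intros j Hj. unfold C, pairing. rewrite scal_sum.
        apply sum_eq. intros; unfold Rdiv; ring.
    - intros j Hj. unfold C at 1, pairing.
      rewrite Rmult_assoc, (Rmult_comm (sum_f_R0 _ _)), <- Rmult_assoc, scal_sum.
      apply sum_eq. intros; unfold Rdiv; ring. }
  (* Acting on column vectors this matrix is [C^T J], and the isometry condition [P^T J P = J]
     reduces to [C J C^T = J]. *)
  exists (fun j i => C i j * Jsig L0 i). split.
  - intros x y. rewrite !ip_sum. unfold mapply.
    rewrite (sum_eq _ (fun j => sum_f_R0 (fun i => sum_f_R0 (fun k =>
       (Jsig L0 i * x i * (Jsig L0 k * y k)) * (Jsig L0 j * C i j * C k j)) 4) 4)).
    + rewrite sum_f_R0_swap. apply sum_eq. intros i Hi.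
      rewrite sum_f_R0_swap.
      rewrite (sum_eq _ (fun k => (Jsig L0 i * x i * y k * (Jsig L0 k * Jsig L0 i)) * kron k i)).
      * rewrite (sum_f_R0_kron (fun k => Jsig L0 i * x i * y k * (Jsig L0 k * Jsig L0 i)) i 4 Hi).
        rewrite Jsig_sqr. ring.
      * intros k Hk.
        rewrite (sum_eq _ (fun j => (Jsig L0 j * C i j * C k j)
                   * (Jsig L0 i * x i * (Jsig L0 k * y k)))) by (intros; ring).
        rewrite <- scal_sum, (CC i k Hi Hk), kron_sym. ring.
    + intros j Hj.
      rewrite Rmult_assoc, (Rmult_comm (sum_f_R0 _ _)), <- Rmult_assoc, scal_sum.
      apply sum_eq. intros i Hi.
      rewrite (Rmult_comm (C i j * Jsig L0 i * x i)), Rmult_assoc,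
        (Rmult_comm (sum_f_R0 _ _)), <- Rmult_assoc, scal_sum.
      apply sum_eq. intros; ring.
  - intros u v j Huv Hj. unfold mapply.
    rewrite (sum_eq _ (fun i => sum_f_R0 (fun a =>
       (frame G M1 M2 a u v j / sqlen L0 (e u v) a)
         * (Jsig L0 i * E 0%nat u v i * E a u v i)) 4)).
    + rewrite sum_f_R0_swap.
      rewrite (sum_eq _ (fun a => frame G M1 M2 a u v j * kron a 0)).
      * symmetry. apply (sum_f_R0_kron (fun a => frame G M1 M2 a u v j)). lia.
      * intros a Ha.
        rewrite (sum_eq _ (fun i => (Jsig L0 i * E 0%nat u v i * E a u v i)
                   * (frame G M1 M2 a u v j / sqlen L0 (e u v) a))) by (intros; ring).
        rewrite <- scal_sum, <- ip_sum, (proj2 HE u v Huv 0%nat a ltac:(lia) Ha), kron_sym.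
        destruct (Nat.eq_dec a 0) as [->|Hn].
        -- field. now apply sqlen_e_neq0.
        -- rewrite kron_neq by exact Hn. ring.
    + intros i Hi. rewrite <- (HC u v i j Huv Hi ltac:(lia)).
      rewrite Rmult_assoc, Rmult_comm, scal_sum.
      apply sum_eq. intros; unfold Rdiv; ring.
Qed.

End MatchingData.
End Existence.

Theorem theorem2p4 :
  (* (1) *)
  (forall (L0 : R) (D : R * R -> Prop) (F : R -> R -> Vec) (lam : R -> R -> R)
          (N1 N2 : R -> R -> Vec) (o : R),
      L0 <> 0 -> open D ->
      local_data L0 F lam N1 N2 D o ->
      twistor_nondeg L0 F lam N1 N2 D ->
      let W := Wf L0 F lam N1 N2 in let X := Xf L0 F lam N1 N2 in
      let Y := Yf L0 F lam N1 N2 in let Z := Zf L0 F lam N1 N2 in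
      let f := fun u v => L0 * e2l lam u v in
      forall u v, D (u, v) ->
        (forall s, Dlt W X Y Z s u v <> 0) /\
        (forall s, Acoef W X Y Z s u v = phif L0 F lam N1 N2 s u v) /\
        (forall s, Bcoef W X Y Z s u v = psif L0 F lam N1 N2 s u v) /\
        du f u v = f u v * (Acoef W X Y Z true u v + Acoef W X Y Z false u v) /\
        dv f u v = f u v * (Bcoef W X Y Z true u v + Bcoef W X Y Z false u v))
  /\
  (* (2) *)
  (forall (L0 : R) (D : R * R -> Prop) (W X Y Z : bool -> R -> R -> R),
      L0 <> 0 -> simply_connected_domain D ->
      (forall s, smooth_on D (W s) /\ smooth_on D (X s) /\
                 smooth_on D (Y s) /\ smooth_on D (Z s)) ->
      (forall u v, D (u, v) ->
         W true u v + W false u v = X true u v + X false u v /\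
         Y true u v + Y false u v = Z true u v + Z false u v /\
         (forall s, Dlt W X Y Z s u v <> 0) /\
         Dlt W X Y Z true u v - Dlt W X Y Z false u v =
           du (fun a b => Acoef W X Y Z true a b - Acoef W X Y Z false a b) u v
           - dv (fun a b => Bcoef W X Y Z true a b - Bcoef W X Y Z false a b) u v) ->
      let f := fun u v => Dlt W X Y Z true u v - du (Acoef W X Y Z true) u v
                          - dv (Bcoef W X Y Z false) u v in
      (forall u v, D (u, v) ->
         f u v <> 0 /\ f u v / L0 > 0 /\
         du f u v = f u v * (Acoef W X Y Z true u v + Acoef W X Y Z false u v) /\
         dv f u v = f u v * (Bcoef W X Y Z true u v + Bcoef W X Y Z false u v)) ->
      let lam := fun u v => / 2 * ln (f u v / L0) in
      exists (F : R -> R -> Vec) (N1 N2 : R -> R -> Vec) (o : R),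
        local_data L0 F lam N1 N2 D o /\
        (forall s u v, D (u, v) ->
           Wf L0 F lam N1 N2 s u v = W s u v /\ Xf L0 F lam N1 N2 s u v = X s u v /\
           Yf L0 F lam N1 N2 s u v = Y s u v /\ Zf L0 F lam N1 N2 s u v = Z s u v) /\
        twistor_nondeg L0 F lam N1 N2 D /\
        (forall (G : R -> R -> Vec) (M1 M2 : R -> R -> Vec) (o' : R),
           local_data L0 G lam M1 M2 D o' ->
           (forall s u v, D (u, v) ->
              Wf L0 G lam M1 M2 s u v = W s u v /\ Xf L0 G lam M1 M2 s u v = X s u v /\
              Yf L0 G lam M1 M2 s u v = Y s u v /\ Zf L0 G lam M1 M2 s u v = Z s u v) ->
           exists P : nat -> nat -> R,
             lin_isometry L0 P /\
             forall u v i, D (u, v) -> (i < 5)%nat -> G u v i = mapply P (F u v) i)).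
Proof.
  split.
  - intros L0 D F lam N1 N2 o HL openD data nondeg W X Y Z f u v Huv.
    assert (HD : forall s, Dlt W X Y Z s u v <> 0).
    (* The lift of sign [negb s] is the one that governs [Dlt s]. *)
    { intros s. rewrite <- (Bool.negb_involutive s).
      apply (twistor_independent_iff L0 D F lam N1 N2 o HL openD data (negb s) u v Huv).
      now apply nondeg. }
    assert (HA : forall s, Acoef W X Y Z s u v = phif L0 F lam N1 N2 s u v).
    { intros s.
      now apply (frame_coefs L0 D F lam N1 N2 o HL openD data s u v Huv). }
    assert (HB : forall s, Bcoef W X Y Z s u v = psif L0 F lam N1 N2 s u v).
    { intros s. unfold Bcoef. rewrite <- (Bool.negb_involutive s) at 2.
      now apply (frame_coefs L0 D F lam N1 N2 o HL openD data (negb s) u v Huv). }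
    destruct (du_conformal_factor L0 D F lam N1 N2 o data u v Huv) as [Hu Hv].
    split; [exact HD|]. split; [exact HA|]. split; [exact HB|].
    (* In the sum over the two signs the [mu] terms cancel, leaving [2 * du lam] and
       [2 * dv lam]. *)
    rewrite !HA, !HB. unfold phif, psif, f in *. cbn [sg].
    split; [rewrite Hu | rewrite Hv]; ring.
  - intros L0 D W X Y Z HL SC smoothWXYZ compat f Hf lam.
    pose proof (proj1 SC) as openD.
    assert (sumWX : forall u v, D (u, v) -> W true u v + W false u v = X true u v + X false u v)
      by (intros u v Huv; apply (compat u v Huv)).
    assert (sumYZ : forall u v, D (u, v) -> Y true u v + Y false u v = Z true u v + Z false u v)
      by (intros u v Huv; apply (compat u v Huv)).
    assert (HD : forall u v s, D (u, v) -> Dlt W X Y Z s u v <> 0)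
      by (intros u v s Huv; apply (compat u v Huv)).
    pose proof (fun u v Huv => proj2 (proj2 (proj2 (compat u v Huv)))) as ricci.
    pose proof (fun u v Huv => proj1 (proj2 (Hf u v Huv))) as f_pos.
    pose proof (fun u v Huv => proj1 (proj2 (proj2 (Hf u v Huv)))) as f_du.
    pose proof (fun u v Huv => proj2 (proj2 (proj2 (Hf u v Huv)))) as f_dv.
    destruct (flat_frame_exists L0 D W X Y Z HL openD smoothWXYZ sumWX sumYZ HD ricci f_pos
                f_du f_dv SC) as [E HE].
    destruct (flat_frame_local_data L0 D W X Y Z HL openD smoothWXYZ HD f_pos SC E HE)
      as [o data].
    pose proof (fun s u v Huv => flat_frame_functions L0 D W X Y Z HL openD sumWX sumYZ
                E HE o s u v data Huv) as functions.
    exists (E 0%nat), (E 3%nat), (E 4%nat), o.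
    split; [exact data|]. split; [exact functions|]. split.
    + exact (matching_twistor_nondeg L0 D W X Y Z HL openD HD _ _ _ o data functions).
    + intros G M1 M2 o' dataG functionsG.
      exact (matching_congruent L0 D W X Y Z HL openD smoothWXYZ HD f_pos f_du f_dv SC
               G M1 M2 o' dataG functionsG E HE).
Qed.
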